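(* Fix the dimension $d$ and a sparsity parameter $\zeta\in(0,d]$. Let $\psi$ be a real random variable with $\mathbb{E}\psi=0$, $\operatorname{Var}\psi=1$ and $\mathbb{E}|\psi|^4=C$. Define the random vector \[ w=\sqrt{d/\zeta}\,(\xi_1\psi_1,\dots,\xi_d\psi_d)^{\mathsf T}\in\mathbb{R}^d, \] where $\xi_i\sim\textsc{bernoulli}(\zeta/d)$ are iid, $\psi_i$ are iid copies of $\psi$, and all are independent. Let $\varepsilon,\delta\in(0,1)$, and suppose \[ n\ge\frac{25d\,\big(1\vee(2C\zeta^{-1}\log(2d/\delta))\big)}{\varepsilon^2}. \] Let $\widehat K_n=\frac1n\sum_{i=1}^nw_iw_i^{\mathsf T}$ with $w_1,\dots,w_n$ iid copies of $w$. Then with probability at least $1-\delta$, $\lambda_{\min}(\widehat K_n)>1-\varepsilon$.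
   Context: $x\vee y=\max\{x,y\}$; $\lambda_{\min}$ is the minimum eigenvalue. *)

(* Defs.v *)
From HB Require Import structures.
From mathcomp Require Import all_boot all_order all_algebra.
From mathcomp Require Import all_classical all_reals all_analysis.
Set Implicit Arguments. Unset Strict Implicit. Unset Printing Implicit Defensive.
Import Order.TTheory GRing.Theory Num.Theory.
Local Open Scope classical_set_scope.
Local Open Scope ring_scope.

Definition mutually_independent (d : measure_display) (T : measurableType d)
  (R : realType) (P : probability T R) (I : finType) (X : I -> T -> R) : Prop :=
  forall (J : {set I}) (B : I -> set R), (forall i, measurable (B i)) ->
    P (\bigcap_(i in [set i | i \in J]) (X i @^-1` B i)) =
    (\prod_(i in J) P (X i @^-1` B i))%E.

(* Minimum eigenvalue of a square real matrix (infimum of its real eigenvalues;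
   for symmetric matrices this is the usual lambda_min). *)
Definition lambda_min (R : realType) (n : nat) (A : 'M[R]_n) : R :=
  inf [set a : R | eigenvalue A a].

Definition xipsi_family (d : measure_display) (T : measurableType d)
  (R : realType) (P : probability T R) (n dim : nat)
  (xi psi : 'I_n -> 'I_dim -> {RV P >-> R}) :
  ('I_n * 'I_dim * bool)%type -> T -> R :=
  fun k => if k.2 then psi k.1.1 k.1.2 else xi k.1.1 k.1.2.

(* Main.v *)
(* Let [Y] be the sum of the matrices [w_i w_i^T] and [m] a large even number.
   An eigenvalue [a] of the sample covariance gives
   [exp (- theta n a) <= (1 + theta n a / m) ^- m <= tr (1 + (theta / m) Y) ^- m],
   so by Markov's inequality it suffices to bound the mean of this trace by
   [delta * exp (- theta n (1 - 0.99 eps))]. The rows are exchanged one at a time.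
   The second-order resolvent expansion of the trace in one row involves only the
   moments of order two and four of [w], where [E w_j^4 = kappa = C d / zeta]; its
   quartic term splits into the one of a random sign vector and [kappa - 1] times a
   diagonal term. If [d <= 20 kappa] the former is bounded through the dimension.
   If [d > 20 kappa] it is cancelled by subtracting from the matrix the outer square
   of a sign vector, so that after [n] steps the sample has been replaced by the
   exponential moment of a sum of [n] such squares; the top eigenvalue of that sum
   is controlled by a partition function over a lattice of half-integer points. *)
Require Import Defs.
From HB Require Import structures.
From mathcomp Require Import all_boot all_order all_algebra.
From mathcomp Require Import all_classical all_reals all_analysis.
From mathcomp Require Import measurable_realfun.
From mathcomp Require Import ring lra zify.
Set Implicit Arguments. Unset Strict Implicit. Unset Printing Implicit Defensive.
Import Order.TTheory GRing.Theory Num.Theory.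
Import numFieldNormedType.Exports.
Local Open Scope ring_scope.

(** * Traces of powers of the resolvent *)

(** In the sample size the logarithm multiplies [kappa] but not [d], and this shapes the proof.
    Iterating the second-order bound directly costs [theta ^+ 2 / 2 * (kappa - 1 + d)] per row; this
    forces [theta] of order [eps / (kappa + d)] and hence [n * eps ^+ 2] of order
    [(kappa + d) * log], affordable only when [d] is at most a multiple of [kappa]. Otherwise
    [theta = eps / (10 * kappa)], and the dimension is paid once, without a logarithm, in the
    exponential moment of the noise, against [n * eps ^+ 2 >= 25 * d]. As [kappa >= 1], the
    threshold 20 also guarantees [d >= 21] in that case, which the lattice estimate needs.

    Powers of a resolvent replace the matrix exponential because a rank-one change of an inverse
    obeys exact identities whose second-order remainder has a sign; hence four moments suffice. The
    finite power costs at most [2 * theta * d / m] per row, which vanishes with [m], so [m] is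
    chosen last. Matrices are handled through quadratic forms only, without diagonalisation. *)

Section ResolventAlgebra.
Variables (R : realFieldType) (d : nat).
Local Notation M := 'M[R]_d.+1.
Local Notation cV := 'cV[R]_d.+1.
Implicit Types (A B C : M) (x y w : cV).

Definition bform A x y : R := (x^T *m A *m y) 0 0.
Definition qform A x : R := bform A x x.
Definition nrm2 x : R := qform 1 x.
Definition outer x : M := x *m x^T.

(** The order relation between [c] times the identity and [C], expressed by quadratic forms.
    Symmetry is bundled since every statement about the inverse relies on it. *)
Definition coercive (c : R) C := C^T = C /\ forall x, c * nrm2 x <= qform C x.

Lemma bformE A x y : bform A x y = \sum_i \sum_j A i j * (x i 0 * y j 0).
Proof.
rewrite /bform mxE exchange_big; apply: eq_bigr => j _.
by rewrite mxE mulr_suml; apply: eq_bigr => i _; rewrite !mxE; ring.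
Qed.

Lemma qformE A x : qform A x = \sum_i \sum_j A i j * (x i 0 * x j 0).
Proof. exact: bformE. Qed.

Lemma nrm2E x : nrm2 x = \sum_i x i 0 ^+ 2.
Proof.
rewrite /nrm2 /qform /bform mulmx1 mxE; apply: eq_bigr => i _.
by rewrite mxE expr2.
Qed.

Lemma nrm2_ge0 x : 0 <= nrm2 x.
Proof. by rewrite nrm2E; apply: sumr_ge0 => i _; rewrite sqr_ge0. Qed.

Lemma nrm2_eq0 x : (nrm2 x == 0) = (x == 0).
Proof.
apply/idP/eqP => [|->]; last by rewrite nrm2E big1 // => i _; rewrite mxE expr0n.
rewrite nrm2E psumr_eq0 => [/allP x0|i _]; last exact: sqr_ge0.
apply/matrixP => i j; rewrite ord1 mxE.
by have := x0 i (mem_index_enum i); rewrite sqrf_eq0 => /eqP.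
Qed.

Lemma bformD A x y z : bform A x (y + z) = bform A x y + bform A x z.
Proof. by rewrite /bform mulmxDr mxE. Qed.

Lemma bformC A x y : A^T = A -> bform A x y = bform A y x.
Proof.
move=> sA; rewrite /bform.
have -> : (x^T *m A *m y) 0 0 = ((x^T *m A *m y)^T) 0 0 by rewrite [RHS]mxE.
by rewrite !trmx_mul sA trmxK mulmxA.
Qed.

Lemma bformZr A x a y : bform A x (a *: y) = a * bform A x y.
Proof. by rewrite /bform -scalemxAr mxE. Qed.

Lemma qform_add A B x : qform (A + B) x = qform A x + qform B x.
Proof. by rewrite /qform /bform mulmxDr mulmxDl mxE. Qed.
Lemma qform_scale a A x : qform (a *: A) x = a * qform A x.
Proof. by rewrite /qform /bform -scalemxAr -scalemxAl mxE. Qed.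
Lemma qform_opp A x : qform (- A) x = - qform A x.
Proof. by rewrite -scaleN1r qform_scale mulN1r. Qed.
Lemma qform_outer w x : qform (outer w) x = (\sum_i w i 0 * x i 0) ^+ 2.
Proof.
rewrite /qform /bform /outer mulmxA -mulmxA mxE big_ord1 expr2.
congr (_ * _); rewrite !mxE; apply: eq_bigr => i _; rewrite !mxE //.
exact: mulrC.
Qed.

Lemma qform_scalev A a x : qform A (a *: x) = a ^+ 2 * qform A x.
Proof.
rewrite /qform bformZr /bform [(a *: x)^T]linearZ /= -!scalemxAl mxE.
by rewrite expr2 mulrA.
Qed.

Lemma qform_mulmx A B x : B^T = B -> qform A (B *m x) = qform (B * A * B) x.
Proof. by move=> sB; rewrite /qform /bform trmx_mul sB !mulmxA. Qed.

Lemma bform_mulmx A B x y : B^T = B -> bform A (B *m x) y = bform (B * A) x y.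
Proof. by move=> sB; rewrite /bform trmx_mul sB !mulmxA. Qed.

Lemma trmx_expr A k : (A ^+ k)^T = A^T ^+ k.
Proof.
elim: k => [|k IH]; first by rewrite !expr0 trmx1.
by rewrite exprS exprSr -IH; exact: trmx_mul.
Qed.

Lemma sym_expr A k : A^T = A -> (A ^+ k)^T = A ^+ k.
Proof. by move=> sA; rewrite trmx_expr sA. Qed.

Lemma sym_outer x : (outer x)^T = outer x.
Proof. by rewrite /outer trmx_mul trmxK. Qed.

Lemma mxtrace_outer A x : \tr (A * outer x) = qform A x.
Proof.
rewrite /outer /qform /bform -[LHS]/(\tr (A *m (x *m x^T))).
by rewrite mulmxA mxtrace_mulC mulmxA /mxtrace big_ord1.
Qed.

Lemma outer_sandwich A B x y z :
  bform (A * outer z * B) x y = bform A x z * bform B z y.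
Proof.
rewrite /bform /outer -[A * _ * B]/(A *m (z *m z^T) *m B) !mulmxA.
by rewrite -2!mulmxA [LHS]mxE big_ord1 -!mulmxA.
Qed.

Definition unitv (i : 'I_d.+1) : cV := delta_mx i 0.

Lemma qform_unitv A i : qform A (unitv i) = A i i.
Proof.
rewrite qformE (bigD1 i) //= [X in _ + X]big1 => [|k ki]; last first.
  by apply: big1 => j _; rewrite [unitv i k 0]mxE (negPf ki) mul0r mulr0.
rewrite addr0 (bigD1 i) //= big1 => [|j ji]; last first.
  by rewrite [unitv i j 0]mxE (negPf ji) !mulr0.
by rewrite !mxE !eqxx !mulr1 addr0.
Qed.

Lemma nrm2_unitv i : nrm2 (unitv i) = 1.
Proof. by rewrite /nrm2 qform_unitv mxE eqxx. Qed.

Lemma trace_unitv A : \tr A = \sum_i qform A (unitv i).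
Proof. by apply: eq_bigr => i _; rewrite qform_unitv. Qed.

Lemma coercive_psd c C x : 0 <= c -> coercive c C -> 0 <= qform C x.
Proof. by move=> c0 [_ /(_ x)]; apply: le_trans; rewrite mulr_ge0 ?nrm2_ge0. Qed.

Lemma coercive_unit c C : 0 < c -> coercive c C -> C \is a GRing.unit.
Proof.
move=> c0 [sC Cc]; rewrite -[_ \is a _]/(C \in unitmx) unitmxE unitfE.
apply/negP => /det0P [v v0 vC]; have := Cc v^T.
rewrite /qform /bform trmxK vC mul0mx mxE pmulr_rle0 // => v_le0.
have /eqP := le_anti (introT andP (conj v_le0 (nrm2_ge0 _))).
by rewrite nrm2_eq0 -(inj_eq trmx_inj) trmxK trmx0 (negPf v0).
Qed.

Lemma cauchy_schwarz_psd A x y : A^T = A -> (forall z, 0 <= qform A z) ->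
  bform A x y ^+ 2 <= qform A x * qform A y.
Proof.
move=> sA pA.
have pos t : 0 <= qform A x + 2 * t * bform A x y + t ^+ 2 * qform A y.
  have := pA (x + t *: y); rewrite /qform bformD bformZr.
  by rewrite ![bform A (x + _) _](bformC _ _ sA) !bformD !bformZr (bformC y x sA);
     congr (0 <= _); ring.
have [y0|yN0] := eqVneq (qform A y) 0.
  have [->|bN0] := eqVneq (bform A x y) 0; first by rewrite y0 mulr0 expr0n.
  (* Without a quadratic term the polynomial is affine in [t]; at this [t] it equals [-1]. *)
  have := pos (- (qform A x + 1) / (2 * bform A x y)).
  have -> : 2 * (- (qform A x + 1) / (2 * bform A x y)) * bform A x y =
    - (qform A x + 1) by field.
  by rewrite y0 mulr0; lra.
have y_gt0 : 0 < qform A y by rewrite lt_neqAle eq_sym yN0 pA.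
have := pos (- bform A x y / qform A y).
have -> : qform A x + 2 * (- bform A x y / qform A y) * bform A x y +
   (- bform A x y / qform A y) ^+ 2 * qform A y =
   (qform A x * qform A y - bform A x y ^+ 2) / qform A y by field.
by rewrite pmulr_lge0 ?invr_gt0 // subr_ge0.
Qed.

Lemma sym_inv C : C^T = C -> (C^-1)^T = C^-1.
Proof. by move=> sC; rewrite -[LHS]/((invmx C)^T) trmx_inv sC. Qed.

Lemma qform_expr A a b x : A^T = A ->
  qform (A ^+ (a + b + a)) x = qform (A ^+ b) (A ^+ a *m x).
Proof. by move=> sA; rewrite qform_mulmx ?sym_expr // !exprD. Qed.

Lemma qform_expr_double A a x : A^T = A ->
  qform (A ^+ a.*2) x = nrm2 (A ^+ a *m x).
Proof. by move=> sA; rewrite -addnn -{1}(addn0 a) qform_expr. Qed.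

Lemma psd_expr A a x : A^T = A -> (forall z, 0 <= qform A z) ->
  0 <= qform (A ^+ a) x.
Proof.
move=> sA pA; rewrite -(odd_double_half a) -addnn addnCA addnA qform_expr //.
by case: (odd a); [exact: pA | exact: nrm2_ge0].
Qed.

Section Inverse.
Variables (c : R) (C : M).
Hypotheses (c0 : 0 < c) (Cc : coercive c C).

Local Notation G := (C^-1).

Let sG : G^T = G. Proof. by apply: sym_inv; case: Cc. Qed.
Let uC : C \is a GRing.unit. Proof. exact: coercive_unit Cc. Qed.

Lemma qform_inv x : qform G x = qform C (G *m x).
Proof. by rewrite qform_mulmx // mulVr // mul1r. Qed.

Lemma inv_psd x : 0 <= qform G x.
Proof. by rewrite qform_inv; apply: coercive_psd (ltW c0) Cc. Qed.

Lemma inv_expr_psd a x : 0 <= qform (G ^+ a) x.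
Proof. by apply: psd_expr => //; apply: inv_psd. Qed.

(** At [y = G *m x] coercivity reads [c * nrm2 y <= bform 1 x y], and Cauchy-Schwarz bounds the
    right side by the product of the two norms. *)
Lemma nrm2_inv x : nrm2 (G *m x) <= c ^- 2 * nrm2 x.
Proof.
set y := G *m x; have [_ /(_ y) Cy] := Cc.
have CyE : qform C y = bform 1 x y.
  by rewrite -qform_inv /qform /bform mulmx1 mulmxA.
have := cauchy_schwarz_psd x y (trmx1 _ _) nrm2_ge0.
rewrite -CyE -/(nrm2 x) -/(nrm2 y) => CS.
have y_ge0 := nrm2_ge0 y; have x_ge0 := nrm2_ge0 x.
rewrite mulrC ler_pdivlMr ?exprn_gt0 //.
have [y0|yN0] := eqVneq (nrm2 y) 0; first by rewrite y0 mul0r.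
have y_gt0 : 0 < nrm2 y by rewrite lt_neqAle eq_sym yN0.
rewrite -(ler_pM2r y_gt0); apply: le_trans CS.
have -> : nrm2 y * c ^+ 2 * nrm2 y = (c * nrm2 y) ^+ 2 by ring.
by rewrite ler_pXn2r ?nnegrE // ?mulr_ge0 // ?(ltW c0) // (coercive_psd _ (ltW c0) Cc).
Qed.

(** Even exponents turn the form of a power into a squared norm, to which [nrm2_inv] applies; each
    use lowers the exponent by two. *)
Lemma qform_inv_exprD2 a x : qform (G ^+ (a.*2 + 2)) x <= c ^- 2 * qform (G ^+ a.*2) x.
Proof.
rewrite addn2 -doubleS !qform_expr_double // exprS.
by have := nrm2_inv (G ^+ a *m x); rewrite mulmxA.
Qed.

Lemma trace_inv_exprD2 a : \tr (G ^+ (a.*2 + 2)) <= c ^- 2 * \tr (G ^+ a.*2).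
Proof.
rewrite !trace_unitv mulr_sumr; apply: ler_sum => i _; exact: qform_inv_exprD2.
Qed.

Lemma trace_inv_expr a : \tr (G ^+ a.*2) <= d.+1%:R * (c ^- a.*2).
Proof.
elim: a => [|a IH]; first by rewrite !expr0 mxtrace1 invr1 mulr1.
rewrite doubleS -addn2; apply: le_trans (trace_inv_exprD2 _) _.
apply: le_trans (ler_wpM2l _ IH) _; first by rewrite invr_ge0 exprn_ge0 // ltW.
have -> : c ^- (a.*2 + 2) = c ^- 2 * c ^- a.*2 by rewrite exprD invfM mulrC.
by rewrite mulrCA.
Qed.

Lemma trace_inv_psd a : 0 <= \tr (G ^+ a).
Proof. by rewrite trace_unitv; apply: sumr_ge0 => i _; exact: inv_expr_psd. Qed.

End Inverse.

(* The sequence [a |-> tr (G ^+ a)] is convex and starts at the dimension. *)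
Lemma trace_inv_telescope C (c : R) N : 0 < c -> coercive c C ->
  \tr (C^-1 ^+ N) - \tr (C^-1 ^+ N.+1) <= d.+1%:R / N.+1%:R.
Proof.
move=> c0 Cc; set G := C^-1.
have sG : G^T = G by apply: sym_inv; case: Cc.
pose u a := \tr (G ^+ a) - \tr (G ^+ a.+1).
have uS a : u a.+1 <= u a.
  rewrite -subr_ge0 /u.
  (* The second difference is the trace of a positive form conjugated by [1 - G], hence
     nonnegative. *)
  have -> : \tr (G ^+ a) - \tr (G ^+ a.+1) - (\tr (G ^+ a.+1) - \tr (G ^+ a.+2)) =
     \tr ((1 - G) * G ^+ a * (1 - G)).
    have -> : (1 - G) * G ^+ a * (1 - G) = G ^+ a - G ^+ a.+1 - (G ^+ a.+1 - G ^+ a.+2).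
      by rewrite mulrBr mulr1 !mulrBl !mul1r -!exprS -!exprSr.
    by rewrite !linearB.
  rewrite trace_unitv; apply: sumr_ge0 => i _.
  rewrite -qform_mulmx; last by rewrite linearB /= trmx1 sG.
  exact: inv_expr_psd Cc _ _.
have u_ge a : (a <= N)%N -> u N <= u a.
  move=> aN; rewrite -(subnK aN); elim: (N - a)%N => // k IH.
  by rewrite addSn (le_trans (uS _)).
(* The last of [N.+1] decreasing increments is at most their average, and their sum telescopes to at
   most [\tr 1]. *)
have : \sum_(a < N.+1) u N <= \sum_(a < N.+1) u a.
  by apply: ler_sum => a _; rewrite u_ge // -ltnS.
have -> : \sum_(a < N.+1) u a = \tr (G ^+ 0) - \tr (G ^+ N.+1).
  elim: N {u_ge} => [|n IH]; first by rewrite big_ord_recr big_ord0 /= add0r.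
  by rewrite big_ord_recr /= IH /u; ring.
rewrite sumr_const card_ord => h.
rewrite -/(u N) ler_pdivlMr ?ltr0n // mulr_natr.
apply: le_trans h _; rewrite expr0 mxtrace1 gerBl.
exact: trace_inv_psd Cc _.
Qed.

Lemma qform_expr_log_convex A x a : A^T = A -> (forall z, 0 <= qform A z) ->
  qform (A ^+ a.+1) x ^+ 2 <= qform (A ^+ a) x * qform (A ^+ a.+2) x.
Proof.
move=> sA pA.
have := cauchy_schwarz_psd x (A *m x) (sym_expr a sA) (fun z => psd_expr a z sA pA).
by rewrite (bformC _ _ (sym_expr a sA)) bform_mulmx // qform_mulmx // -exprS -exprSr.
Qed.

(** The numbers [qform (A ^+ k) x] are the moments of the spectral measure of [x], carried by the
    half-line, where powers are positively correlated. Log-convexity of the moments replaces the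
    spectral measure in the proof. *)
Lemma qform_expr_chebyshev A x a b : A^T = A -> (forall z, 0 <= qform A z) ->
  qform (A ^+ a) x * qform (A ^+ b) x <= nrm2 x * qform (A ^+ (a + b)) x.
Proof.
move=> sA pA; pose p k := qform (A ^+ k) x.
have p0 k : 0 <= p k by exact: psd_expr.
have lc k : p k.+1 ^+ 2 <= p k * p k.+2 by exact: qform_expr_log_convex.
(* The ratios [p k.+1 / p k] increase, stated without division. If [p (k + l)] vanishes,
   log-convexity makes the next moment vanish too. *)
have step k l : p k.+1 * p (k + l)%N <= p k * p (k + l).+1%N.
  elim: l => [|l IH]; first by rewrite addn0 mulrC.
  rewrite addnS.
  have [z|zN] := eqVneq (p (k + l).+1%N) 0.
    by rewrite z mulr0 mulr_ge0.
  have z0 : 0 < p (k + l).+1%N by rewrite lt_neqAle eq_sym zN p0.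
  have [y|yN] := eqVneq (p (k + l)%N) 0.
    by have := lc (k + l)%N; rewrite y mul0r; have := exprn_gt0 2 z0; lra.
  have y0 : 0 < p (k + l)%N by rewrite lt_neqAle eq_sym yN p0.
  rewrite -(ler_pM2r y0).
  have := ler_wpM2r (ltW z0) IH; have := ler_wpM2l (p0 k) (lc (k + l)%N).
  lra.
rewrite -/(p a) -/(p b) -/(p (a + b)%N) -[nrm2 x]/(p 0).
elim: a => [|a IH]; first by rewrite add0n.
have [z|zN] := eqVneq (p a) 0.
  have : p a.+1 ^+ 2 <= 0 by apply: le_trans (lc a) _; rewrite z mul0r.
  rewrite le_eqVlt ltNge sqr_ge0 orbF sqrf_eq0 => /eqP ->.
  by rewrite mul0r mulr_ge0.
have a0 : 0 < p a by rewrite lt_neqAle eq_sym zN p0.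
rewrite -(ler_pM2r a0) addSn.
have := ler_wpM2l (p0 a.+1) IH; have := ler_wpM2l (p0 0%N) (step a b).
lra.
Qed.
Lemma qform_sum (I : finType) (F : I -> M) x :
  qform (\sum_i F i) x = \sum_i qform (F i) x.
Proof.
apply: (big_morph (fun A => qform A x)) => [A B|]; first exact: qform_add.
by rewrite /qform /bform mulmx0 mul0mx mxE.
Qed.

(** [g l] occurs [N - l] times and its mirror image [l] times, so on average each value is counted
    [N / 2] times. *)
Lemma sum_triangle_sym N (g : nat -> R) :
  (forall l, (l <= N)%N -> g (N - l)%N = g l) ->
  \sum_(i < N) \sum_(l < i.+1) g l = 2^-1 * N%:R * \sum_(l < N.+1) g l.
Proof.
move=> gS.
have tri n : \sum_(i < n) \sum_(l < i.+1) g l = \sum_(l < n.+1) (n%:R - l%:R) * g l.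
  elim: n => [|n IH]; first by rewrite big_ord0 big_ord1 subrr mul0r.
  rewrite big_ord_recr /= IH [RHS]big_ord_recr /= subrr mul0r addr0 -big_split /=.
  by apply: eq_bigr => l _; rewrite -natr1; ring.
have rev : \sum_(l < N.+1) (N%:R - l%:R) * g l = \sum_(l < N.+1) l%:R * g l.
  rewrite (reindex_inj rev_ord_inj) /=; apply: eq_bigr => l _.
  have lN : (l <= N)%N by rewrite -ltnS.
  by rewrite subSS gS // natrB //; ring.
have : \sum_(l < N.+1) (N%:R - l%:R) * g l + \sum_(l < N.+1) l%:R * g l =
       N%:R * \sum_(l < N.+1) g l.
  by rewrite -big_split /= mulr_sumr; apply: eq_bigr => l _; ring.
by rewrite tri -rev; lra.
Qed.

Section RankOneUpdate.
Variables (c c' s : R) (C : M) (w : cV).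
Hypotheses (c0 : 0 < c) (Cc : coercive c C) (c'0 : 0 < c')
  (Cc' : coercive c' (C + s *: outer w)).
Local Notation G := (C^-1).
Local Notation H := ((C + s *: outer w)^-1).
Local Notation p a := (qform (G ^+ a) w).
Local Notation q a := (qform (H ^+ a) w).

Let uC : C \is a GRing.unit. Proof. exact: coercive_unit Cc. Qed.
Let uC' : C + s *: outer w \is a GRing.unit. Proof. exact: coercive_unit Cc'. Qed.

Lemma resolventl : H = G - s *: (G * outer w * H).
Proof.
have : G * (C + s *: outer w) * H = G by rewrite -mulrA divrr // mulr1.
rewrite mulrDr mulVr // mulrDl mul1r -scalerAr -scalerAl => E.
by apply/eqP; rewrite eq_sym subr_eq E.
Qed.

Lemma resolventr : H = G - s *: (H * outer w * G).
Proof.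
have : H * (C + s *: outer w) * G = G by rewrite mulVr // mul1r.
rewrite mulrDr mulrDl -mulrA divrr // mulr1 -scalerAr -scalerAl => E.
by apply/eqP; rewrite eq_sym subr_eq E.
Qed.

Lemma resolvent_exprl m :
  H ^+ m = G ^+ m - s *: \sum_(l < m) G ^+ (m - l) * outer w * H ^+ l.+1.
Proof.
elim: m => [|m IH]; first by rewrite big_ord0 scaler0 subr0.
rewrite exprS {1}resolventl mulrBl -scalerAl -[_ * _ * H ^+ m]mulrA -exprS.
rewrite {1}IH mulrBr -exprS big_ord_recr /= scalerDr opprD addrA.
congr (_ - _ - s *: _); last by rewrite subSnn expr1.
rewrite -scalerAr mulr_sumr; congr (s *: _); apply: eq_bigr => l _.
by rewrite !mulrA -exprS subSn // ltnW.
Qed.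

Lemma resolvent_exprr m :
  H ^+ m = G ^+ m - s *: \sum_(l < m) H ^+ l.+1 * outer w * G ^+ (m - l).
Proof.
elim: m => [|m IH]; first by rewrite big_ord0 scaler0 subr0.
rewrite exprSr {2}resolventr mulrBr -scalerAr !mulrA -exprSr.
rewrite {1}IH mulrBl -exprSr big_ord_recr /= scalerDr opprD addrA.
congr (_ - _ - s *: _); last by rewrite subSnn expr1.
rewrite -scalerAl mulr_suml; congr (s *: _); apply: eq_bigr => l _.
by rewrite -[LHS]mulrA -exprSr subSn // ltnW.
Qed.

Lemma qform_update a : q a = p a - s * \sum_(l < a) p (a - l) * q l.+1.
Proof.
rewrite {1}resolvent_exprl qform_add qform_opp qform_scale qform_sum.
by congr (_ - s * _); apply: eq_bigr => l _; exact: outer_sandwich.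
Qed.

(** An identity rather than an approximation: the left expansion of [H ^+ N], followed by the right
    one inside each term, leaves a quadratic term made of products [p * q], with [q] still taken at
    the updated matrix. Comparing [q] with [p] then gives an inequality in either direction. *)
Lemma trace_update N : \tr (H ^+ N) = \tr (G ^+ N) - s * N%:R * p N.+1 +
  s ^+ 2 * \sum_(i < N) \sum_(l < i.+1) p (N.+1 - l) * q l.+1.
Proof.
rewrite {1}resolvent_exprl linearB /= linearZ /= linear_sum /=.
have term (i : 'I_N) : \tr (G ^+ (N - i) * outer w * H ^+ i.+1) =
    p N.+1 - s * \sum_(l < i.+1) p (N.+1 - l) * q l.+1.
  have -> : \tr (G ^+ (N - i) * outer w * H ^+ i.+1) =
      \tr (H ^+ i.+1 * G ^+ (N - i) * outer w).
    rewrite -[X in _ = \tr X]mulrA.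
    exact: (mxtrace_mulC (G ^+ (N - i) * outer w) (H ^+ i.+1)).
  rewrite mxtrace_outer {1}resolvent_exprr mulrBl -exprD -scalerAl mulr_suml.
  rewrite qform_add qform_opp qform_scale qform_sum.
  have iN := ltn_ord i.
  congr (qform (_ ^+ _) _ - s * _); first by lia.
  apply: eq_bigr => l _; have li := ltn_ord l.
  rewrite -[X in qform X w = _]mulrA -exprD [LHS]outer_sandwich mulrC; congr (qform (_ ^+ _) _ * _).
  by lia.
rewrite (eq_bigr _ (fun i _ => term i)) sumrB sumr_const card_ord -mulr_sumr.
by rewrite -mulr_natl; ring.
Qed.

(* The second-order term of [tr (A^-1 + s x x^T)^-N] at [s = 0], up to a factor. *)
Definition pair_sum A N x := \sum_(l < N.+1) qform (A ^+ l.+1) x * qform (A ^+ (N.+1 - l)) x.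

Lemma pair_sum_triangle N :
  \sum_(i < N) \sum_(l < i.+1) p (N.+1 - l) * p l.+1 =
  2^-1 * N%:R * pair_sum G N w.
Proof.
rewrite (@sum_triangle_sym N (fun l => p (N.+1 - l) * p l.+1)) => [|l lN].
  by congr (_ * _); apply: eq_bigr => l _; rewrite mulrC.
by rewrite mulrC; congr (qform (_ ^+ _) _ * qform (_ ^+ _) _); lia.
Qed.

(** For [s >= 0], [qform_update] gives [q <= p], so putting [p] for [q] in [trace_update] only
    increases the right side. For [s <= 0] the comparison is reversed, which yields
    [trace_update_ge]. *)
Lemma trace_update_le N : 0 <= s -> \tr (H ^+ N) <=
  \tr (G ^+ N) - s * N%:R * p N.+1 + s ^+ 2 * (2^-1 * N%:R * pair_sum G N w).
Proof.
move=> s0; rewrite trace_update lerD2l -pair_sum_triangle.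
apply: ler_wpM2l; first exact: sqr_ge0.
apply: ler_sum => i _; apply: ler_sum => l _.
apply: ler_wpM2l; first exact: inv_expr_psd Cc _ _.
rewrite qform_update gerBl mulr_ge0 //; apply: sumr_ge0 => k _.
by rewrite mulr_ge0 // ?(inv_expr_psd c0 Cc) // (inv_expr_psd c'0 Cc').
Qed.

Lemma trace_update_ge N : s <= 0 -> \tr (G ^+ N) - s * N%:R * p N.+1 +
  s ^+ 2 * (2^-1 * N%:R * pair_sum G N w) <= \tr (H ^+ N).
Proof.
move=> s0; rewrite trace_update lerD2l -pair_sum_triangle.
apply: ler_wpM2l; first exact: sqr_ge0.
apply: ler_sum => i _; apply: ler_sum => l _.
apply: ler_wpM2l; first exact: inv_expr_psd Cc _ _.
rewrite qform_update lerBrDr gerDl mulr_le0_ge0 //; apply: sumr_ge0 => k _.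
by rewrite mulr_ge0 // ?(inv_expr_psd c0 Cc) // (inv_expr_psd c'0 Cc').
Qed.

End RankOneUpdate.

End ResolventAlgebra.

(** * One-step bounds from fourth moments *)

Section SignVectors.
Variables (R : realFieldType) (d : nat).
Local Notation M := 'M[R]_d.+1.
Local Notation cV := 'cV[R]_d.+1.
Local Notation signs := {ffun 'I_d.+1 -> bool}.
Implicit Types (A B C : M) (x : cV).

Definition sgnv (e : signs) : cV := \col_i (-1) ^+ (e i).
Definition avg (h : signs -> R) : R := (#|{: signs}|%:R)^-1 * \sum_e h e.

Lemma card_signs_gt0 : 0 < #|{: signs}|%:R :> R.
Proof. by rewrite ltr0n; apply/card_gt0P; exists [ffun=> true]. Qed.

Lemma avg_cst a : avg (fun=> a) = a.
Proof.
rewrite /avg sumr_const -[a *+ _]mulr_natl mulKf //.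
by rewrite gt_eqF // card_signs_gt0.
Qed.

Lemma eq_avg h1 h2 : h1 =1 h2 -> avg h1 = avg h2.
Proof. by move=> e; rewrite /avg (eq_bigr _ (fun i _ => e i)). Qed.

Lemma avgD h1 h2 : avg (fun e => h1 e + h2 e) = avg h1 + avg h2.
Proof. by rewrite /avg big_split mulrDr. Qed.

Lemma avgZ a h : avg (fun e => a * h e) = a * avg h.
Proof. by rewrite /avg -mulr_sumr mulrCA. Qed.

Lemma avg_sum (I : finType) (F : I -> signs -> R) :
  avg (fun e => \sum_i F i e) = \sum_i avg (F i).
Proof. by rewrite /avg exchange_big /= mulr_sumr. Qed.

Lemma avg_le h1 h2 : (forall e, h1 e <= h2 e) -> avg h1 <= avg h2.
Proof.
by move=> h; rewrite ler_wpM2l ?invr_ge0 ?ler0n //; apply: ler_sum => e _.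
Qed.

Lemma avg_ge0 h : (forall e, 0 <= h e) -> 0 <= avg h.
Proof. by move=> h0; rewrite -(avg_cst 0); apply: avg_le. Qed.

Lemma avg_prod (F : 'I_d.+1 -> bool -> R) :
  avg (fun e => \prod_i F i (e i)) = \prod_i (2^-1 * (F i false + F i true)).
Proof.
rewrite big_split /= /avg; congr (_ * _).
  by rewrite prodr_const card_ffun card_bool card_ord natrX exprVn.
rewrite -(bigA_distr_bigA F); apply: eq_bigr => i _.
by rewrite big_bool addrC.
Qed.

Lemma nrm2_sgnv e : nrm2 (sgnv e) = d.+1%:R.
Proof.
rewrite nrm2E (eq_bigr (fun=> 1)) => [|i _]; last by rewrite mxE sqrr_sign.
by rewrite sumr_const card_ord.
Qed.

Lemma avg_monomial (m : 'I_d.+1 -> nat) :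
  avg (fun e => \prod_i (sgnv e) i 0 ^+ m i) = \prod_i (~~ odd (m i))%:R.
Proof.
transitivity (avg (fun e => \prod_i ((-1) ^+ (e i)) ^+ m i)).
  by apply: eq_avg => e; apply: eq_bigr => i _; rewrite mxE.
rewrite (avg_prod (fun i b => ((-1) ^+ b) ^+ m i)); apply: eq_bigr => i _.
rewrite /= expr0 expr1 expr1n -signr_odd; case: (odd _) => /=; lra.
Qed.

(* Multiplicities of the coordinates in a monomial of degree two or four. *)
Definition mult2 (i j : 'I_d.+1) k : nat := (k == i) + (k == j).
Definition mult4 (i j l m : 'I_d.+1) k : nat := mult2 i j k + mult2 l m k.

Lemma prod_delta (x : 'I_d.+1 -> R) i : \prod_k x k ^+ (k == i) = x i.
Proof.
rewrite (bigD1 i) //= eqxx expr1 big1 ?mulr1 // => k /negPf ->.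
by rewrite expr0.
Qed.

Lemma prod_mult2 (x : 'I_d.+1 -> R) i j : \prod_k x k ^+ mult2 i j k = x i * x j.
Proof.
by under eq_bigr do rewrite exprD; rewrite big_split /= !prod_delta.
Qed.

Lemma prod_mult4 (x : 'I_d.+1 -> R) i j l m :
  \prod_k x k ^+ mult4 i j l m k = (x i * x j) * (x l * x m).
Proof.
by under eq_bigr do rewrite exprD; rewrite big_split /= !prod_mult2.
Qed.

(* Product moments of independent centred coordinates of variance one, with
   fourth moment [k4]; the third moment never matters. *)
Definition pmom (k3 k4 : R) (a : nat) : R :=
  match a with 0 => 1 | 1 => 0 | 2 => 1 | 3 => k3 | _ => k4 end.

Lemma prod_pmom2 k3 k4 i j : \prod_k pmom k3 k4 (mult2 i j k) = (i == j)%:R.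
Proof.
have [->|ij] := eqVneq i j.
  by apply: big1 => k _; rewrite /mult2; case: (k == j).
by rewrite (bigD1 i) //= /mult2 eqxx (negPf ij) mul0r.
Qed.

Lemma sum_mult4 i j l m : (\sum_k mult4 i j l m k = 4)%N.
Proof.
have s1 a : (\sum_(k < d.+1) (k == a) = 1)%N.
  by rewrite (bigD1 a) //= eqxx big1 // => k /negPf ->.
by rewrite /mult4 /mult2 !big_split /= !s1.
Qed.

(** The multiplicities sum to four. A multiplicity three forces a multiplicity one elsewhere, so
    both products vanish; a multiplicity four means that all indices agree, the only pattern that
    sees [k4]. The reference values [pmom 0 1] are the moments of a fair sign. *)
Lemma prod_pmom4 k3 k4 i j l m :
  \prod_k pmom k3 k4 (mult4 i j l m k) = \prod_k pmom 0 1 (mult4 i j l m k) +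
    (k4 - 1) * [&& i == j, i == l & i == m]%:R.
Proof.
have [/and3P [/eqP <- /eqP <- /eqP <-]|ne] := boolP [&& _, _ & _].
  rewrite (bigD1 i) //= [in RHS](bigD1 i) //= !big1; first last.
  - by move=> k /negPf ki; rewrite /mult4 /mult2 ki.
  - by move=> k /negPf ki; rewrite /mult4 /mult2 ki.
  by rewrite /mult4 /mult2 eqxx /=; ring.
rewrite mulr0 addr0.
have [[k k3']|no3] := pselect (exists k, mult4 i j l m k = 3); last first.
  apply: eq_bigr => k _.
  have : mult4 i j l m k != 4%N.
    apply: contra ne => /eqP; rewrite /mult4 /mult2.
    case: (k =P i) => ki; case: (k =P j) => kj; case: (k =P l) => kl;
      case: (k =P m) => km //= _.
    by rewrite -ki -kj -kl -km !eqxx.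
  have : mult4 i j l m k != 3%N by apply/eqP => k3'; apply: no3; exists k.
  have : (mult4 i j l m k <= 4)%N.
    by rewrite /mult4 /mult2; do 4! case: eqP.
  by case: mult4 => [|[|[|[|[|?]]]]].
have [k' k'k k'1] : exists2 k', k' != k & mult4 i j l m k' = 1%N.
  have := sum_mult4 i j l m; rewrite (bigD1 k) //= k3' => -[] /eqP.
  rewrite -[X in _ == X]/1%N => /eqP s1.
  have [k' k'k k'0] : exists2 k', k' != k & (0 < mult4 i j l m k')%N.
    apply/exists_inP; apply: contraPT s1; rewrite negb_exists_in => /forall_inP z.
    by rewrite big1 // => k' /z; rewrite -eqn0Ngt => /eqP.
  exists k' => //; apply/eqP; rewrite eqn_leq k'0 andbT.
  by rewrite -[X in (_ <= X)%N]s1 (bigD1 k') //= leq_addr.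
by rewrite (bigD1 k') //= k'1 mul0r (bigD1 k') //= k'1 mul0r.
Qed.

Lemma avg_mult2 i j : avg (fun e => sgnv e i 0 * sgnv e j 0) = (i == j)%:R.
Proof.
under eq_avg => e do rewrite -(prod_mult2 (fun k => sgnv e k 0)).
rewrite avg_monomial -(prod_pmom2 0 1); apply: eq_bigr => k _.
by rewrite /mult2; do 2! case: eqP.
Qed.

Lemma avg_mult4 i j l m :
  avg (fun e => (sgnv e i 0 * sgnv e j 0) * (sgnv e l 0 * sgnv e m 0)) =
  \prod_k pmom 0 1 (mult4 i j l m k).
Proof.
under eq_avg => e do rewrite -(prod_mult4 (fun k => sgnv e k 0)).
rewrite avg_monomial; apply: eq_bigr => k _.
by rewrite /mult4 /mult2; do 4! case: eqP.
Qed.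

Lemma avg_qform (A : M) : avg (fun e => qform A (sgnv e)) = \tr A.
Proof.
under eq_avg do rewrite qformE.
rewrite avg_sum; apply: eq_bigr => i _; rewrite avg_sum (bigD1 i) //= big1.
  by rewrite avgZ avg_mult2 eqxx mulr1 addr0.
by move=> j ji; rewrite avgZ avg_mult2 eq_sym (negPf ji) mulr0.
Qed.

Lemma qform_mul (A B : M) x : qform A x * qform B x =
  \sum_i \sum_j \sum_l \sum_m A i j * B l m * ((x i 0 * x j 0) * (x l 0 * x m 0)).
Proof.
rewrite !qformE mulr_suml; apply: eq_bigr => i _.
rewrite mulr_suml; apply: eq_bigr => j _; rewrite mulr_sumr; apply: eq_bigr => l _.
by rewrite mulr_sumr; apply: eq_bigr => m _; ring.
Qed.

(** Kept algebraic so that a uniform sign vector ([avg_qform_mul]) and a row of the sample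
    ([has_mean_qform_mul]) both realise it, with different parameters. *)
Definition quartic_mean k3 k4 (A B : M) : R :=
  \sum_i \sum_j \sum_l \sum_m A i j * B l m * \prod_k pmom k3 k4 (mult4 i j l m k).

Lemma quartic_meanE k3 k4 A B : quartic_mean k3 k4 A B =
  quartic_mean 0 1 A B + (k4 - 1) * \sum_i A i i * B i i.
Proof.
have -> : \sum_i A i i * B i i =
    \sum_i \sum_j \sum_l \sum_m A i j * B l m * [&& i == j, i == l & i == m]%:R.
  apply: eq_bigr => i _.
  rewrite (bigD1 i) //= [X in _ + X]big1 ?addr0 => [|j ji]; last first.
    by apply: big1 => l _; apply: big1 => m _; rewrite eq_sym (negPf ji) mulr0.
  rewrite (bigD1 i) //= [X in _ + X]big1 ?addr0 => [|l li]; last first.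
    by apply: big1 => m _; rewrite eqxx [i == l]eq_sym (negPf li) mulr0.
  rewrite (bigD1 i) //= [X in _ + X]big1 ?addr0 => [|m mi]; last first.
    by rewrite !eqxx [i == m]eq_sym (negPf mi) mulr0.
  by rewrite !eqxx mulr1.
rewrite mulr_sumr -big_split; apply: eq_bigr => i _ /=.
rewrite mulr_sumr -big_split; apply: eq_bigr => j _ /=.
rewrite mulr_sumr -big_split; apply: eq_bigr => l _ /=.
rewrite mulr_sumr -big_split; apply: eq_bigr => m _ /=.
by rewrite (prod_pmom4 k3 k4); ring.
Qed.

Lemma avg_qform_mul A B :
  avg (fun e => qform A (sgnv e) * qform B (sgnv e)) = quartic_mean 0 1 A B.
Proof.
under eq_avg do rewrite qform_mul.
rewrite avg_sum; apply: eq_bigr => i _; rewrite avg_sum; apply: eq_bigr => j _.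
rewrite avg_sum; apply: eq_bigr => l _; rewrite avg_sum; apply: eq_bigr => m _.
by rewrite avgZ avg_mult4.
Qed.

Definition pair_mean k3 k4 (A : M) N : R :=
  \sum_(l < N.+1) quartic_mean k3 k4 (A ^+ l.+1) (A ^+ (N.+1 - l)).

Lemma avg_pair_sum A N : avg (fun e => pair_sum A N (sgnv e)) = pair_mean 0 1 A N.
Proof. by rewrite avg_sum; apply: eq_bigr => l _; rewrite avg_qform_mul. Qed.

(** Each product has total exponent [N.+2], so the Chebyshev inequality reduces all of them to one
    form. It is applied to coordinate vectors, of norm one, and to sign vectors, whose squared norm
    is the source of the factor [d.+1]. *)
Lemma pair_sum_le A N x : A^T = A -> (forall z, 0 <= qform A z) ->
  pair_sum A N x <= N.+1%:R * (nrm2 x * qform (A ^+ N.+2) x).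
Proof.
move=> sA pA; rewrite /pair_sum mulr_natl -[X in _ <= _ *+ X]card_ord -sumr_const.
apply: ler_sum => l _; have lN := ltn_ord l.
have -> : (N.+2 = l.+1 + (N.+1 - l))%N by lia.
exact: qform_expr_chebyshev.
Qed.

Lemma pair_meanE k3 k4 A N :
  pair_mean k3 k4 A N = pair_mean 0 1 A N + (k4 - 1) * \sum_i pair_sum A N (unitv R i).
Proof.
rewrite /pair_mean (eq_bigr _ (fun l _ => quartic_meanE k3 k4 _ _)) big_split /=.
congr (_ + _); rewrite -mulr_sumr exchange_big /=; congr (_ * _).
by apply: eq_bigr => l _; apply: eq_bigr => i _; rewrite !qform_unitv.
Qed.

Section Step.
Variables (c : R) (C : M) (N : nat).
Hypotheses (c0 : 0 < c) (Cc : coercive c C) (N0 : (0 < N)%N).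
Local Notation G := (C^-1).
Local Notation f := (\tr (G ^+ N.*2)).
Local Notation n := (N.*2%:R : R).

Let sG : G^T = G. Proof. by apply: sym_inv; case: Cc. Qed.
Let n0 : 0 < n. Proof. by rewrite ltr0n double_gt0. Qed.
Let f0 : 0 <= f. Proof. exact: trace_inv_psd Cc _. Qed.

(* Expectation of the upper bound [trace_update_le] for a random vector with
   independent centred coordinates of variance one and fourth moment [k4]. *)
Definition step_bound k3 k4 th : R := f - th * \tr (G ^+ N.*2.+1) +
  (th / n) ^+ 2 * (2^-1 * n * pair_mean k3 k4 G N.*2).

Lemma trace_exprD2_le : \tr (G ^+ N.*2.+2) <= c ^- 2 * f.
Proof. by rewrite -[N.*2.+2]addn2; exact: trace_inv_exprD2 Cc _. Qed.

Lemma diag_pair_sum_le :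
  \sum_i pair_sum G N.*2 (unitv R i) <= N.*2.+1%:R * (c ^- 2 * f).
Proof.
apply: le_trans (ler_wpM2l (ler0n _ _) trace_exprD2_le).
rewrite trace_unitv mulr_sumr; apply: ler_sum => i _.
have := pair_sum_le N.*2 (unitv R i) sG (inv_psd c0 Cc).
by rewrite nrm2_unitv mul1r.
Qed.

Lemma avg_pair_mean_le :
  pair_mean 0 1 G N.*2 <= d.+1%:R * (N.*2.+1%:R * (c ^- 2 * f)).
Proof.
apply: le_trans (ler_wpM2l (ler0n _ _) (ler_wpM2l (ler0n _ _) trace_exprD2_le)).
rewrite -avg_pair_sum -avg_qform -!avgZ; apply: avg_le => e.
have := pair_sum_le N.*2 (sgnv e) sG (inv_psd c0 Cc).
by rewrite nrm2_sgnv mulrCA.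
Qed.

(** The linear term of [step_bound] carries one power too many for a recursion in [f]. This is the
    price of lowering it. *)
Lemma trace_drift_le : f - \tr (G ^+ N.*2.+1) <= d.+1%:R / n.
Proof.
apply: le_trans (trace_inv_telescope _ c0 Cc) _.
by rewrite ler_wpM2l ?ler0n // lef_pV2 ?posrE ?ltr0n ?double_gt0 // ler_nat.
Qed.

(** The isotropic part of the quartic term is estimated by the squared norm of a sign vector, which
    adds [d.+1] to [k4 - 1]. The factor [1 + n^-1] is [N.*2.+1 / N.*2], from the number of terms of
    [pair_sum], and [c ^- 2] comes from lowering the exponent [N.*2.+2]. *)
Lemma step_bound_simple k3 k4 th : 0 <= th -> 1 <= k4 -> step_bound k3 k4 th <=
  (1 - th + th ^+ 2 / 2 * (k4 - 1 + d.+1%:R) * ((1 + n^-1) * c ^- 2)) * f +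
  th * (d.+1%:R / n).
Proof.
move=> th0 k41; rewrite /step_bound pair_meanE.
have := ler_wpM2l th0 trace_drift_le.
have k0 : 0 <= k4 - 1 by rewrite subr_ge0.
have := lerD avg_pair_mean_le (ler_wpM2l k0 diag_pair_sum_le).
set P := _ + _ => PE.
have t0 : 0 <= (th / n) ^+ 2 * (2^-1 * n) by rewrite mulr_ge0 ?sqr_ge0 // mulr_ge0 ?invr_ge0 ?ler0n.
have := ler_wpM2l t0 PE.
have -> : (th / n) ^+ 2 * (2^-1 * n) * (d.+1%:R * (N.*2.+1%:R * (c ^- 2 * f)) +
    (k4 - 1) * (N.*2.+1%:R * (c ^- 2 * f))) =
  th ^+ 2 / 2 * (k4 - 1 + d.+1%:R) * ((1 + n^-1) * c ^- 2) * f.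
  rewrite -[N.*2.+1%:R]natr1; field.
  by rewrite !gt_eqF.
lra.
Qed.

(* Trades a row for a sign vector of negative weight. Since [pair_mean 0 1] is
   also the mean of [pair_sum] over sign vectors, adding [(1 - th) ^+ 2] times
   the lower bound [trace_update_ge] at [s = - (th / (1 - th)) / n] cancels the
   isotropic part of the quartic term and leaves only the part [k4 - 1], which
   is free of the dimension. *)
Lemma step_bound_avg k3 k4 th c' : 0 <= th < 1 -> 1 <= k4 -> 0 < c' ->
  (forall e, coercive c' (C - (th / (1 - th) / n) *: outer (sgnv e))) ->
  step_bound k3 k4 th <=
  ((1 - th) ^+ 2 + th ^+ 2 / 2 * (k4 - 1) * ((1 + n^-1) * c ^- 2)) *
    avg (fun e => \tr ((C - (th / (1 - th) / n) *: outer (sgnv e))^-1 ^+ N.*2)) +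
  2 * th * (d.+1%:R / n).
Proof.
move=> /andP [th0 th1] k41 c'0 Cc'; set b := th / (1 - th) in Cc' *.
set S := avg _; have th1' : 0 < 1 - th by rewrite subr_gt0.
have b0 : 0 <= b by rewrite divr_ge0 // ltW.
have SE : f + b * \tr (G ^+ N.*2.+1) +
    (b / n) ^+ 2 * (2^-1 * n * pair_mean 0 1 G N.*2) <= S.
  rewrite -avg_pair_sum -(avg_qform (G ^+ N.*2.+1)) -(avg_cst f) -!avgZ -!avgD.
  apply: avg_le => e.
  have := Cc' e; rewrite -scaleNr => Ce.
  have := trace_update_ge c0 Cc c'0 Ce N.*2.
  rewrite sqrrN oppr_le0 divr_ge0 ?ler0n // => /(_ isT).
  by rewrite mulNr divfK ?gt_eqF //; lra.
have df := trace_drift_le.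
have P0 : 0 <= pair_mean 0 1 G N.*2.
  rewrite -avg_pair_sum; apply: avg_ge0 => e; apply: sumr_ge0 => l _.
  by rewrite mulr_ge0 // (inv_expr_psd c0 Cc).
(* The diagonal error is naturally a multiple of [f]; this charges it to [S], so that [S] alone
   appears in the conclusion. *)
have fS : f <= S.
  apply: le_trans SE; rewrite -addrA lerDl addr_ge0 // mulr_ge0 //.
    exact: trace_inv_psd Cc _.
    exact: sqr_ge0.
  by rewrite !mulr_ge0 // ?invr_ge0 ?ler0n.
rewrite /step_bound pair_meanE.
have k0 : 0 <= k4 - 1 by rewrite subr_ge0.
have t0 : 0 <= (th / n) ^+ 2 * (2^-1 * n * (k4 - 1)).
  by rewrite mulr_ge0 ?sqr_ge0 // !mulr_ge0 ?invr_ge0 ?ler0n.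
have := ler_wpM2l t0 diag_pair_sum_le.
have -> : (th / n) ^+ 2 * (2^-1 * n * (k4 - 1)) * (N.*2.+1%:R * (c ^- 2 * f)) =
  th ^+ 2 / 2 * (k4 - 1) * ((1 + n^-1) * c ^- 2) * f.
  by rewrite -[N.*2.+1%:R]natr1; field; rewrite !gt_eqF.
have K0 : 0 <= th ^+ 2 / 2 * (k4 - 1) * ((1 + n^-1) * c ^- 2).
  apply: mulr_ge0; first by rewrite mulr_ge0 // divr_ge0 ?sqr_ge0.
  by rewrite mulr_ge0 ?addr_ge0 ?invr_ge0 ?exprn_ge0 ?(ltW c0) ?ler0n.
have := ler_wpM2l K0 fS.
(* With [b = th / (1 - th)] one has [(1 - th) ^+ 2 * b ^+ 2 = th ^+ 2], so the isotropic quartic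
   terms agree. The remaining coefficients of [f] and of [\tr (G ^+ N.*2.+1)] are opposite,
   [2 * th - th ^+ 2] in absolute value, and [trace_drift_le] bounds their contribution. *)
have := ler_wpM2l (sqr_ge0 (1 - th)) SE.
have -> : (1 - th) ^+ 2 * (f + b * \tr (G ^+ N.*2.+1) +
    (b / n) ^+ 2 * (2^-1 * n * pair_mean 0 1 G N.*2)) =
   (1 - th) ^+ 2 * f + th * (1 - th) * \tr (G ^+ N.*2.+1) +
    (th / n) ^+ 2 * (2^-1 * n * pair_mean 0 1 G N.*2).
  by rewrite /b; field; rewrite !gt_eqF.
have a0 : 0 <= 2 * th - th ^+ 2 by nra.
have := ler_wpM2l a0 df.
have : (2 * th - th ^+ 2) * (d.+1%:R / n) <= 2 * th * (d.+1%:R / n).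
  by rewrite ler_wpM2r ?divr_ge0 ?ler0n // gerBl sqr_ge0.
lra.
Qed.

End Step.

End SignVectors.

Arguments sgnv {R d} e.
(** * Random sign vectors *)

Section ExponentialInequalities.
Variable R : realType.
Implicit Types x y t : R.

Lemma ge0_of_derivative (f df : R -> R) x : f 0 = 0 ->
  (forall y, is_derive y 1 f (df y)) -> (forall y, 0 <= y -> 0 <= df y) ->
  0 <= x -> 0 <= f x.
Proof.
move=> f0 fdf df0; rewrite le_eqVlt => /predU1P [<-|x0]; first by rewrite f0.
have fd y : y \in `]0, x[ -> is_derive y 1 f (df y) by move=> _; exact: fdf.
have fc : {within `[0, x], continuous f}%classic.
  apply: continuous_subspaceT => y; apply: differentiable_continuous.
  by apply/derivable1_diffP; case: (fdf y).
have [y] := MVT x0 fd fc.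
rewrite in_itv /= => /andP [/ltW y0 _]; rewrite f0 !subr0 => ->.
by rewrite mulr_ge0 ?df0 // ltW.
Qed.

(** The rules of derivation are restated for functions written pointwise, so that [pointwise_derive]
    can build a derivative by unification and leave an algebraic identity. *)
Lemma is_derive_pointD (f g : R -> R) x a b : is_derive x 1 f a -> is_derive x 1 g b ->
  is_derive x 1 (fun y => f y + g y) (a + b).
Proof. exact: is_deriveD. Qed.

Lemma is_derive_pointN (f : R -> R) x a : is_derive x 1 f a ->
  is_derive x 1 (fun y => - f y) (- a).
Proof. exact: is_deriveN. Qed.

Lemma is_derive_pointM (f g : R -> R) x a b : is_derive x 1 f a -> is_derive x 1 g b ->
  is_derive x 1 (fun y => f y * g y) (f x * b + g x * a).
Proof. exact: is_deriveM. Qed.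

Lemma is_derive_point_expR (f : R -> R) x a : is_derive x 1 f a ->
  is_derive x 1 (fun y => expR (f y)) (expR (f x) * a).
Proof. by move=> h; apply: (@is_derive1_comp _ expR f). Qed.

Lemma is_derive_point_id x : is_derive x 1 (fun y : R => y) 1.
Proof. exact: is_derive_id. Qed.

Lemma is_derive_point_cst (c : R) x : is_derive x 1 (fun _ : R => c) 0.
Proof. exact: is_derive_cst. Qed.

Lemma is_derive_conv (f : R -> R) x a b : is_derive x 1 f a -> a = b -> is_derive x 1 f b.
Proof. by move=> h <-. Qed.

Local Ltac pointwise_derive := eapply is_derive_conv;
  [repeat first [eapply is_derive_point_cst | eapply is_derive_point_id | eapply is_derive_pointD | eapply is_derive_pointN | eapply is_derive_pointM
    | eapply is_derive_point_expR] |].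

Lemma expR_ge2 x : 0 <= x -> 1 + x + x * x / 2 <= expR x.
Proof.
move=> x0; rewrite -subr_ge0; move: x x0 => x.
apply: (@ge0_of_derivative (fun x => expR x - (1 + x + x * x / 2))
          (fun x => expR x - (1 + x))) => [|y|y _].
- by rewrite expR0; ring.
- by pointwise_derive; rewrite /=; field.
- by rewrite subr_ge0 expR_ge1Dx.
Qed.

Lemma expR_ge3 x : 0 <= x -> 1 + x + x * x / 2 + x * x * x / 6 <= expR x.
Proof.
move=> x0; rewrite -subr_ge0; move: x x0 => x.
apply: (@ge0_of_derivative (fun x => expR x - (1 + x + x * x / 2 + x * x * x / 6))
          (fun x => expR x - (1 + x + x * x / 2))) => [|y|y y0].
- by rewrite expR0; ring.
- by pointwise_derive; rewrite /=; field.
- by rewrite subr_ge0 expR_ge2.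
Qed.

(** By parity [x >= 0]. The derivative of [1 - expR (- (x * x / 2)) * cosh x] has the sign of
    [x * cosh x - sinh x], whose own derivative [x * sinh x] is nonnegative. *)
Lemma cosh_le x : (expR x + expR (- x)) / 2 <= expR (x * x / 2).
Proof.
wlog x0 : x / 0 <= x.
  move=> h; case: (leP 0 x) => [/h //|/ltW xn].
  by have := h (- x); rewrite oppr_ge0 opprK mulrNN addrC => /(_ xn).
have k0 y : 0 <= y -> 0 <= y * (expR y + expR (- y)) - (expR y - expR (- y)).
  apply: (@ge0_of_derivative
    (fun y => y * (expR y + expR (- y)) - (expR y - expR (- y)))
    (fun y => y * (expR y - expR (- y)))) => [|z|z z0].
  - by rewrite oppr0 expR0; ring.
  - by pointwise_derive; rewrite /=; field.
  - by rewrite mulr_ge0 // subr_ge0 ler_expR; lra.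
have : 0 <= 1 - expR (- (x * x / 2)) * ((expR x + expR (- x)) / 2).
  apply: (@ge0_of_derivative
    (fun x => 1 - expR (- (x * x / 2)) * ((expR x + expR (- x)) / 2))
    (fun y => expR (- (y * y / 2)) / 2 *
       (y * (expR y + expR (- y)) - (expR y - expR (- y))))) => [|z|z z0|//].
  - by rewrite mul0r mul0r !oppr0 expR0; field.
  - by pointwise_derive; rewrite /=; field.
  - by rewrite mulr_ge0 ?divr_ge0 ?expR_ge0 ?k0.
rewrite subr_ge0 expRN mulrC ler_pdivrMr ?expR_gt0 //.
by rewrite mul1r.
Qed.

End ExponentialInequalities.

Section SignNoise.
Variables (R : realType) (d : nat).
Local Notation M := 'M[R]_d.+1.
Local Notation cV := 'cV[R]_d.+1.
Local Notation signs := {ffun 'I_d.+1 -> bool}.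
Implicit Types (A C V : M) (x u : cV) (e : signs) (t : R).

Definition flip (k : 'I_d.+1) e : signs := [ffun i => e i (+) (i == k)].

Lemma flipK k : involutive (flip k).
Proof. by move=> e; apply/ffunP => i; rewrite !ffunE -addbA addbb addbF. Qed.

Lemma avg_flip k (h : signs -> R) : avg h = avg (fun e => (h e + h (flip k e)) / 2).
Proof.
have fl : avg h = avg (fun e => h (flip k e)).
  by rewrite /avg (reindex_inj (can_inj (flipK k))).
have -> : avg (fun e => (h e + h (flip k e)) / 2) =
    avg (fun e => 2^-1 * (h e + h (flip k e))) by apply: eq_avg => e; rewrite mulrC.
by rewrite avgZ avgD -fl; field.
Qed.

Section GaussianDomination.
Variables (u : cV) (t : R).
Hypotheses (t0 : 0 <= t) (tu : 2 * t * nrm2 u < 1).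

Let head k e : R := \sum_(i < d.+1 | (i < k)%N) sgnv e i 0 * u i 0.
Let tail k : R := \sum_(i < d.+1 | (k <= i)%N) u i 0 ^+ 2.
Let den k : R := 1 - 2 * t * tail k.

Let tail_le k : tail k <= nrm2 u.
Proof.
rewrite nrm2E /tail [leRHS](bigID (fun i : 'I_d.+1 => (k <= i)%N)) /= lerDl.
by apply: sumr_ge0 => i _; exact: sqr_ge0.
Qed.

Let den_gt0 k : 0 < den k.
Proof.
rewrite subr_gt0; apply: le_lt_trans tu.
by rewrite ler_wpM2l ?tail_le // mulr_ge0.
Qed.

(** Averaging over the sign of [a] produces a hyperbolic cosine. With [y = 2 * t * a ^+ 2 / D], what
    remains after [cosh_le] is [1 + y <= (1 - y)^-1] for the exponents and [expR y <= (1 - y)^-1]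
    for the square roots. *)
Lemma gaussian_step (c a D : R) : 0 < D - 2 * t * a ^+ 2 ->
  (expR (t * (c + a) ^+ 2 / D) + expR (t * (c - a) ^+ 2 / D)) / 2 / Num.sqrt D <=
  expR (t * c ^+ 2 / (D - 2 * t * a ^+ 2)) / Num.sqrt (D - 2 * t * a ^+ 2).
Proof.
set D' := D - _ => D'0.
have D0 : 0 < D.
  by apply: lt_le_trans D'0 _; rewrite /D' gerBl mulr_ge0 ?sqr_ge0 ?mulr_ge0.
pose y := 2 * t * a ^+ 2 / D.
have y0 : 0 <= y by rewrite divr_ge0 ?(ltW D0) // mulr_ge0 ?sqr_ge0 ?mulr_ge0.
have D'E : D' = D * (1 - y) by rewrite /D' /y; field; rewrite lt0r_neq0.
have y1 : 0 < 1 - y by rewrite -(pmulr_rgt0 _ D0) -D'E.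
have -> : (expR (t * (c + a) ^+ 2 / D) + expR (t * (c - a) ^+ 2 / D)) / 2 =
    expR (t * (c ^+ 2 + a ^+ 2) / D) *
    ((expR (2 * t * c * a / D) + expR (- (2 * t * c * a / D))) / 2).
  rewrite mulrA mulrDr -!expRD; congr ((expR _ + expR _) / 2).
    by ring.
  by ring.
apply: (@le_trans _ _ (expR (t * c ^+ 2 / D') * (expR (y / 2) / Num.sqrt D))).
  rewrite [leRHS]mulrA ler_wpM2r ?invr_ge0 ?sqrtr_ge0 //.
  apply: le_trans (ler_wpM2l (expR_ge0 _) (cosh_le _)) _.
  rewrite -!expRD ler_expR.
  have -> : t * (c ^+ 2 + a ^+ 2) / D + 2 * t * c * a / D * (2 * t * c * a / D) / 2 =
     t * c ^+ 2 / D * (1 + y) + y / 2 by rewrite /y; field; rewrite lt0r_neq0.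
  rewrite lerD2r D'E invfM [leRHS]mulrA ler_wpM2l //.
    by rewrite divr_ge0 ?(ltW D0) // mulr_ge0 ?sqr_ge0.
  by rewrite -[leRHS]div1r ler_pdivlMr //; have := sqr_ge0 y; lra.
rewrite ler_wpM2l ?expR_ge0 // ler_pdivrMr ?sqrtr_gt0 // [leRHS]mulrC ler_pdivlMr ?sqrtr_gt0 //.
have -> : expR (y / 2) = Num.sqrt (expR y).
  have -> : expR y = expR (y / 2) ^+ 2 by rewrite -expRM_natr; congr expR; field.
  by rewrite sqrtr_sqr ger0_norm ?expR_ge0.
rewrite -sqrtrM ?expR_ge0 // ler_sqrt ?(ltW D0) // D'E mulrCA ger_pMr //.
rewrite mulrC -ler_pdivlMr ?expR_gt0 // div1r -expRN.
by have := expR_ge1Dx (- y).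
Qed.

(* The coordinates are replaced one by one by Gaussians, for which the
   exponential moment is explicit: [cosh a <= exp (a ^+ 2 / 2)]. *)
Lemma avg_exp_sqr_le :
  avg (fun e => expR (t * (\sum_i sgnv e i 0 * u i 0) ^+ 2)) <=
  (Num.sqrt (1 - 2 * t * nrm2 u))^-1.
Proof.
(* For a centred Gaussian [g] of variance [v], the mean of [expR (t * (c + g) ^+ 2)] is
   [expR (t * c ^+ 2 / (1 - 2 * t * v))] over the root of [1 - 2 * t * v]. Here the coordinates from
   [k] on are Gaussian, with total variance [tail k]. *)
pose Phi k e := expR (t * head k e ^+ 2 / den k) / Num.sqrt (den k).
have step (k : 'I_d.+1) : avg (Phi k.+1) <= avg (Phi k).
  have tailE : tail k = tail k.+1 + u k 0 ^+ 2.
    rewrite /tail (bigD1 k) //= addrC; congr (_ + _); apply: eq_bigl => i.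
    by rewrite ltn_neqAle andbC eq_sym.
  have headE e : head k.+1 e = head k e + sgnv e k 0 * u k 0.
    rewrite /head (bigD1 k) //= addrC; congr (_ + _); apply: eq_bigl => i.
    by rewrite ltnS ltn_neqAle andbC.
  have head_flip e : head k (flip k e) = head k e.
    apply: eq_bigr => i ik; rewrite !mxE ffunE.
    by rewrite [i == k](_ : _ = false) ?addbF // -val_eqE ltn_eqF.
  have sgn_flip e : sgnv (flip k e) k 0 = - sgnv e k 0 :> R.
    by rewrite !mxE ffunE eqxx addbT; case: (e k); rewrite /= ?expr0 ?expr1 ?opprK.
  rewrite (avg_flip k); apply: avg_le => e; rewrite /Phi !headE head_flip sgn_flip.
  have := @gaussian_step (head k e) (sgnv e k 0 * u k 0) (den k.+1).
  have -> : den k.+1 - 2 * t * (sgnv e k 0 * u k 0) ^+ 2 = den k.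
    by rewrite /den tailE exprMn [sgnv e k 0]mxE sqrr_sign; ring.
  move=> /(_ (den_gt0 k)); rewrite mulNr -mulrDl.
  by apply: le_trans; rewrite mulrAC.
have all k : (k <= d.+1)%N -> avg (Phi k) <= avg (Phi 0%N).
  elim: k => // k IH kd; apply: le_trans (IH (ltnW kd)).
  exact: step (Ordinal kd).
have := all _ (leqnn _).
have -> : avg (Phi d.+1) = avg (fun e => expR (t * (\sum_i sgnv e i 0 * u i 0) ^+ 2)).
  apply: eq_avg => e; rewrite /Phi /den /tail big_pred0 => [|i].
    by rewrite mulr0 subr0 sqrtr1 !divr1; congr (expR (t * _ ^+ 2)); apply: eq_bigl => i; rewrite ltn_ord.
  by rewrite leqNgt ltn_ord.
move=> /le_trans; apply; rewrite -[leRHS](@avg_cst R d); apply: avg_le => e.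
rewrite /Phi /head big_pred0 // expr0n mulr0 mul0r expR0 div1r /den.
by rewrite (_ : tail 0 = nrm2 u) // nrm2E.
Qed.

End GaussianDomination.

(** The logarithm of the left side expands as [t + t ^+ 2 + ...]; the coefficient [27 / 20] absorbs
    the higher orders up to [17 / 100], with enough room for the cubic bound [expR_ge3]. *)
Lemma inv_sqrt_le t : 0 <= t <= 17 / 100 ->
  (Num.sqrt (1 - 2 * t * 1))^-1 <= expR (t + 27 / 20 * t ^+ 2).
Proof.
move=> /andP [t0 t1]; rewrite mulr1.
set y := 2 * t + 27 / 10 * t ^+ 2.
have y0 : 0 <= y by rewrite addr_ge0 ?mulr_ge0 ?sqr_ge0 //; lra.
have D0 : 0 < 1 - 2 * t by lra.
have -> : expR (t + 27 / 20 * t ^+ 2) = Num.sqrt (expR y).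
  have -> : y = (t + 27 / 20 * t ^+ 2) * 2%:R by rewrite /y; field.
  by rewrite expRM_natr sqrtr_sqr ger0_norm ?expR_ge0.
rewrite -sqrtrV ?(ltW D0) // ler_sqrt ?expR_ge0 //.
rewrite -[leLHS]div1r ler_pdivrMr //.
apply: le_trans (ler_wpM2r (ltW D0) (expR_ge3 y0)); rewrite /y.
have t2 : t ^+ 2 <= (17 / 100) * t by rewrite expr2 ler_wpM2r.
have p k : 0 <= t ^+ k by rewrite exprn_ge0.
have t3 := ler_wpM2l (p 1%N) t2; have t4 := ler_wpM2l (p 2%N) t2.
have t5 := ler_wpM2l (p 3%N) t2; have t6 := ler_wpM2l (p 4%N) t2.
have t7 := ler_wpM2l (p 5%N) t2.
have := p 2%N; have := p 3%N; have := p 4%N; have := p 5%N; have := p 6%N.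
lra.
Qed.

Lemma avg_exp_unit_le u t : nrm2 u = 1 -> 0 <= t <= 17 / 100 ->
  avg (fun e => expR (t * (\sum_i sgnv e i 0 * u i 0) ^+ 2)) <=
  expR (t + 27 / 20 * t ^+ 2).
Proof.
move=> u1 t01; apply: le_trans (inv_sqrt_le t01).
have /andP [t0 t1] := t01; have tu : 2 * t * nrm2 u < 1 by rewrite u1; lra.
by have := avg_exp_sqr_le t0 tu; rewrite u1.
Qed.

(* [noise m g] is the mean of [g] at a sum of [m] independent outer squares of
   uniform sign vectors, and [reach m] is the support of that sum. *)
Fixpoint reach m V : Prop :=
  if m is m'.+1 then exists e V', reach m' V' /\ V = V' + outer (sgnv e) else V = 0.

Fixpoint noise m (g : M -> R) : R :=
  if m is m'.+1 then noise m' (fun V => avg (fun e => g (V + outer (sgnv e)))) else g 0.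

Lemma noise_le m (g1 g2 : M -> R) : (forall V, reach m V -> g1 V <= g2 V) ->
  noise m g1 <= noise m g2.
Proof.
elim: m g1 g2 => [|m IH] g1 g2 h /=; first exact: h.
by apply: IH => V rV; apply: avg_le => e; apply: h; exists e, V.
Qed.

Lemma noise_eq m (g1 g2 : M -> R) : (forall V, reach m V -> g1 V = g2 V) ->
  noise m g1 = noise m g2.
Proof.
by move=> h; apply/le_anti/andP; split; apply: noise_le => V rV; rewrite h.
Qed.

Lemma noiseZ m a (g : M -> R) : noise m (fun V => a * g V) = a * noise m g.
Proof.
elim: m g => [|m IH] g //=; rewrite -IH; apply: noise_eq => V _.
by rewrite avgZ.
Qed.

Lemma noiseD m (g1 g2 : M -> R) :
  noise m (fun V => g1 V + g2 V) = noise m g1 + noise m g2.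
Proof.
elim: m g1 g2 => [|m IH] g1 g2 //=; rewrite -IH; apply: noise_eq => V _.
by rewrite avgD.
Qed.

Lemma noise_cst m a : noise m (fun=> a) = a.
Proof.
elim: m => [|m IH] //=; rewrite -[RHS]IH; apply: noise_eq => V _.
by rewrite avg_cst.
Qed.

Lemma noise_sum m (I : finType) (F : I -> M -> R) :
  noise m (fun V => \sum_i F i V) = \sum_i noise m (F i).
Proof.
elim: m F => [|m IH] F //=; rewrite -IH; apply: noise_eq => V _.
by rewrite avg_sum.
Qed.

Lemma noise_ge0 m (g : M -> R) : (forall V, reach m V -> 0 <= g V) -> 0 <= noise m g.
Proof. by move=> h; rewrite -(noise_cst m 0); apply: noise_le. Qed.

Lemma reach_sym m V : reach m V -> V^T = V.
Proof.
elim: m V => [|m IH] V /=; first by move->; rewrite trmx0.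
by case=> e [V' [/IH sV' ->]]; rewrite linearD /= sV' sym_outer.
Qed.

(** The deterministic diagonal is what makes random rounding harmless later: independent rounding
    errors change the mean of a quadratic form only through its diagonal. *)
Lemma reach_diag m V i : reach m V -> V i i = m%:R.
Proof.
elim: m V => [|m IH] V /=; first by move->; rewrite mxE.
case=> e [V' [/IH V'i ->]]; rewrite mxE V'i -natr1; congr (_ + _).
by rewrite -qform_unitv qform_outer (bigD1 i) //= big1 => [|k ki];
  rewrite !mxE ?(negPf ki) ?mulr0 // eqxx mulr1 addr0 sqrr_sign.
Qed.

Lemma qform_outer_le w x : qform (outer w) x <= nrm2 w * nrm2 x.
Proof.
have := cauchy_schwarz_psd w x (trmx1 _ _) (@nrm2_ge0 R d).
by rewrite qform_outer /bform mulmx1 mxE; under eq_bigr do rewrite mxE.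
Qed.

Lemma reach_qform m V x : reach m V -> 0 <= qform V x <= (m * d.+1)%:R * nrm2 x.
Proof.
elim: m V => [|m IH] V /=.
  by move->; rewrite mul0n mul0r /qform /bform mulmx0 mul0mx mxE lexx.
case=> e [V' [/IH /andP [V0 Vx] ->]]; rewrite qform_add.
rewrite addr_ge0 ?qform_outer ?sqr_ge0 //= -qform_outer mulSn natrD mulrDl addrC.
apply: lerD => //.
by apply: le_trans (qform_outer_le _ _) _; rewrite nrm2_sgnv.
Qed.

Lemma noise_exp m u t : nrm2 u = 1 -> 0 <= t <= 17 / 100 ->
  noise m (fun V => expR (t * qform V u)) <= expR (m%:R * (t + 27 / 20 * t ^+ 2)).
Proof.
move=> u1 t01; elim: m => [|m IH] /=.
  by rewrite mul0r /qform /bform mulmx0 mul0mx mxE mulr0 !expR0.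
rewrite -natr1 mulrDl mul1r expRD; apply: le_trans (ler_wpM2r (expR_ge0 _) IH).
rewrite mulrC -noiseZ; apply: noise_le => V _.
under eq_avg do rewrite qform_add qform_outer mulrDr expRD.
by rewrite avgZ mulrC ler_wpM2r ?expR_ge0 ?avg_exp_unit_le.
Qed.

End SignNoise.

(** * A lattice bound for the top eigenvalue of the noise *)

Section ProductMean.
Variables (R : realFieldType) (I K : finType) (rho : I -> K -> R).
Hypotheses (rho_ge0 : forall i k, 0 <= rho i k) (rho1 : forall i, \sum_k rho i k = 1).
Implicit Types (F : {ffun I -> K} -> R) (h : K -> R).

Definition pmean F : R := \sum_(z : {ffun I -> K}) (\prod_i rho i (z i)) * F z.

Lemma pmean_prod (h : I -> K -> R) :
  pmean (fun z => \prod_i h i (z i)) = \prod_i \sum_k rho i k * h i k.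
Proof. by rewrite bigA_distr_bigA; apply: eq_bigr => z _; rewrite -big_split. Qed.

Lemma pmean_cst a : pmean (fun=> a) = a.
Proof.
rewrite /pmean -mulr_suml -(bigA_distr_bigA (fun i k => rho i k)).
by rewrite big1 ?mul1r.
Qed.

Lemma pmean1 i h : pmean (fun z => h (z i)) = \sum_k rho i k * h k.
Proof.
have -> : (fun z : {ffun I -> K} => h (z i)) =
   (fun z => \prod_j (if j == i then h (z j) else 1)).
  by apply/funext => z; rewrite (bigD1 i) //= eqxx big1 ?mulr1 // => j /negPf ->.
rewrite (pmean_prod (fun j k => if j == i then h k else 1)).
rewrite (bigD1 i) //= eqxx [X in _ * X]big1 ?mulr1 // => j /negPf ->.
by under eq_bigr do rewrite mulr1.
Qed.

Lemma pmean2 i j h h' : i != j -> pmean (fun z => h (z i) * h' (z j)) =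
  (\sum_k rho i k * h k) * (\sum_k rho j k * h' k).
Proof.
move=> ij; have ji : j == i = false by rewrite eq_sym (negPf ij).
pose w l k : R := if l == i then h k else if l == j then h' k else 1.
have -> : (fun z : {ffun I -> K} => h (z i) * h' (z j)) =
   (fun z => \prod_l w l (z l)).
  apply/funext => z; rewrite (bigD1 i) //= (bigD1 j) /= ?ji // /w eqxx ji eqxx.
  by rewrite big1 ?mulr1 // => l /andP [/negPf -> /negPf ->].
rewrite pmean_prod (bigD1 i) //= (bigD1 j) /= ?ji // /w eqxx ji eqxx.
rewrite [X in _ * (_ * X)]big1 ?mulr1 // => l /andP [/negPf -> /negPf ->].
by under eq_bigr do rewrite mulr1.
Qed.

Lemma pmeanD F G : pmean (fun z => F z + G z) = pmean F + pmean G.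
Proof. by rewrite -big_split; apply: eq_bigr => z _; rewrite mulrDr. Qed.

Lemma pmeanZ a F : pmean (fun z => a * F z) = a * pmean F.
Proof. by rewrite mulr_sumr; apply: eq_bigr => z _; rewrite mulrCA. Qed.

Lemma pmean_sum (J : finType) (F : J -> {ffun I -> K} -> R) :
  pmean (fun z => \sum_j F j z) = \sum_j pmean (F j).
Proof. by rewrite exchange_big; apply: eq_bigr => z _; rewrite mulr_sumr. Qed.

Lemma eq_pmean F G : F =1 G -> pmean F = pmean G.
Proof. by move=> h; apply: eq_bigr => z _; rewrite h. Qed.

End ProductMean.

Section Rounding.
Variables (R : realType) (D : nat).

(** The values run from [- D - 1/2] to [D + 1/2]. None is zero, so lattice vectors have positive
    norm and their Rayleigh quotients make sense. *)
Definition half_int (k : 'I_(D.+1.*2)) : R := k%:R - D.+1%:R + 2^-1.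

(* An unbiased random rounding of [y] to the half-integers: round to one of the
   two nearest integers, then add a fair sign times 1/2. *)
Lemma half_int_rounding (y : R) : `|y| <= D.-1%:R -> (0 < D)%N ->
  exists rho : 'I_(D.+1.*2) -> R, [/\ (forall k, 0 <= rho k <= 2^-1),
    \sum_k rho k = 1, \sum_k rho k * half_int k = y &
    exists2 s2 : R, 1 / 4 <= s2 <= 1 / 2 &
      \sum_k rho k * half_int k ^+ 2 = y ^+ 2 + s2 /\
      \sum_k rho k * (half_int k ^+ 2 - y ^+ 2) ^+ 2 <= 4 * y ^+ 2 + 9 / 4].
Proof.
move=> yD D0; pose l := Num.floor y.
have /andP [ly yl] := real_floor_itv (num_real y : y \is Num.real).
rewrite -/l in ly yl; rewrite ler_norml in yD; case/andP: yD => yD1 yD2.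
pose p := y - l%:~R; have p0 : 0 <= p by rewrite subr_ge0.
have p1 : p <= 1 by rewrite lerBlDl -(intrD _ l 1) ltW.
have DE : (D.-1%:R : R) = D%:R - 1 by rewrite -[in RHS](prednK D0) -natr1 addrK.
have l1 : (- (D%:Z - 1) <= l)%R.
  rewrite -ltzD1 -(ltr_int R) ; apply: le_lt_trans yl.
  by rewrite rmorphN rmorphB /= -DE.
have l2 : (l <= D%:Z - 1)%R.
  by rewrite -(ler_int R) rmorphB /= -DE (le_trans ly).
have kP (j : nat) : (j < 3)%N -> exists k : 'I_(D.+1.*2), k%:R = l%:~R + j%:R - 1 + D.+1%:R :> R.
  move=> j3; have [q qE] : exists q : nat, q%:Z = l + j%:Z - 1 + D.+1%:Z.
    exists (absz (l + j%:Z - 1 + D.+1%:Z)); rewrite gez0_abs //; lia.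
  have qD : (q < D.+1.*2)%N by lia.
  exists (Ordinal qD) => /=; have : (q%:Z)%:~R = (l + j%:Z - 1 + D.+1%:Z)%:~R :> R by rewrite qE.
  by rewrite !rmorphD rmorphN /=.
have [k0 k0E] := kP 0%N isT; have [k1 k1E] := kP 1%N isT; have [k2 k2E] := kP 2%N isT.
(* [k0], [k1], [k2] encode [l - 1/2], [l + 1/2], [l + 3/2]. The middle point is reached from both
   neighbouring integers and has weight exactly one half; no weight exceeds this. *)
pose rho k : R := (1 - p) / 2 * (k == k0)%:R + 2^-1 * (k == k1)%:R + p / 2 * (k == k2)%:R.
have rhoE (h : 'I_(D.+1.*2) -> R) :
    \sum_k rho k * h k = (1 - p) / 2 * h k0 + 2^-1 * h k1 + p / 2 * h k2.
  have one a (b : 'I_(D.+1.*2)) : \sum_k a * (k == b)%:R * h k = a * h b.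
    rewrite (bigD1 b) //= eqxx mulr1 big1 ?addr0 // => k /negPf ->.
    by rewrite mulr0 mul0r.
  under eq_bigr do rewrite 2!mulrDl.
  by rewrite !big_split /= !one.
have g0 : half_int k0 = y - p - 2^-1 by rewrite /half_int k0E /p; field.
have g1 : half_int k1 = y - p + 2^-1 by rewrite /half_int k1E /p; field.
have g2 : half_int k2 = y - p + 3 / 2 by rewrite /half_int k2E /p; field.
have pp : 0 <= p * (1 - p) by rewrite mulr_ge0 ?subr_ge0.
have pp4 : p * (1 - p) <= 1 / 4.
  by have := sqr_ge0 (p - 2^-1); rewrite expr2; lra.
exists rho; split.
- have d01 : k0 != k1 by apply: contraTneq isT => e; move: k0E; rewrite e k1E; lra.
  have d02 : k0 != k2 by apply: contraTneq isT => e; move: k0E; rewrite e k2E; lra.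
  have d12 : k1 != k2 by apply: contraTneq isT => e; move: k1E; rewrite e k2E; lra.
  move=> k; rewrite /rho.
  have [->|n0] := eqVneq k k0; first by rewrite (negPf d01) (negPf d02) /=; lra.
  have [->|n1] := eqVneq k k1; first by rewrite (negPf d12) /=; lra.
  by have [_|n2] := eqVneq k k2; rewrite /=; lra.
- by rewrite -[LHS](eq_bigr _ (fun k _ => mulr1 (rho k))) rhoE; field.
- by rewrite rhoE g0 g1 g2; field.
(* The variance: [1 / 4] from the half sign, [p * (1 - p)] from the choice of the integer. *)
exists (1 / 4 + p * (1 - p)); first by lra.
split; first by rewrite rhoE g0 g1 g2; field.
rewrite rhoE g0 g1 g2.
(* For a rounding error [z] the deviation is [z * (2 * y + z)], and [(2 * y + z) ^+ 2 <= 8 * y ^+ 2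
   + 2 * z ^+ 2]. The factor [z ^+ 2] is kept because it averages to the variance, at most
   [1 / 2]. *)
have key (z a : R) : z ^+ 2 <= 9 / 4 -> 0 <= a ->
    a * ((y + z) ^+ 2 - y ^+ 2) ^+ 2 <= a * (z ^+ 2 * (8 * y ^+ 2 + 9 / 2)).
  move=> z2 a0; apply: ler_wpM2l => //.
  have -> : ((y + z) ^+ 2 - y ^+ 2) ^+ 2 = z ^+ 2 * (2 * y + z) ^+ 2 by ring.
  apply: ler_wpM2l; first exact: sqr_ge0.
  by have := sqr_ge0 (2 * y - z); lra.
have h0 := key (- p - 2^-1) ((1 - p) / 2).
have h1 := key (- p + 2^-1) 2^-1.
have h2 := key (- p + 3 / 2) (p / 2).
have -> : y - p - 2^-1 = y + (- p - 2^-1) by ring.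
have -> : y - p + 2^-1 = y + (- p + 2^-1) by ring.
have -> : y - p + 3 / 2 = y + (- p + 3 / 2) by ring.
by apply: le_trans (lerD (lerD (h0 _ _) (h1 _ _)) (h2 _ _)) _; nra.
Qed.

End Rounding.

Section Lattice.
Variables (R : realType) (d : nat).
Local Notation M := 'M[R]_d.+1.
Local Notation cV := 'cV[R]_d.+1.
Local Notation dim := (d.+1%:R : R).
Local Notation D := (2 * d.+1).+1.
Local Notation K := 'I_(D.+1.*2).
Local Notation grid := {ffun 'I_d.+1 -> K}.
Implicit Types (z : grid) (V : M) (x y : cV).

Definition lat z : cV := \col_i half_int R (z i).

Lemma half_int_sqr (k : K) : 1 / 4 <= half_int R k ^+ 2.
Proof.
rewrite /half_int; have [kD|kD] := leqP D.+1 k.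
  have : (D.+1%:R : R) <= k%:R by rewrite ler_nat.
  by move: (k%:R) (D.+1%:R) => a b ab; nra.
have : (k%:R : R) + 1 <= D.+1%:R by rewrite natr1 ler_nat.
by move: (k%:R) (D.+1%:R) => a b ab; nra.
Qed.

Lemma nrm2_lat z : nrm2 (lat z) = \sum_i half_int R (z i) ^+ 2.
Proof. by rewrite nrm2E; apply: eq_bigr => i _; rewrite mxE. Qed.

Lemma nrm2_lat_gt0 z : 0 < nrm2 (lat z).
Proof.
rewrite nrm2_lat (bigD1 ord0) //=.
apply: lt_le_trans (_ : 1 / 4 <= _); first by lra.
apply: le_trans (half_int_sqr (z ord0)) _; rewrite lerDl.
by apply: sumr_ge0 => i _; exact: sqr_ge0.
Qed.

(* A partition function over half-integer points, whose mean over the noise is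
   computed point by point. A random rounding of a multiple of a unit vector [x]
   has small quadratic deviation, so by Jensen's inequality the sum dominates
   [exp (t * (qform V x - n))] in every direction [x] at once, up to the
   exponents in [lat_bound_qform]. *)
Definition lat_sum t n V : R := \sum_z
  expR (- (nrm2 (lat z) / 5) + t * (qform V (lat z) / nrm2 (lat z) - n)).

Lemma jensen_exp (I : finType) (w f : I -> R) : (forall i, 0 <= w i) ->
  \sum_i w i = 1 -> expR (\sum_i w i * f i) <= \sum_i w i * expR (f i).
Proof.
move=> w0 w1; set m := \sum_i w i * f i.
apply: (@le_trans _ _ (\sum_i w i * (expR m * (1 + (f i - m))))).
  rewrite (eq_bigr (fun i => expR m * (w i * (1 - m)) + expR m * (w i * f i))) => [|i _].
    by rewrite big_split /= -!mulr_sumr -mulr_suml w1 -/m; lra.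
  by ring.
apply: ler_sum => i _; apply: ler_wpM2l => //.
rewrite -[f i in leRHS](subrK m) expRD [leRHS]mulrC ler_wpM2l ?expR_ge0 //.
exact: expR_ge1Dx.
Qed.

(** The law of the rounding [z] of [Num.sqrt (2 * dim) *: x] is size-biased by [nrm2 (lat z) / S].
    This cancels the denominator of the Rayleigh quotient, so its mean needs second moments only; by
    independence and the constant diagonal, the rounding adds just [n * \sum_i s i], which the
    centring by [n] removes. In Jensen's inequality the penalty costs at most
    [11/50 * S <= 11/20 * dim], and the factor [2^-1] per coordinate appears since no rounding
    weight exceeds one half. *)
Lemma lat_sum_ge t n V x : (forall i, V i i = n) -> nrm2 x = 1 -> (20 < d.+1)%N ->
  exists2 S, 9 / 4 * dim <= S <= 5 / 2 * dim &
  expR (t * (2 * dim * (qform V x - n)) / S) <=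
  lat_sum t n V * 2^-1 ^+ d.+1 * expR (11 / 20 * dim + 1 / 10).
Proof.
move=> Vn x1 d20; have dim21 : 21 <= dim by rewrite ler_nat.
pose y : cV := Num.sqrt (2 * dim) *: x.
have ynrm : nrm2 y = 2 * dim.
  by rewrite /nrm2 qform_scalev -/(nrm2 x) x1 mulr1 sqr_sqrtr // mulr_ge0 ?ler0n.
have yD i : `|y i 0| <= D.-1%:R.
  rewrite -(ler_pXn2r (ltn0Sn 1)) ?nnegrE // real_normK ?num_real //.
  apply: (@le_trans _ _ (nrm2 y)).
    rewrite nrm2E (bigD1 i) //= lerDl; apply: sumr_ge0 => k _; exact: sqr_ge0.
  rewrite ynrm /= natrM; have := dim21; nra.
pose rhoP i := cid (half_int_rounding (yD i) isT).
pose rho i := projT1 (rhoP i).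
have rho_le i k : 0 <= rho i k <= 2^-1 by have [h _ _ _] := projT2 (rhoP i); exact: h.
have rho0 i k : 0 <= rho i k by case/andP: (rho_le i k).
have rho1 i : \sum_k rho i k = 1 by have [_ h _ _] := projT2 (rhoP i); exact: h.
have rhom i : \sum_k rho i k * half_int R k = y i 0 by have [_ _ h _] := projT2 (rhoP i); exact: h.
have sP i : exists s2 : R, [/\ 1 / 4 <= s2 <= 1 / 2,
   \sum_k rho i k * half_int R k ^+ 2 = y i 0 ^+ 2 + s2 &
   \sum_k rho i k * (half_int R k ^+ 2 - y i 0 ^+ 2) ^+ 2 <= 4 * y i 0 ^+ 2 + 9 / 4].
  by have [_ _ _ [s2 ? [? ?]]] := projT2 (rhoP i); exists s2.
pose s i := projT1 (cid (sP i)).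
have s_b i : 1 / 4 <= s i <= 1 / 2 by have [h _ _] := projT2 (cid (sP i)); exact: h.
have s_m i : \sum_k rho i k * half_int R k ^+ 2 = y i 0 ^+ 2 + s i.
  by have [_ h _] := projT2 (cid (sP i)); exact: h.
have s_v i : \sum_k rho i k * (half_int R k ^+ 2 - y i 0 ^+ 2) ^+ 2 <= 4 * y i 0 ^+ 2 + 9 / 4.
  by have [_ _ h] := projT2 (cid (sP i)); exact: h.
pose S := nrm2 y + \sum_i s i.
have Slo : 9 / 4 * dim <= S.
  have : \sum_(i < d.+1) (1 / 4 : R) <= \sum_i s i.
    by apply: ler_sum => i _; case/andP: (s_b i).
  by rewrite sumr_const card_ord /S ynrm -mulr_natr; lra.
have Shi : S <= 5 / 2 * dim.
  have : \sum_i s i <= \sum_(i < d.+1) (1 / 2 : R).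
    by apply: ler_sum => i _; case/andP: (s_b i).
  by rewrite sumr_const card_ord /S ynrm -mulr_natr; lra.
have S0 : 0 < S by lra.
pose Em := pmean rho.
have ES : Em (fun z => nrm2 (lat z)) = S.
  rewrite /Em (@eq_pmean _ _ _ rho _ (fun z => \sum_i half_int R (z i) ^+ 2)); last exact: nrm2_lat.
  rewrite pmean_sum /S nrm2E -big_split; apply: eq_bigr => i _.
  by rewrite (pmean1 rho1 i (fun k => half_int R k ^+ 2)) s_m.
have EV : Em (fun z => qform V (lat z)) = qform V y + n * \sum_i s i.
  rewrite /Em (@eq_pmean _ _ _ rho _ (fun z => \sum_i \sum_j V i j * (half_int R (z i) * half_int R (z j)))); last first.
    by move=> z; rewrite qformE; apply: eq_bigr => i _; apply: eq_bigr => j _; rewrite !mxE.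
  rewrite pmean_sum qformE mulr_sumr -big_split; apply: eq_bigr => i _ /=.
  rewrite pmean_sum (bigD1 i) //= [in RHS](bigD1 i) //= addrAC; congr (_ + _).
    rewrite pmeanZ (@eq_pmean _ _ _ rho _ (fun z => half_int R (z i) ^+ 2)) => [|z]; last by rewrite expr2.
    by rewrite (pmean1 rho1 i (fun k => half_int R k ^+ 2)) s_m Vn; ring.
  apply: eq_bigr => j ji; rewrite pmeanZ.
  by rewrite (pmean2 rho1 (@half_int R D) (@half_int R D)) ?[i == j]eq_sym // !rhom.
have E4 : Em (fun z => nrm2 (lat z) ^+ 2) <= S ^+ 2 * (11 / 10).
  pose X i z : R := half_int R (z i) ^+ 2 - (y i 0 ^+ 2 + s i).
  have EX i : Em (X i) = 0.
    rewrite /Em pmeanD pmean_cst // (pmean1 rho1 i (fun k => half_int R k ^+ 2)) s_m.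
    by rewrite subrr.
  have EXX i : Em (fun z => X i z * X i z) <= 4 * y i 0 ^+ 2 + 9 / 4.
    apply: le_trans (s_v i).
    pose W z := half_int R (z i) ^+ 2 - y i 0 ^+ 2.
    have -> : Em (fun z => X i z * X i z) =
       Em (fun z => W z ^+ 2 + (- (2 * s i) * W z + s i ^+ 2)).
      by apply: eq_pmean => z; rewrite /X /W; ring.
    rewrite /Em !pmeanD pmeanZ pmean_cst // {2}/W pmeanD pmean_cst //.
    rewrite (pmean1 rho1 i (fun k => (half_int R k ^+ 2 - y i 0 ^+ 2) ^+ 2)).
    rewrite (pmean1 rho1 i (fun k => half_int R k ^+ 2)) s_m.
    by have := sqr_ge0 (s i); lra.
  have EXY i j : i != j -> Em (fun z => X i z * X j z) = 0.
    move=> ij; rewrite /Em (pmean2 rho1 (fun k => half_int R k ^+ 2 - (y i 0 ^+ 2 + s i))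
      (fun k => half_int R k ^+ 2 - (y j 0 ^+ 2 + s j)) ij).
    under eq_bigr do rewrite mulrBr.
    by rewrite sumrB s_m -mulr_suml rho1 mul1r subrr mul0r.
  have -> : Em (fun z => nrm2 (lat z) ^+ 2) =
     Em (fun z => (\sum_i \sum_j X i z * X j z) + (2 * S * nrm2 (lat z) + - S ^+ 2)).
    apply: eq_pmean => z.
    have -> : \sum_i \sum_j X i z * X j z = (nrm2 (lat z) - S) ^+ 2.
      rewrite expr2 /S nrm2_lat nrm2E -big_split /= -sumrB mulr_suml.
      by apply: eq_bigr => i _; rewrite mulr_sumr.
    by ring.
  rewrite /Em !pmeanD pmeanZ pmean_cst // -/Em ES.
  have : Em (fun z => \sum_i \sum_j X i z * X j z) <= 41 / 4 * dim.
    rewrite /Em pmean_sum.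
    apply: (@le_trans _ _ (\sum_i (4 * y i 0 ^+ 2 + 9 / 4))).
      apply: ler_sum => i _; rewrite pmean_sum (bigD1 i) //= big1 => [|j ji].
        by rewrite addr0; exact: EXX.
      by apply: EXY; rewrite eq_sym.
    by rewrite big_split /= -mulr_sumr -nrm2E ynrm sumr_const card_ord -mulr_natr; lra.
  (* From [S >= 9/4 * dim], the slack [S ^+ 2 / 10] is at least [81/160 * dim ^+ 2], which exceeds
     the variance bound [41/4 * dim] once [dim >= 21]. *)
  by rewrite -/Em; nra.
exists S; first by rewrite Slo.
(* With [a = nrm2 (lat z) / S], the summand [1 - a] in [f] is inserted so that [a <= expR (a - 1)]
   absorbs the size bias. Its biased mean is at least [- 1/10], the source of that constant. *)
pose wt z : R := (\prod_i rho i (z i)) * nrm2 (lat z) / S.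
pose f z : R := - (nrm2 (lat z) / 5) + t * (qform V (lat z) / nrm2 (lat z) - n) +
   (1 - nrm2 (lat z) / S).
have wt0 z : 0 <= wt z.
  by rewrite divr_ge0 ?(ltW S0) // mulr_ge0 ?prodr_ge0 ?nrm2_ge0.
have wt1 : \sum_z wt z = 1 by rewrite /wt -mulr_suml -[X in X / _]/(Em _) ES divff ?gt_eqF.
have mid : \sum_z wt z * f z = t * (2 * dim * (qform V x - n)) / S -
    (1 / 5 + 1 / S) * (Em (fun z => nrm2 (lat z) ^+ 2) / S) + 1.
  have -> : \sum_z wt z * f z = Em (fun z => t / S * qform V (lat z) +
     ((1 - t * n) / S * nrm2 (lat z) + (- ((1 / 5 + 1 / S) / S) * nrm2 (lat z) ^+ 2))).
    apply: eq_bigr => z _; rewrite /wt /f -!mulrA; congr (_ * _).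
    have := nrm2_lat_gt0 z => z0.
    by field; rewrite !gt_eqF.
  rewrite /Em !pmeanD !pmeanZ -/Em ES EV.
  have -> : qform V y = 2 * dim * qform V x.
    by rewrite qform_scalev sqr_sqrtr // mulr_ge0.
  have -> : \sum_i s i = S - 2 * dim by rewrite /S ynrm; ring.
  by field; rewrite gt_eqF.
have step1 : expR (\sum_z wt z * f z) <= lat_sum t n V * 2^-1 ^+ d.+1.
  apply: le_trans (jensen_exp _ wt0 wt1) _.
  rewrite /lat_sum mulr_suml; apply: ler_sum => z _.
  rewrite /f [expR (_ + (1 - _))]expRD mulrCA ler_wpM2l ?expR_ge0 //.
  have pr : \prod_i rho i (z i) <= 2^-1 ^+ d.+1.
    rewrite -[in leRHS](card_ord d.+1) -prodr_const; apply: ler_prod => i _.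
    exact: rho_le.
  apply: le_trans pr; rewrite /wt -!mulrA -[leRHS]mulr1.
  apply: ler_wpM2l; first by apply: prodr_ge0.
  rewrite mulrA; set a := nrm2 (lat z) / S.
  have : a <= expR (a - 1) by have := expR_ge1Dx (a - 1); rewrite addrC subrK.
  move=> /(ler_wpM2r (expR_ge0 (1 - a))) /le_trans; apply.
  by rewrite -expRD addrA subrK subrr expR0.
have e4 : Em (fun z => nrm2 (lat z) ^+ 2) / S <= S * (11 / 10).
  by rewrite ler_pdivrMr // mulrAC -expr2.
apply: le_trans (ler_wpM2r (expR_ge0 _) step1).
rewrite -expRD ler_expR mid.
have : (1 / 5 + 1 / S) * (Em (fun z => nrm2 (lat z) ^+ 2) / S) <=
    (1 / 5 + 1 / S) * (S * (11 / 10)).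
  by apply: ler_wpM2l e4; rewrite addr_ge0 ?divr_ge0 ?(ltW S0).
have -> : (1 / 5 + 1 / S) * (S * (11 / 10)) = S * (11 / 50) + 11 / 10.
  by field; rewrite gt_eqF.
lra.
Qed.

Definition lat_bound t n V : R :=
  lat_sum t n V * 2^-1 ^+ d.+1 * expR (11 / 20 * dim + 1 / 10).

Lemma lat_bound_ge1 t n V : (forall i, V i i = n) -> (20 < d.+1)%N ->
  1 <= lat_bound t n V.
Proof.
move=> Vn d20; have [S _] := lat_sum_ge t Vn (nrm2_unitv R (ord0 : 'I_d.+1)) d20.
by rewrite qform_unitv Vn subrr !mulr0 mul0r expR0.
Qed.

(** The factor [5 / 4] is the bound on [S / (2 * dim)]. Replacing [S] by [5/2 * dim] is legitimate
    because the logarithm is nonnegative; [lat_bound_ge1] obtains this from a coordinate vector,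
    whose quadratic form is exactly [n]. *)
Lemma lat_bound_qform t n V x : 0 <= t -> (forall i, V i i = n) -> nrm2 x = 1 ->
  (20 < d.+1)%N -> t * (qform V x - n) <= 5 / 4 * ln (lat_bound t n V).
Proof.
move=> t0 Vn x1 d20; have B1 := lat_bound_ge1 t Vn d20.
have lB0 : 0 <= ln (lat_bound t n V) by exact: ln_ge0.
have [S /andP [S1 S2]] := lat_sum_ge t Vn x1 d20.
have dim0 : 0 < dim by rewrite ltr0n.
have S0 : 0 < S by lra.
rewrite -/(lat_bound t n V) -ler_ln ?posrE ?expR_gt0 ?(lt_le_trans _ B1) // expRK.
rewrite ler_pdivrMr // => h.
have : ln (lat_bound t n V) * S <= ln (lat_bound t n V) * (5 / 2 * dim).
  by rewrite ler_wpM2l.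
move=> /(le_trans h) {}h; rewrite -subr_ge0 -(pmulr_rge0 _ dim0).
lra.
Qed.

End Lattice.

Section LatticeNoise.
Variable R : realType.

Lemma pronic_ge j : (20 + 10 * j <= (4 + j) * (4 + j).+1)%N.
Proof. by case: j => [|j] //; nia. Qed.

(** The two factors on the left are the numerical bounds met in [half_theta_sum]:
    [expR (- (1 / 20))], and [1 + 0.671 + 0.303 + 0.092 + 0.023]. Halving the exponent makes the
    cubic Taylor bound sharp enough. *)
Lemma exp69 : (952 / 1000) * (2089 / 1000) <= expR (69 / 100) :> R.
Proof.
have -> : expR (69 / 100) = expR (345 / 1000) * expR (345 / 1000) :> R.
  by rewrite -expRD; congr expR; field.
have h : (0 : R) <= 345 / 1000 by lra.
have e : 1411 / 1000 <= expR (345 / 1000) :> R.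
  by apply: le_trans (expR_ge3 h); lra.
have h' : (0 : R) <= 1411 / 1000 by lra.
by apply: le_trans (ler_pM h' h' e e); lra.
Qed.

(** Since [(j + 1/2) ^+ 2 = 1/4 + j * (j + 1)], the sum is [expR (- (1 / 20))] times a series in
    [y ^+ (j * j.+1)]. Four terms are evaluated; from the fifth on, [pronic_ge] compares with a
    geometric series of ratio [y ^+ 10]. *)
Lemma half_theta_sum m :
  \sum_(j < 4 + m) expR (- ((j%:R + 2^-1) ^+ 2 / 5)) <= expR (69 / 100 : R).
Proof.
pose y : R := expR (- (1 / 5)).
have y0 : 0 <= y by exact: expR_ge0.
have expN (a b c : R) : 0 <= a -> b <= 1 + a + a * a / 2 + a * a * a / 6 ->
    1 <= b * c -> 0 <= c -> expR (- a) <= c.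
  move=> a0 ba bc c0; rewrite expRN -[leLHS]mul1r ler_pdivrMr ?expR_gt0 //.
  by apply: le_trans bc _; rewrite mulrC ler_wpM2l // (le_trans ba) // expR_ge3.
have y1 : y <= 819 / 1000 by apply: (@expN _ (1221 / 1000 + 1 / 4000)); lra.
have yle1 : y <= 1 by lra.
have c1 : expR (- (1 / 20)) <= 952 / 1000 :> R.
  by apply: (@expN _ (1051 / 1000)); lra.
have term (j : nat) : expR (- ((j%:R + 2^-1) ^+ 2 / 5)) = expR (- (1 / 20)) * y ^+ (j * j.+1).
  by rewrite -expRM_natl -expRD natrM -natr1; congr expR; field.
rewrite (eq_bigr _ (fun (j : 'I_(4 + m)) _ => term j)) -mulr_sumr.
have yn k : 0 <= y ^+ k by rewrite exprn_ge0.
have yM (k l : nat) (a b c : R) : y ^+ k <= a -> y ^+ l <= b -> a * b <= c -> y ^+ (k + l) <= c.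
  move=> ka lb /(le_trans _); apply; rewrite exprD.
  by apply: ler_pM.
have p2 : y ^+ 2 <= 671 / 1000 by apply: (yM 1%N 1%N _ _ _ y1 y1); clear; lra.
have p4 : y ^+ 4 <= 451 / 1000 by apply: (yM 2%N 2%N _ _ _ p2 p2); clear; lra.
have p6 : y ^+ 6 <= 303 / 1000 by apply: (yM 4%N 2%N _ _ _ p4 p2); clear; lra.
have p10 : y ^+ 10 <= 137 / 1000 by apply: (yM 6%N 4%N _ _ _ p6 p4); clear; lra.
have p12 : y ^+ 12 <= 92 / 1000 by apply: (yM 6%N 6%N _ _ _ p6 p6); clear; lra.
have p20 : y ^+ 20 <= 19 / 1000 by apply: (yM 10%N 10%N _ _ _ p10 p10); clear; lra.
have q0 : 0 < 1 - y ^+ 10 by clear - p10; lra.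
have tail : (\sum_(j < m) y ^+ ((4 + j) * (4 + j).+1)) * (1 - y ^+ 10) <= y ^+ 20.
  apply: (@le_trans _ _ ((y ^+ 20 * \sum_(j < m) (y ^+ 10) ^+ j) * (1 - y ^+ 10))).
    rewrite ler_wpM2r ?(ltW q0) // mulr_sumr; apply: ler_sum => j _; rewrite -exprM -exprD.
    exact: (ler_wiXn2l y0 yle1 (pronic_ge j)).
  have -> : y ^+ 20 * (\sum_(j < m) (y ^+ 10) ^+ j) * (1 - y ^+ 10) =
      y ^+ 20 * (1 - (y ^+ 10) ^+ m).
    by rewrite -[1 - (y ^+ 10) ^+ m]opprB subrX1; ring.
  by rewrite ler_piMr // gerBl exprn_ge0.
rewrite big_split_ord /= 4!big_ord_recr big_ord0 /= add0r.
set T := \sum_(j < m) _ in tail *.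
have T0 : 0 <= T by apply: sumr_ge0.
have tl : T <= 23 / 1000.
  have := ler_wpM2l T0 p10; clear - tail p20; lra.
rewrite mul0n expr0 (_ : (1 * 2)%N = 2) // (_ : (2 * 3)%N = 6) // (_ : (3 * 4)%N = 12) //.
apply: le_trans exp69; apply: ler_pM c1 _; first exact: expR_ge0.
  by rewrite !addr_ge0.
clear - p2 p6 p12 tl; lra.
Qed.

(** The division by two is the factor [2^-1] that [lat_bound] grants to each coordinate; the
    half-integers are symmetric, so only the positive ones remain. *)
Lemma theta_sum_le D : (3 <= D)%N ->
  (\sum_(k < D.+1.*2) expR (- (half_int R k ^+ 2 / 5))) / 2 <= expR (69 / 100).
Proof.
move=> D3; pose h (j : nat) : R := expR (- ((j%:R + 2^-1) ^+ 2 / 5)).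
have -> : \sum_(k < D.+1.*2) expR (- (half_int R k ^+ 2 / 5)) = 2 * \sum_(j < D.+1) h j.
  pose F (k : nat) : R := expR (- ((k%:R - D.+1%:R + 2^-1) ^+ 2 / 5)).
  rewrite -[LHS]/(\sum_(k < D.+1.*2) F k) -(big_mkord xpredT F).
  rewrite (@big_cat_nat _ _ _ D.+1) //=; last by lia.
  have -> : \sum_(0 <= k < D.+1) F k = \sum_(j < D.+1) h j.
    rewrite big_mkord (reindex_inj rev_ord_inj); apply: eq_bigr => j _ /=.
    rewrite /F /h natrB //; congr (expR (- (_ / 5))).
    by rewrite -[j.+1%:R]natr1; field.
  have -> : \sum_(D.+1 <= k < D.+1.*2) F k = \sum_(j < D.+1) h j.
    rewrite -{1}[D.+1]add0n big_addn -addnn addnK big_mkord; apply: eq_bigr => j _.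
    by rewrite /F /h natrD addrK.
  by rewrite mulr_natl mulr2n.
rewrite mulrC mulKf // /h.
have -> : D.+1 = (4 + (D.+1 - 4))%N by lia.
exact: half_theta_sum.
Qed.

Variable d : nat.
Local Notation M := 'M[R]_d.+1.

(** Each lattice point contributes one fixed direction, where [noise_exp] applies; the centring by
    [t * m%:R] leaves only the quadratic exponent. The sum over the grid then factorises over
    coordinates, and [31 / 25 = 11 / 20 + 69 / 100]. *)
Lemma noise_lat_bound m t : 0 <= t <= 17 / 100 ->
  noise m (lat_bound t m%:R : M -> R) <=
  expR (27 / 20 * (m%:R * t ^+ 2) + (31 / 25 * d.+1%:R + 1 / 10)).
Proof.
move=> t01; pose u z := (Num.sqrt (nrm2 (lat R z)))^-1 *: lat R (z : {ffun 'I_d.+1 -> _}).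
have u1 z : nrm2 (u z) = 1.
  rewrite /nrm2 qform_scalev exprVn sqr_sqrtr ?nrm2_ge0 // mulVf //.
  by rewrite gt_eqF // nrm2_lat_gt0.
pose c : R := 2^-1 ^+ d.+1 * expR (11 / 20 * d.+1%:R + 1 / 10).
have c0 : 0 <= c by rewrite mulr_ge0 ?expR_ge0 ?exprn_ge0 ?invr_ge0.
pose E : R := expR (27 / 20 * (m%:R * t ^+ 2)).
have -> : noise m (lat_bound t m%:R : M -> R) = noise m (fun V : M => c * lat_sum t m%:R V).
  by apply: noise_eq => V _; rewrite /lat_bound /c; ring.
rewrite noiseZ noise_sum.
apply: (@le_trans _ _ (c * \sum_z (expR (- (nrm2 (lat R (z : {ffun 'I_d.+1 -> _})) / 5)) * E))).
  apply: ler_wpM2l => //; apply: ler_sum => z _.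
  rewrite (noise_eq (g2 := fun V : M => expR (- (nrm2 (lat R z) / 5)) *
     (expR (- (t * m%:R)) * expR (t * qform V (u z))))); last first.
    move=> V _; rewrite -!expRD; congr expR; congr (_ + _).
    rewrite qform_scalev exprVn sqr_sqrtr ?nrm2_ge0 //.
    by rewrite [_^-1 * _]mulrC; ring.
  rewrite !noiseZ ler_wpM2l ?expR_ge0 //.
  apply: le_trans (ler_wpM2l (expR_ge0 _) (noise_exp m (u1 z) t01)) _.
  by rewrite -expRD ler_expR /E; lra.
rewrite -mulr_suml mulrA.
have -> : \sum_z expR (- (nrm2 (lat R (z : {ffun 'I_d.+1 -> _})) / 5)) =
   (\sum_(k < (2 * d.+1).+2.*2) expR (- (half_int R k ^+ 2 / 5))) ^+ d.+1.
  rewrite -[X in _ ^+ X]card_ord -prodr_const bigA_distr_bigA; apply: eq_bigr => z _.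
  rewrite nrm2_lat -expR_sum; congr expR.
  by rewrite sumrN mulr_suml.
rewrite expRD mulrC ler_wpM2l ?expR_ge0 // /c mulrAC -exprMn mulrC.
have -> : expR (31 / 25 * d.+1%:R + 1 / 10) =
   expR (11 / 20 * d.+1%:R + 1 / 10) * expR (69 / 100) ^+ d.+1 :> R.
  by rewrite -expRM_natr -expRD; congr expR; field.
rewrite ler_wpM2l ?expR_ge0 // lerXn2r ?nnegrE ?expR_ge0 //.
  by rewrite mulr_ge0 ?invr_ge0 // sumr_ge0 // => k _; exact: expR_ge0.
by rewrite mulrC theta_sum_le //; lia.
Qed.

End LatticeNoise.

(** * Resolvent traces of the noise *)

Section NoiseTrace.
Variables (R : realType) (d : nat).
Local Notation M := 'M[R]_d.+1.
Local Notation cV := 'cV[R]_d.+1.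
Local Notation dim := (d.+1%:R : R).
Implicit Types (V : M) (x : cV).

Lemma qform_le_unit V (a : R) x : (forall u, nrm2 u = 1 -> qform V u <= a) ->
  qform V x <= a * nrm2 x.
Proof.
move=> h; have [x0|x0] := eqVneq x 0.
  by rewrite x0 /nrm2 /qform /bform !mulmx0 !mxE mulr0.
have n0 : 0 < nrm2 x by rewrite lt_neqAle eq_sym nrm2_eq0 x0 nrm2_ge0.
have := h ((Num.sqrt (nrm2 x))^-1 *: x).
rewrite /nrm2 !qform_scalev -/(nrm2 x) exprVn sqr_sqrtr ?(ltW n0) // mulVf ?gt_eqF //.
by move=> /(_ erefl); rewrite mulrC ler_pdivrMr.
Qed.

Lemma coercive_shift V (a l : R) : V^T = V -> 0 <= a ->
  (forall x, qform V x <= l * nrm2 x) -> coercive (1 - a * l) (1 - a *: V).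
Proof.
move=> sV a0 h; split; first by rewrite linearB linearZ /= trmx1 sV.
move=> x; rewrite qform_add qform_opp qform_scale -/(nrm2 x) mulrBl mul1r lerD2l.
by rewrite lerN2 -mulrA ler_wpM2l.
Qed.

Lemma inv_one_sub_le (z : R) : 0 <= z <= 1 / 2 -> (1 - z)^-1 <= expR (z + z ^+ 2).
Proof.
move=> /andP [z0 z1]; have z2 : 0 <= z + z ^+ 2 by rewrite addr_ge0 ?sqr_ge0.
rewrite -[leLHS]mul1r ler_pdivrMr; last lra.
have zz : 0 <= 1 - z by lra.
apply: le_trans (ler_wpM2r zz (expR_ge2 z2)).
have : 0 <= z ^+ 2 * ((1 - z) * (1 + z) ^+ 2 / 2 - z).
  by rewrite mulr_ge0 ?sqr_ge0 //; nra.
by rewrite -subr_ge0 => h; rewrite -subr_ge0; move: h; congr (_ <= _); ring.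
Qed.

Lemma expR_interpolate (r u : R) : 0 <= r <= 1 -> expR (r * u) <= 1 - r + r * expR u.
Proof.
move=> /andP [r0 r1].
have := @jensen_exp R bool (fun b => if b then r else 1 - r) (fun b => if b then u else 0).
rewrite !big_bool /= mulr0 addr0 expR0 mulr1 => J.
rewrite addrC; apply: J.
  by case; rewrite ?subr_ge0.
by rewrite addrCA subrr addr0.
Qed.

(** Jensen's inequality for the concave power [r]: pointwise, [g] to the power [r] lies below the
    tangent at [expR k], which is affine in [g] and can be averaged. *)
Lemma noise_expR_ln_le m (g : M -> R) (r k : R) : 0 <= r <= 1 ->
  (forall V, reach m V -> 0 < g V) -> noise m g <= expR k ->
  noise m (fun V => expR (r * ln (g V))) <= expR (r * k).
Proof.
move=> r01 g0 gk; have /andP [r0 r1] := r01.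
apply: (@le_trans _ _ (noise m (fun V => expR (r * k) * (1 - r + r * expR (- k) * g V)))).
  apply: noise_le => V rV.
  have -> : r * ln (g V) = r * k + r * (ln (g V) - k) by ring.
  rewrite expRD ler_wpM2l ?expR_ge0 //; apply: le_trans (expR_interpolate _ r01) _.
  by rewrite expRD lnK ?posrE ?g0 // -mulrA [g V * _]mulrC.
rewrite noiseZ noiseD noise_cst noiseZ -[leRHS]mulr1 ler_wpM2l ?expR_ge0 //.
have : expR (- k) * noise m g <= 1.
  by rewrite expRN mulrC ler_pdivrMr ?expR_gt0 // mul1r.
by move=> /(ler_wpM2l r0); rewrite mulr1 mulrA; lra.
Qed.

(** The top eigenvalue of [V] is at most [L], and [expR (b * L)] is [expR (b * m%:R)] times the
    power [r] of [lat_bound]; [5 / 4 * b <= t] says [r <= 1], so Jensen's inequality applies. The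
    last two hypotheses keep the resolvent defined and the second-order part of [(1 - z) ^- N.*2]
    below [expR (1 / 4) <= 4 / 3]. *)
Lemma noise_trace_bound m N (t b : R) : (20 < d.+1)%N -> (0 < N)%N ->
  0 < t <= 17 / 100 -> 0 <= b -> 5 / 4 * b <= t ->
  b * (m * d.+1)%:R <= N.*2%:R / 2 ->
  (b * (m * d.+1)%:R) ^+ 2 <= N.*2%:R / 4 ->
  noise m (fun V : M => \tr ((1 - (b / N.*2%:R) *: V)^-1 ^+ N.*2)) <=
  4 / 3 * dim * expR (b * m%:R + 5 / 4 * b / t *
     (27 / 20 * (m%:R * t ^+ 2) + (31 / 25 * dim + 1 / 10))).
Proof.
move=> d20 N0 /andP [t0 t1] b0 bt bN bN2.
set nn : R := N.*2%:R; have nn0 : 0 < nn by rewrite ltr0n double_gt0.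
set r := 5 / 4 * b / t.
have r01 : 0 <= r <= 1.
  by rewrite divr_ge0 ?(ltW t0) ?mulr_ge0 //= ler_pdivrMr // mul1r.
have tt : 0 <= t <= 17 / 100 by rewrite (ltW t0).
rewrite expRD mulrA.
have Bpos V : reach m V -> 0 < lat_bound t m%:R V.
  move=> rV; apply: lt_le_trans (lat_bound_ge1 t _ d20); first exact: ltr01.
  by move=> i; exact: reach_diag rV.
have c0 : 0 <= 4 / 3 * dim * expR (b * m%:R) by rewrite !mulr_ge0 ?expR_ge0.
apply: le_trans (ler_wpM2l c0 (noise_expR_ln_le r01 Bpos (noise_lat_bound d m tt))).
rewrite -noiseZ; apply: noise_le => V rV.
have sV := reach_sym rV; have Vm i := reach_diag i rV.
pose L := m%:R + 5 / 4 / t * ln (lat_bound t m%:R V).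
(* The lattice bound is sharp but not bounded over all [V]; the crude bound by the trace makes [z]
   small for every outcome. *)
pose l := Num.min (m * d.+1)%:R L.
have lnB : 0 <= ln (lat_bound t m%:R V) by rewrite ln_ge0 // lat_bound_ge1.
have L0 : 0 <= L by rewrite addr_ge0 // mulr_ge0 // divr_ge0 ?(ltW t0).
have l0 : 0 <= l by rewrite le_min L0 ler0n.
have lm : l <= (m * d.+1)%:R by rewrite ge_min lexx.
have lL : l <= L by rewrite ge_min lexx orbT.
have Vl x : qform V x <= l * nrm2 x.
  apply: qform_le_unit => u u1; rewrite le_min; apply/andP; split.
    by have /andP [_] := reach_qform u rV; rewrite u1 mulr1.
  have := lat_bound_qform (ltW t0) Vm u1 d20.
  rewrite -ler_pdivlMl // => h; rewrite /L -lerBlDl; apply: le_trans h _.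
  by rewrite mulrA [t^-1 * _]mulrC.
have bn0 : 0 <= b / nn by rewrite divr_ge0 ?(ltW nn0).
have Cc := coercive_shift sV bn0 Vl.
set z := b / nn * l in Cc.
have bl : b * l <= b * (m * d.+1)%:R by rewrite ler_wpM2l.
have bl0 : 0 <= b * l by rewrite mulr_ge0.
have zE : z = b * l / nn by rewrite /z mulrAC.
have z0 : 0 <= z by rewrite mulr_ge0.
have z1 : z <= 1 / 2 by rewrite zE ler_pdivrMr //; lra.
have z01 : 0 <= z <= 1 / 2 by rewrite z0.
have c1 : 0 < 1 - z by lra.
apply: le_trans (trace_inv_expr c1 Cc N) _.
have : (1 - z) ^- N.*2 <= 4 / 3 * expR (b * l).
  rewrite -exprVn.
  have i0 : 0 <= (1 - z)^-1 by rewrite invr_ge0 ltW.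
  apply: (@le_trans _ _ (expR (z + z ^+ 2) ^+ N.*2)).
    by rewrite lerXn2r ?nnegrE ?expR_ge0 ?inv_one_sub_le.
  rewrite -expRM_natl -/nn.
  have -> : nn * (z + z ^+ 2) = (b * l) ^+ 2 / nn + b * l.
    by rewrite zE; field; rewrite gt_eqF.
  rewrite expRD ler_wpM2r ?expR_ge0 //.
  have q : (b * l) ^+ 2 / nn <= 1 / 4.
    rewrite ler_pdivrMr //; apply: (@le_trans _ _ ((b * (m * d.+1)%:R) ^+ 2)); last by lra.
    by rewrite lerXn2r ?nnegrE // (le_trans bl0).
  apply: (@le_trans _ _ (expR (1 / 4))); first by rewrite ler_expR.
  have := expR_ge1Dx (- (1 / 4) : R); rewrite expRN => e4.
  rewrite -[expR _]invrK -[4 / 3]invrK lef_pV2 ?posrE ?invr_gt0 ?expR_gt0 //; lra.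
move=> /(ler_wpM2l (ler0n R d.+1)) /le_trans; apply.
rewrite mulrCA [leLHS]mulrA -[leRHS]mulrA ler_wpM2l ?mulr_ge0 // -expRD ler_expR.
apply: le_trans (ler_wpM2l b0 lL) _.
by rewrite /L /r mulrDr; lra.
Qed.

End NoiseTrace.

(** * Independence *)

Section Decoupling.
Local Open Scope classical_set_scope.
Local Open Scope ereal_scope.
Context {dT d1 d2 : measure_display} {T : measurableType dT} {R : realType}
  (P : probability T R) {T1 : measurableType d1} {T2 : measurableType d2}
  (X : {mfun T >-> T1}) (Y : {mfun T >-> T2}).
Hypothesis indXY : forall A B, measurable A -> measurable B ->
  P (X @^-1` A `&` Y @^-1` B) = P (X @^-1` A) * P (Y @^-1` B).

Let XY x := (X x, Y x).
Let mXY : measurable_fun setT XY.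
Proof. by apply: measurable_fun_pair; exact: measurable_funP. Qed.
Let XYm : {mfun T >-> (T1 * T2)%type} :=
  MeasurableFun.Pack (MeasurableFun.Class (isMeasurableFun.Build _ _ _ _ _ mXY)).

Let law_pair A : measurable A ->
  (distribution P X \x distribution P Y) A = distribution P XYm A.
Proof. by apply: product_measure_unique => A1 A2 mA1 mA2; exact: indXY. Qed.

Let law_pair_sym A : measurable A ->
  distribution P XYm A = (distribution P X \x distribution P Y) A.
Proof. by move=> mA; rewrite law_pair. Qed.

Lemma decouple (f : (T1 * T2)%type -> \bar R) : measurable_fun setT f ->
  (forall z, 0 <= f z) ->
  \int[P]_x f (X x, Y x) = \int[P]_x \int[P]_y f (X x, Y y).
Proof.
move=> mf f0.
transitivity (\int[distribution P XYm]_z f z).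
  by rewrite (ge0_integral_distribution XYm).
transitivity (\int[distribution P X \x distribution P Y]_z f z).
  by apply: eq_measure_integral => A mA _; exact: law_pair_sym.
rewrite fubini_tonelli1 // (ge0_integral_distribution X) //; first last.
- by move=> y; exact: integral_ge0.
- exact: measurable_fun_fubini_tonelli_F.
apply: eq_integral => x _ /=; rewrite /fubini_F (ge0_integral_distribution Y) //.
exact: measurableT_comp.
Qed.

(** Stands in for conditioning on [X]: an estimate over [Y], valid at every frozen value of [X], is
    integrated. *)
Lemma decouple_le (f : (T1 * T2)%type -> \bar R) (g : T1 -> \bar R) :
  measurable_fun setT f -> (forall z, 0 <= f z) -> measurable_fun setT g ->
  (forall a, \int[P]_y f (a, Y y) <= g a) ->
  \int[P]_x f (X x, Y x) <= \int[P]_x g (X x).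
Proof.
move=> mf f0 mg fg.
have g0 a : 0 <= g a by apply: le_trans (fg a); exact: integral_ge0.
rewrite decouple //; apply: ge0_le_integral => //.
- by move=> x _; exact: integral_ge0.
- apply: (eq_measurable_fun (fubini_F (distribution P Y) f \o X)).
    move=> x _ /=; rewrite /fubini_F (ge0_integral_distribution Y) //.
    exact: measurableT_comp.
  by apply: measurableT_comp => //; exact: measurable_fun_fubini_tonelli_F.
- exact: measurableT_comp.
Qed.

Lemma decouple_prod (g : T1 -> R) (h : T2 -> R) :
  measurable_fun setT g -> measurable_fun setT h ->
  P.-integrable setT (EFin \o (g \o X)) -> P.-integrable setT (EFin \o (h \o Y)) ->
  P.-integrable setT (fun x => (g (X x) * h (Y x))%:E) /\
  \int[P]_x (g (X x) * h (Y x))%:E = \int[P]_x (g (X x))%:E * \int[P]_x (h (Y x))%:E.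
Proof.
move=> mg mh ig ih.
pose f (z : (T1 * T2)%type) := (g z.1 * h z.2)%:E.
have mf : measurable_fun setT f.
  apply/measurable_EFinP; apply: measurable_funM.
    exact: measurableT_comp.
  exact: measurableT_comp.
have maf : measurable_fun setT (fun z => `|f z|) by exact: measurableT_comp.
have fin_h : \int[P]_y `|(h (Y y))%:E| < +oo by case/integrableP: ih.
have fin_g : \int[P]_y `|(g (X y))%:E| < +oo by case/integrableP: ig.
have mgX : measurable_fun setT (g \o X) by apply: measurableT_comp.
have mhY : measurable_fun setT (h \o Y) by apply: measurableT_comp.
have mag : measurable_fun setT (fun x => `|(g (X x))%:E|).
  by apply: measurableT_comp => //; exact/measurable_EFinP.
have mah : measurable_fun setT (fun x => `|(h (Y x))%:E|).
  by apply: measurableT_comp => //; exact/measurable_EFinP.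
have iprod : P.-integrable setT (fun x => (g (X x) * h (Y x))%:E).
  apply/integrableP; split.
    by apply/measurable_EFinP; exact: measurable_funM.
  rewrite (decouple (f := fun z => `|f z|)) //.
  under eq_integral do under eq_integral do rewrite /f /= normrM EFinM.
  under eq_integral => x _.
    rewrite ge0_integralZl //; over.
  rewrite ge0_integralZr //; last by apply: integral_ge0.
  by rewrite lte_mul_pinfty // ?integral_ge0 // ge0_fin_numE ?integral_ge0.
split=> //.
have idist : (distribution P X \x distribution P Y).-integrable setT f.
  apply/integrableP; split => //.
  rewrite (_ : \int[_]_z `|f z| = \int[distribution P XYm]_z `|f z|); last first.
    by apply: eq_measure_integral => A mA _; exact: law_pair.
  rewrite (ge0_integral_distribution XYm) //.
  by case/integrableP: iprod.
transitivity (\int[distribution P XYm]_z f z).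
  by rewrite (integral_distribution (X := XYm)).
transitivity (\int[distribution P X \x distribution P Y]_z f z).
  by apply: eq_measure_integral => A mA _; exact: law_pair_sym.
rewrite -integral12_prod_meas1 //.
have iYh : (distribution P Y).-integrable setT (EFin \o h).
  by apply: integrable_pushforward => //; exact/measurable_EFinP.
have iXg : (distribution P X).-integrable setT (EFin \o g).
  by apply: integrable_pushforward => //; exact/measurable_EFinP.
have finh : \int[distribution P Y]_y (h y)%:E \is a fin_num.
  exact: integrable_fin_num iYh.
transitivity (\int[distribution P X]_x ((g x)%:E * \int[distribution P Y]_y (h y)%:E)).
  apply: eq_integral => x _; rewrite /fubini_F /f /= -integralZl //.
rewrite -(fineK finh) integralZr // fineK //.
by rewrite (integral_distribution (X := X)) ?(integral_distribution (X := Y)) //; exact/measurable_EFinP.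
Qed.
End Decoupling.

Section IndependentFamily.
Local Open Scope classical_set_scope.
Local Open Scope ereal_scope.
Context {dT : measure_display} {T : measurableType dT} {R : realType}
  (P : probability T R) {I : finType} (X : I -> T -> R).
Hypotheses (mX : forall i, measurable_fun setT (X i))
  (indX : mutually_independent P X).
Implicit Types (A : {set I}) (S : set T).

Definition cylinders A : set (set T) := [set S | exists2 B : I -> set R,
  (forall i, measurable (B i)) & S = \bigcap_(i in [set i | i \in A]) X i @^-1` B i].

Lemma cylinders_measurable A S : cylinders A S -> measurable S.
Proof.
move=> [B mB ->]; apply: fin_bigcap_measurable; first exact: finite_finset.
by move=> i _; rewrite -[_ @^-1` _]setTI; exact: mX.
Qed.

Lemma cylindersI A : setI_closed (cylinders A).
Proof.
move=> _ _ [B mB ->] [B' mB' ->]; exists (fun i => B i `&` B' i).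
  by move=> i; exact: measurableI.
by rewrite -bigcapI.
Qed.

Lemma cylindersT A : cylinders A setT.
Proof.
exists (fun=> setT) => //; apply/seteqP; split => // x _ i _; exact: I.
Qed.

Lemma sigma_cylinders_measurable A S : <<s cylinders A >> S -> measurable S.
Proof.
apply: smallest_sub S; first exact: sigma_algebra_measurable.
exact: cylinders_measurable.
Qed.

(* The sample space with the sigma-algebra of the [X i], [i] in [A]; the identity
   into it is a random element carrying exactly the variables [X i]. *)
Definition generated A : Type := g_sigma_algebraType (cylinders A).
HB.instance Definition _ A := Measurable.on (generated A).

Definition generated_id A : T -> generated A := fun x => x.

Lemma measurable_generated_id A : measurable_fun setT (generated_id A).
Proof.
by move=> _ S mS; rewrite setTI; exact: (@sigma_cylinders_measurable A S mS).
Qed.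

HB.instance Definition _ A := isMeasurableFun.Build _ _ _ _ (generated_id A)
  (@measurable_generated_id A).

Lemma measurable_generated A i : i \in A ->
  measurable_fun setT (X i : generated A -> R).
Proof.
move=> iA _ B mB; rewrite setTI; apply: sub_sigma_algebra.
exists (fun k => if k == i then B else setT) => [k|]; first by case: ifP.
apply/seteqP; split => [x Bx k /= _|x /(_ i iA)] /=; last by rewrite eqxx.
by case: eqP => [->|].
Qed.

Lemma cylinders_indep A A' S S' : [disjoint A & A']%B ->
  cylinders A S -> cylinders A' S' -> P (S `&` S') = P S * P S'.
Proof.
move=> dA [B mB ->] [B' mB' ->].
rewrite !indX //.
(* Both events become one event over [A :|: A'], to which the definition of independence applies
   directly; disjointness makes [W] agree with [B'] on [A']. *)
pose W i := if i \in A then B i else B' i.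
have mW i : measurable (W i) by rewrite /W; case: ifP.
have A'W i : i \in A' -> W i = B' i.
  by move=> iA'; rewrite /W (disjointFl dA).
transitivity (P (\bigcap_(i in [set i | i \in A :|: A']) X i @^-1` W i)).
  congr (P _); apply/seteqP; split => x /=.
    move=> [xB xB'] i /=; rewrite inE => /orP [iA|iA'].
      by rewrite /W iA; exact: xB.
    by rewrite A'W //; exact: xB'.
  move=> xW; split => i /= iA; have := xW i; rewrite /= inE iA ?orbT => /(_ isT).
    by rewrite /W iA.
  by rewrite A'W.
rewrite indX // (eq_bigl _ _ (fun x => finset.in_setU x A A')) (bigU _ _ _ dA).
congr (mule _ _).
  by apply: eq_bigr => i iA; rewrite /W iA.
by apply: eq_bigr => i iA; rewrite A'W.
Qed.

(** Cylinders form a pi-system containing the whole space, so uniqueness of measures extends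
    independence from cylinders, one side at a time: the restriction of [P] to a fixed event is
    compared with the multiple of [P] by its probability. *)
Lemma generated_indep A A' (S : set (generated A)) (S' : set (generated A')) :
  [disjoint A & A']%B -> measurable S -> measurable S' ->
  P (generated_id A @^-1` S `&` generated_id A' @^-1` S') =
  P (generated_id A @^-1` S) * P (generated_id A' @^-1` S').
Proof.
move=> dA mS mS'; rewrite -[generated_id A @^-1` S]/S -[generated_id A' @^-1` S']/S'.
have uniq (G : set (set T)) (m1 m2 : {measure set T -> \bar R}) :
    (forall E, G E -> measurable E) -> setI_closed G -> G setT ->
    (forall E, G E -> m1 E = m2 E) -> m1 setT < +oo ->
    forall E, <<s G >> E -> m1 E = m2 E.
  move=> mG IG TG mE fin E; apply: (@g_sigma_algebra_measure_unique _ _ _ G _ (fun=> setT)) => //.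
  by rewrite bigcup_const.
have half C E : cylinders A C -> <<s cylinders A' >> E -> P (E `&` C) = P C * P E.
  move=> cC sE; have mC := cylinders_measurable cC.
  have p0 : (0 <= fine (P C))%R by rewrite fine_ge0.
  have pE : P C = (NngNum p0)%:num%:E by rewrite /= fineK // fin_num_measure.
  transitivity (mscale (NngNum p0) P E); last by rewrite /mscale -pE.
  apply: (@uniq (cylinders A') (mrestr P mC) (mscale (NngNum p0) P)) sE.
  - exact: cylinders_measurable.
  - exact: cylindersI.
  - exact: cylindersT.
  - move=> F cF; rewrite /= /mrestr /mscale /= -/((NngNum p0)%:num) -pE.
    by rewrite setIC (cylinders_indep dA).
  - rewrite /= /mrestr setTI (le_lt_trans (probability_le1 P mC)) // ltry //.
have mS0 := sigma_cylinders_measurable mS'.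
have p0 : (0 <= fine (P S'))%R by rewrite fine_ge0.
have pE : P S' = (NngNum p0)%:num%:E by rewrite /= fineK // fin_num_measure.
transitivity (mscale (NngNum p0) P S); last by rewrite /mscale -pE muleC.
apply: (@uniq (cylinders A) (mrestr P mS0) (mscale (NngNum p0) P)) mS.
- exact: cylinders_measurable.
- exact: cylindersI.
- exact: cylindersT.
- move=> F cF; rewrite /= /mrestr /mscale /= -/((NngNum p0)%:num) -pE.
  by rewrite setIC half // muleC.
- rewrite /= /mrestr setTI (le_lt_trans (probability_le1 P mS0)) // ltry //.
Qed.

End IndependentFamily.

Section Means.
Local Open Scope classical_set_scope.
Context {dT : measure_display} {T : measurableType dT} {R : realType}
  (P : probability T R).

Definition has_mean (f : T -> R) (a : R) : Prop :=
  P.-integrable setT (EFin \o f) /\ (\int[P]_x (f x)%:E = a%:E)%E.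

Lemma has_mean_measurable f a : has_mean f a -> measurable_fun setT f.
Proof. by case=> /measurable_int/measurable_EFinP. Qed.

Lemma has_mean_eq f g a : f =1 g -> has_mean f a -> has_mean g a.
Proof. by move=> /funext ->. Qed.

Lemma has_mean_cst a : has_mean (fun=> a) a.
Proof.
split; first exact: finite_measure_integrable_cst.
by rewrite -[RHS]mule1 -(probability_setT P); exact: (integral_cst P measurableT a%:E).
Qed.

Lemma has_meanD f g a b : has_mean f a -> has_mean g b ->
  has_mean (fun x => f x + g x) (a + b).
Proof.
move=> [fi fa] [gi gb]; split; first exact: (integrableD measurableT fi gi).
by rewrite (integralD_EFin measurableT fi gi) fa gb.
Qed.

Lemma has_meanZ k f a : has_mean f a -> has_mean (fun x => k * f x) (k * a).
Proof.
move=> [fi fa]; split; first exact: (integrableZl measurableT k fi).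
by rewrite (integralZl measurableT fi) fa.
Qed.

Lemma has_mean_sum (I : Type) (s : seq I) (f : I -> T -> R) (a : I -> R) :
  (forall i, has_mean (f i) (a i)) ->
  has_mean (fun x => \sum_(i <- s) f i x) (\sum_(i <- s) a i).
Proof.
move=> fa; elim: s => [|i s IH].
  rewrite big_nil; apply: has_mean_eq (has_mean_cst 0) => x.
  by rewrite big_nil.
rewrite big_cons; apply: has_mean_eq (has_meanD (fa i) IH) => x.
by rewrite big_cons.
Qed.

Lemma integral_le_mean (f g : T -> R) a : measurable_fun setT f -> (forall x, 0 <= f x) ->
  (forall x, f x <= g x) -> has_mean g a -> (\int[P]_x (f x)%:E <= a%:E)%E.
Proof.
move=> mf f0 fg ga; rewrite -ga.2; apply: ge0_le_integral => //.
- by move=> x _; rewrite lee_fin.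
- exact/measurable_EFinP.
- exact/measurable_EFinP/(has_mean_measurable ga).
- by move=> x _; rewrite lee_fin.
Qed.

End Means.

Section ProductMeans.
Local Open Scope classical_set_scope.
Context {dT : measure_display} {T : measurableType dT} {R : realType}
  (P : probability T R) {I : finType} (X : I -> T -> R).
Hypotheses (mX : forall i, measurable_fun setT (X i))
  (indX : mutually_independent P X).

(** Each step separates one variable from the sigma-algebra generated by the remaining ones, on
    which their product is measurable. *)
Lemma has_mean_prod (phi : I -> R -> R) (m : I -> R) (s : seq I) :
  uniq s -> (forall i, measurable_fun setT (phi i)) ->
  (forall i, has_mean P (fun x => phi i (X i x)) (m i)) ->
  has_mean P (fun x => \prod_(i <- s) phi i (X i x)) (\prod_(i <- s) m i).
Proof.
move=> us mphi phim; elim: s us => [_|i s IH /= /andP [nis us]].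
  rewrite big_nil; apply: has_mean_eq (has_mean_cst P 1) => x.
  by rewrite big_nil.
have dA : [disjoint [set i]%SET & [set j | j \in s]%SET]%B.
  by rewrite disjoints1 inE nis.
pose g : generated X [set i]%SET -> R := fun x => phi i (X i x).
pose h : generated X [set j | j \in s]%SET -> R := fun x => \prod_(j <- s) phi j (X j x).
have mg : measurable_fun setT g.
  by apply: measurableT_comp => //; apply: measurable_generated; rewrite inE.
have mh : measurable_fun setT h.
  apply: measurable_prod => j js; apply: measurableT_comp => //.
  by apply: measurable_generated; rewrite inE.
have [e1 e2] := decouple_prod
  (fun S S' => generated_indep mX indX (S := S) (S' := S') dA) mg mh
  (phim i).1 (IH us).1.
split.
  apply: eq_integrable e1 => // x _ /=; by rewrite big_cons.
under eq_integral do rewrite big_cons.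
by rewrite [LHS]e2 (phim i).2 (IH us).2 big_cons.
Qed.

End ProductMeans.

(** * Moments of the rows *)

Section Laws.
Local Open Scope classical_set_scope.
Local Open Scope ereal_scope.
Context {dT : measure_display} {T : measurableType dT} {R : realType}
  (P : probability T R).
Implicit Types (X Y : {RV P >-> R}) (p : R).

Lemma has_mean_law X Y (f : R -> R) a :
  (forall B, measurable B -> P (X @^-1` B) = P (Y @^-1` B)) ->
  measurable_fun setT f ->
  has_mean P (fun x => f (Y x)) a -> has_mean P (fun x => f (X x)) a.
Proof.
move=> law mf [fi fa].
have mEf : measurable_fun setT (EFin \o f) by exact/measurable_EFinP.
have mef : measurable_fun setT (fun y => `|(f y)%:E|) by exact: measurableT_comp.
have mfX : measurable_fun setT (fun x => (f (X x))%:E).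
  by apply/measurable_EFinP; exact: measurableT_comp.
have Xi : P.-integrable setT (fun x => (f (X x))%:E).
  apply/integrableP; split => //.
  rewrite -(ge0_integral_distribution X mef) //.
  rewrite (_ : \int[_]_y _ = \int[distribution P Y]_y `|(f y)%:E|); last first.
    by apply: eq_measure_integral => B mB _; rewrite /= /distribution /pushforward law.
  rewrite (ge0_integral_distribution Y mef) //.
  by case/integrableP: fi.
split=> //; rewrite -fa.
transitivity (\int[distribution P X]_y (f y)%:E).
  by rewrite (integral_distribution (X := X)).
rewrite (_ : \int[_]_y _ = \int[distribution P Y]_y (f y)%:E); last first.
  by apply: eq_measure_integral => B mB _; rewrite /= /distribution /pushforward law.
by rewrite (integral_distribution (X := Y)).
Qed.

(** The two point masses sum to one, so almost surely [X] takes the values 0 and 1 and its positive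
    powers equal the indicator of [X = 1]. *)
Lemma has_mean_bernoulli X p e : P (X @^-1` [set 1%R]) = p%:E ->
  P (X @^-1` [set 0%R]) = (1 - p)%:E -> (0 < e)%N ->
  has_mean P (fun x => X x ^+ e)%R p.
Proof.
move=> X1 X0 e0.
have mX := measurable_funP X.
have m1 (a : R) : measurable (X @^-1` [set a]).
  by rewrite -[X in measurable X]setTI; exact: mX.
have ae : {ae P, forall x, (X x ^+ e)%R = \1_(X @^-1` [set 1%R]) x}.
  apply: (@negligibleS _ _ _ _ (~` (X @^-1` [set 1%R] `|` X @^-1` [set 0%R]))).
    apply: subsetC => x /= [] hx; rewrite indicE /=; move: hx => /= hx.
      by rewrite mem_set //= hx expr1n.
    rewrite memNset /= hx; last by move/esym/eqP; rewrite oner_eq0.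
    by rewrite expr0n (gtn_eqF e0).
  apply/negligibleP; first exact/measurableC/measurableU.
  transitivity (1 - P (X @^-1` [set 1%R] `|` X @^-1` [set 0%R])).
    by apply: probability_setC; exact: measurableU.
  rewrite (_ : P _ = P (X @^-1` [set 1%R]) + P (X @^-1` [set 0%R])).
    by rewrite X1 X0 -EFinD subrKC subrr.
  apply: (measureU P (m1 1%R) (m1 0%R)).
  by apply/seteqP; split => // x [/= -> /eqP]; rewrite oner_eq0.
have mXe : measurable_fun setT (EFin \o (fun x => X x ^+ e)%R).
  by apply/measurable_EFinP; exact: measurable_funX.
have m1e : measurable_fun setT (fun x => (\1_(X @^-1` [set 1%R]) x)%:E : \bar R).
  by apply/measurable_EFinP; exact: measurable_indic.
split.
  apply/integrableP; split => //.
  rewrite (ae_eq_integral (fun x => (\1_(X @^-1` [set 1%R]) x)%:E)) //; last first.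
  - by apply: filterS ae => x /= -> _; rewrite ger0_norm.
  - by apply: measurableT_comp.
  by rewrite integral_indic // setIT [ltLHS]X1 ltry.
rewrite (ae_eq_integral (fun x => (\1_(X @^-1` [set 1%R]) x)%:E)) //.
  by rewrite integral_indic // setIT.
by apply: filterS ae => x /= -> _.
Qed.

(** Integrability up to order four follows from the domination of [|X| ^ e] by [1 + X ^+ 4]. The
    third moment is only known to exist. *)
Lemma moments_of_fourth X C : \int[P]_x (`|X x| ^+ 4)%:E = C%:E ->
  'E_P[X] = 0 -> 'V_P[X] = 1 ->
  exists2 mu : nat -> R, [/\ mu 0 = 1, mu 1 = 0, mu 2 = 1 & mu 4 = C]%R &
    forall e, (e <= 4)%N -> has_mean P (fun x => X x ^+ e)%R (mu e).
Proof.
move=> X4 EX VX.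
have mX := measurable_funP X.
have mXe e : measurable_fun setT (fun x => X x ^+ e)%R by exact: measurable_funX.
have i4 : has_mean P (fun x => X x ^+ 4)%R C.
  have e4 x : (`|X x| ^+ 4 = X x ^+ 4)%R by rewrite -normrX ger0_norm // -[4%N]/(2 * 2)%N exprM sqr_ge0.
  split; last by rewrite -X4; apply: eq_integral => x _; rewrite e4.
  apply/integrableP; split; first exact/measurable_EFinP.
  rewrite (_ : \int[P]_x _ = C%:E) ?ltry // -X4.
  by apply: eq_integral => x _; rewrite /= normrX.
have ie e : (e <= 4)%N -> P.-integrable setT (fun x => (X x ^+ e)%:E).
  move=> e4.
  apply: (le_integrable measurableT _ _ (has_meanD (has_mean_cst P 1) i4).1).
    exact/measurable_EFinP.
  move=> x _ /=; rewrite lee_fin normrX.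
  apply: le_trans (ler_norm _).
  have -> : (X x ^+ 4 = `|X x| ^+ 4)%R by rewrite -normrX ger0_norm // -[4%N]/(2 * 2)%N exprM sqr_ge0.
  have [x1|x1] := leP (`|X x|)%R 1%R.
    by rewrite (le_trans (exprn_ile1 _ (normr_ge0 _) x1)) // lerDl exprn_ge0.
  by rewrite (le_trans (ler_weXn2l (ltW x1) e4)) // lerDr.
exists (fun e => fine (\int[P]_x (X x ^+ e)%:E)) => [|e e4].
  have EX' : \int[P]_x (X x)%:E = 0 by rewrite -expectation_def.
  split.
  - under eq_integral do rewrite expr0.
    by rewrite (has_mean_cst P 1).2.
  - by rewrite EX'.
  - under eq_integral do rewrite expr2.
    move: VX; rewrite /variance unlock EX /= unlock.
    rewrite (_ : \int[P]_w _ = \int[P]_x (X x * X x)%:E); first by move=> ->.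
    apply: eq_integral => x _; congr (_%:E).
    by rewrite -[LHS]/((X x - 0) * (X x - 0))%R subr0.
  - by rewrite i4.2.
split; first exact: ie.
rewrite fineK //; exact: integrable_fin_num (ie e e4).
Qed.

End Laws.

Section RowMoments.
Local Open Scope classical_set_scope.
Context {dT : measure_display} {T : measurableType dT} {R : realType}
  (P : probability T R) {d n : nat} (zeta C : R) (psi0 : {RV P >-> R})
  (xi psi : 'I_n -> 'I_d.+1 -> {RV P >-> R}).
Hypotheses (hzeta : 0 < zeta <= d.+1%:R)
  (hmean : ('E_P[psi0] = 0)%E) (hvar : 'V_P[psi0] = 1%E)
  (hfourth : (\int[P]_x (`|psi0 x| ^+ 4)%:E)%E = C%:E)
  (hxi1 : forall i j, P (xi i j @^-1` [set 1]) = (zeta / d.+1%:R)%:E)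
  (hxi0 : forall i j, P (xi i j @^-1` [set 0]) = (1 - zeta / d.+1%:R)%:E)
  (hpsi : forall i j (B : set R), measurable B ->
     P (psi i j @^-1` B) = P (psi0 @^-1` B))
  (hindep : mutually_independent P (xipsi_family xi psi)).

Lemma measurable_xipsi q : measurable_fun setT (xipsi_family xi psi q).
Proof. by rewrite /xipsi_family; case: ifP => _; exact: measurable_funP. Qed.

(** With [r ^+ 2 = d / zeta] and [p = zeta / d], an entry has moment [r ^+ e * mu e * p] for
    [e > 0], as positive powers of [xi] all have mean [p]. Since [r ^+ 2 * p = 1] this is 0, 1, some
    [k3], and [C * (d / zeta)]. The list [S] collects both variables of each entry, so one
    factorisation serves the row. *)
Lemma row_moments : exists k3, forall k (e : 'I_d.+1 -> nat),
  (forall j, e j <= 4)%N ->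
  has_mean P (fun x => \prod_j
      (Num.sqrt (d.+1%:R / zeta) * (xi k j x * psi k j x)) ^+ e j)
    (\prod_j pmom k3 (C * (d.+1%:R / zeta)) (e j)).
Proof.
have [mu [mu0 mu1 mu2 mu4] psimu] := moments_of_fourth hfourth hmean hvar.
have [z0 _] := andP hzeta.
set s := d.+1%:R / zeta; pose p := zeta / d.+1%:R.
have d0 : 0 < d.+1%:R :> R by rewrite ltr0n.
have s0 : 0 < s by rewrite divr_gt0.
have sp : s * p = 1 by rewrite /s /p; field; rewrite !gt_eqF //.
pose r := Num.sqrt s; have rr : r ^+ 2 = s by rewrite sqr_sqrtr // ltW.
exists (r ^+ 3 * (mu 3 * p)) => k e e4.
pose S := [seq (k, j, b) | j <- index_enum 'I_d.+1, b <- [:: true; false]].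
have uS : uniq S.
  apply: allpairs_uniq => //; first exact: index_enum_uniq.
  by move=> [j b] [j' b'] _ _ /= [-> ->].
pose phi (q : 'I_n * 'I_d.+1 * bool) (y : R) := y ^+ e q.1.2.
pose m (q : 'I_n * 'I_d.+1 * bool) :=
  if q.2 then mu (e q.1.2) else if e q.1.2 == 0%N then 1 else p.
have mphi q : measurable_fun setT (phi q) by exact: measurable_funX.
have phim q : has_mean P (fun x => phi q (xipsi_family xi psi q x)) (m q).
  rewrite /phi /m /xipsi_family; case: q => [[i j] [|]] /=.
    apply: (has_mean_law (f := fun y => y ^+ e j) (hpsi i j)).
      exact: measurable_funX.
    exact: psimu.
  case: eqP => [-> | /eqP ej].
    by apply: has_mean_eq (has_mean_cst P 1) => x; rewrite expr0.
  by apply: has_mean_bernoulli => //; rewrite lt0n.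
have := has_meanZ (\prod_j r ^+ e j)
  (has_mean_prod measurable_xipsi hindep uS mphi phim).
rewrite !big_allpairs_dep -big_split /=.
rewrite [X in has_mean _ _ X -> _](_ : _ = \prod_j
    pmom (r ^+ 3 * (mu 3 * p)) (C * s) (e j)); last first.
  apply: eq_bigr => j _; rewrite !big_cons big_nil mulr1 /m /=.
  case: (e j) (e4 j) => [|[|[|[|[|//]]]]] _ /=.
  - by rewrite expr0 mu0 !mulr1.
  - by rewrite mu1 mul0r mulr0.
  - by rewrite rr mu2 mul1r.
  - by [].
  - by rewrite mu4 -[4%N]/(2 * 2)%N exprM rr mulrCA -[s ^+ 2]/(s * s) -mulrA sp mulr1.
apply: has_mean_eq => x.
rewrite big_allpairs_dep -big_split /=; apply: eq_bigr => j _.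
rewrite !big_cons big_nil mulr1 /phi /xipsi_family /=.
by rewrite -!exprMn [psi k j x * _]mulrC.
Qed.

(** [C - 1] is the variance of the square of [psi0]. *)
Lemma kurtosis_ge1 : 1 <= C.
Proof.
have [mu [mu0 mu1 mu2 mu4] psimu] := moments_of_fourth hfourth hmean hvar.
have m2 := psimu 2%N isT; have m4 := psimu 4%N isT.
rewrite mu2 in m2; rewrite mu4 in m4.
have h := has_meanD (has_meanD m4 (has_meanZ (- 2) m2)) (has_mean_cst P 1).
have : (0 <= (C + - 2 * 1 + 1)%:E)%E.
  rewrite -h.2; apply: integral_ge0 => x _; rewrite lee_fin.
  rewrite (_ : _ + _ = (psi0 x ^+ 2 - 1) ^+ 2) ?sqr_ge0 //; ring.
rewrite lee_fin; lra.
Qed.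

End RowMoments.

(** * Exchanging the rows *)

Section MeasurableMatrices.
Local Open Scope classical_set_scope.
Context {dT : measure_display} {T : measurableType dT} {R : realType}.

Definition measurable_mx a b (M : T -> 'M[R]_(a, b)) : Prop :=
  forall i j, measurable_fun setT (fun x => M x i j).

Lemma measurable_mx_cst a b (A : 'M[R]_(a, b)) : measurable_mx (fun=> A).
Proof. by move=> i j; exact: measurable_cst. Qed.

Lemma measurable_mxD a b (M N : T -> 'M[R]_(a, b)) :
  measurable_mx M -> measurable_mx N -> measurable_mx (fun x => M x + N x).
Proof. by move=> mM mN i j; under eq_fun do rewrite mxE; exact: measurable_funD. Qed.

Lemma measurable_mxZ a b (k : T -> R) (M : T -> 'M[R]_(a, b)) :
  measurable_fun setT k -> measurable_mx M -> measurable_mx (fun x => k x *: M x).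
Proof. by move=> mk mM i j; under eq_fun do rewrite mxE; exact: measurable_funM. Qed.

Lemma measurable_mxM a b c (M : T -> 'M[R]_(a, b)) (N : T -> 'M[R]_(b, c)) :
  measurable_mx M -> measurable_mx N -> measurable_mx (fun x => M x *m N x).
Proof.
move=> mM mN i j; under eq_fun do rewrite mxE.
by apply: measurable_sum => l; exact: measurable_funM.
Qed.

Lemma measurable_mx_tr a b (M : T -> 'M[R]_(a, b)) :
  measurable_mx M -> measurable_mx (fun x => (M x)^T).
Proof. by move=> mM i j; under eq_fun do rewrite mxE; exact: mM. Qed.

Lemma measurable_mx_sum a b (I : Type) (s : seq I) (M : I -> T -> 'M[R]_(a, b)) :
  (forall i, measurable_mx (M i)) -> measurable_mx (fun x => \sum_(i <- s) M i x).
Proof.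
by move=> mM i j; under eq_fun do rewrite summxE; apply: measurable_sum => k; exact: mM.
Qed.

Lemma measurable_det a (M : T -> 'M[R]_a) :
  measurable_mx M -> measurable_fun setT (fun x => \det (M x)).
Proof.
move=> mM; apply: measurable_sum => s; apply: measurable_funM => //.
by apply: measurable_prod => i _; exact: mM.
Qed.

(** The inverse is rewritten through a real power of the nonnegative [f x ^+ 2]; at a zero of [f]
    both sides are zero. *)
Lemma measurable_fun_inv (f : T -> R) :
  measurable_fun setT f -> measurable_fun setT (fun x => (f x)^-1).
Proof.
move=> mf.
have -> : (fun x => (f x)^-1) = (fun x => f x * powR (f x ^+ 2) (- 1)).
  apply/funext => x; rewrite powR_inv1 ?sqr_ge0 //.
  have [->|f0] := eqVneq (f x) 0; first by rewrite invr0 mul0r.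
  by field.
apply: measurable_funM => //.
apply: (measurableT_comp (f := fun y => powR y (- 1))).
  exact: measurable_powR.
exact: measurable_funX.
Qed.

Lemma measurable_mxV a (M : T -> 'M[R]_a.+1) : (forall x, M x \in unitmx) ->
  measurable_mx M -> measurable_mx (fun x => (M x)^-1).
Proof.
move=> uM mM.
have -> : (fun x => (M x)^-1) = (fun x => (\det (M x))^-1 *: \adj (M x)).
  by apply/funext => x; rewrite -[LHS]/(invmx (M x)) /invmx uM.
apply: measurable_mxZ; first exact/measurable_fun_inv/measurable_det.
move=> i j; under eq_fun do rewrite mxE /cofactor.
apply: measurable_funM => //; apply: measurable_det => k l.
under eq_fun do rewrite !mxE; exact: mM.
Qed.

Lemma measurable_trace_inv_expr a (M : T -> 'M[R]_a.+1) N :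
  (forall x, M x \in unitmx) -> measurable_mx M ->
  measurable_fun setT (fun x => \tr ((M x)^-1 ^+ N)).
Proof.
move=> uM mM; apply: measurable_sum => i.
suff : measurable_mx (fun x => (M x)^-1 ^+ N) by exact.
elim: N => [|N IH].
  by under eq_fun do rewrite expr0; exact: measurable_mx_cst.
by under eq_fun do rewrite exprS; apply: measurable_mxM => //; exact: measurable_mxV.
Qed.

End MeasurableMatrices.

Section StepMean.
Local Open Scope classical_set_scope.
Context {dT : measure_display} {T : measurableType dT} {R : realType}
  (P : probability T R) {d : nat} (W : T -> 'cV[R]_d.+1) (k3 k4 : R).
Hypothesis momW : forall e : 'I_d.+1 -> nat, (forall j, e j <= 4)%N ->
  has_mean P (fun x => \prod_j W x j 0 ^+ e j) (\prod_j pmom k3 k4 (e j)).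

Lemma has_mean_qform A : has_mean P (fun x => qform A (W x)) (\tr A).
Proof.
have -> : \tr A = \sum_i \sum_j A i j * \prod_k pmom k3 k4 (mult2 i j k).
  apply: eq_bigr => i _; rewrite (bigD1 i) //= prod_pmom2 eqxx mulr1.
  rewrite big1 ?addr0 // => j ji.
  by rewrite prod_pmom2 eq_sym (negbTE ji) mulr0.
apply: (@has_mean_eq _ _ _ _ (fun x => \sum_i \sum_j A i j * \prod_k W x k 0 ^+ mult2 i j k)).
  move=> x; rewrite qformE; apply: eq_bigr => i _; apply: eq_bigr => j _.
  by rewrite prod_mult2.
do 2![apply: has_mean_sum => ?]; apply: has_meanZ; apply: momW => j.
by rewrite /mult2; do 2!case: (_ == _).
Qed.

Lemma has_mean_qform_mul A B :
  has_mean P (fun x => qform A (W x) * qform B (W x)) (quartic_mean k3 k4 A B).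
Proof.
apply: (@has_mean_eq _ _ _ _ (fun x => \sum_i \sum_j \sum_l \sum_m
    A i j * B l m * \prod_k W x k 0 ^+ mult4 i j l m k)).
  move=> x; rewrite qform_mul; do 4![apply: eq_bigr => ? _].
  by rewrite prod_mult4.
do 4![apply: has_mean_sum => ?]; apply: has_meanZ; apply: momW => j.
by rewrite /mult4 /mult2; do 4!case: (_ == _).
Qed.

Lemma measurable_row : measurable_mx W.
Proof.
move=> i j; rewrite (ord1 j).
have e4 k : ((k == i) <= 4)%N by case: (_ == _).
apply: has_mean_measurable; apply: has_mean_eq (momW e4) => x.
rewrite (bigD1 i) //= eqxx expr1 big1 ?mulr1 // => k ki.
by rewrite (negbTE ki).
Qed.

Lemma coercive_add_outer (c s : R) (A : 'M[R]_d.+1) (w : 'cV[R]_d.+1) :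
  0 <= s -> coercive c A -> coercive c (A + s *: outer w).
Proof.
move=> s0 [sA cA]; split => [|x].
  by rewrite linearD /= sA linearZ /= /outer trmx_mul trmxK.
rewrite qform_add qform_scale qform_outer (le_trans (cA x)) // lerDl.
by rewrite mulr_ge0 // sqr_ge0.
Qed.

(** The majorant from [trace_update_le] is a polynomial of degree four in the row, so its mean is
    determined by [momW]. *)
Lemma integral_step_le (c : R) (A : 'M[R]_d.+1) N th :
  0 < c -> coercive c A -> 0 <= th -> (0 < N)%N ->
  (\int[P]_x (\tr ((A + (th / N.*2%:R) *: outer (W x))^-1 ^+ N.*2))%:E <=
   (step_bound A N k3 k4 th)%:E)%E.
Proof.
move=> c0 cA th0 N0.
have n0 : 0 < N.*2%:R :> R by rewrite ltr0n double_gt0.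
have s0 : 0 <= th / N.*2%:R :> R by rewrite divr_ge0 // ltW.
have cw x := coercive_add_outer (W x) s0 cA.
apply: (@integral_le_mean _ _ _ P _ (fun x => \tr (A^-1 ^+ N.*2) -
     th / N.*2%:R * N.*2%:R * qform (A^-1 ^+ N.*2.+1) (W x) +
  (th / N.*2%:R) ^+ 2 * (2^-1 * N.*2%:R * pair_sum A^-1 N.*2 (W x)))).
- apply: measurable_trace_inv_expr => [x|]; first exact: (coercive_unit c0 (cw x)).
  apply: measurable_mxD; first exact: measurable_mx_cst.
  apply: measurable_mxZ; first exact: measurable_cst.
  apply: measurable_mxM; first exact: measurable_row.
  exact/measurable_mx_tr/measurable_row.
- by move=> x; exact: (trace_inv_psd c0 (cw x)).
- by move=> x; exact: (trace_update_le c0 cA c0 (cw x) _ s0).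
rewrite /step_bound; apply: has_meanD.
  rewrite -mulNr; apply: (@has_mean_eq _ _ _ _ (fun x => \tr (A^-1 ^+ N.*2) +
      (- th) * qform (A^-1 ^+ N.*2.+1) (W x))).
    by move=> x; rewrite divfK ?gt_eqF // mulNr.
  apply: has_meanD; first exact: has_mean_cst.
  exact/has_meanZ/has_mean_qform.
do 2!apply: has_meanZ; rewrite /pair_sum /pair_mean.
apply: has_mean_sum => l; exact: has_mean_qform_mul.
Qed.

End StepMean.

Section NoiseIntegral.
Local Open Scope classical_set_scope.
Context {dT : measure_display} {T : measurableType dT} {R : realType} {d : nat}.
Implicit Types (h : 'M[R]_d.+1 -> T -> R).

Lemma measurable_avg (h : {ffun 'I_d.+1 -> bool} -> T -> R) :
  (forall e, measurable_fun setT (h e)) -> measurable_fun setT (fun x => avg (h ^~ x)).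
Proof. by move=> mh; apply: measurable_funM => //; exact: measurable_sum. Qed.

Lemma measurable_noise m h : (forall V, reach m V -> measurable_fun setT (h V)) ->
  measurable_fun setT (fun x => noise m (h ^~ x)).
Proof.
elim: m h => [|m IH] h mh /=; first exact: mh.
apply: IH => V rV; apply: measurable_avg => e; apply: mh.
by exists e, V.
Qed.

Lemma integral_avg (P : probability T R) (h : {ffun 'I_d.+1 -> bool} -> T -> R)
  (a : {ffun 'I_d.+1 -> bool} -> R) :
  (forall e, measurable_fun setT (h e)) -> (forall e x, 0 <= h e x) ->
  (forall e, (\int[P]_x (h e x)%:E <= (a e)%:E)%E) ->
  (\int[P]_x (avg (h ^~ x))%:E <= (avg a)%:E)%E.
Proof.
move=> mh h0 ha; rewrite /avg.
under eq_integral do rewrite EFinM -sumEFin.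
rewrite ge0_integralZl //; first last.
- by move=> x _; apply: sume_ge0 => e _; rewrite lee_fin.
- by apply: emeasurable_sum => e; exact/measurable_EFinP.
rewrite EFinM lee_wpmul2l ?lee_fin ?invr_ge0 //.
rewrite ge0_integral_sum //.
- by rewrite -sumEFin lee_sum.
- by move=> e; exact/measurable_EFinP.
- by move=> e x _; rewrite lee_fin.
Qed.

Lemma integral_noise (P : probability T R) m h (a : 'M[R]_d.+1 -> R) :
  (forall V, reach m V -> measurable_fun setT (h V)) ->
  (forall V x, reach m V -> 0 <= h V x) ->
  (forall V, reach m V -> (\int[P]_x (h V x)%:E <= (a V)%:E)%E) ->
  (\int[P]_x (noise m (h ^~ x))%:E <= (noise m a)%:E)%E.
Proof.
elim: m h a => [|m IH] h a mh h0 ha /=; first exact: ha.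
have rS V e : reach m V -> reach m.+1 (V + outer (sgnv e)) by exists e, V.
apply: (IH (fun V x => avg (fun e => h (V + outer (sgnv e)) x))).
- by move=> V rV; apply: measurable_avg => e; exact/mh/rS.
- by move=> V x rV; apply: avg_ge0 => e; exact/h0/rS.
- by move=> V rV; apply: integral_avg => e; [exact/mh/rS|move=> x; exact/h0/rS|exact/ha/rS].
Qed.

End NoiseIntegral.

Section Lindeberg.
Local Open Scope classical_set_scope.
Context {dT : measure_display} {T : measurableType dT} {R : realType}
  (P : probability T R) {I : finType} (X : I -> T -> R)
  {n d : nat} (row : I -> 'I_n) (W : 'I_n -> T -> 'cV[R]_d.+1) (k3 k4 : R).
Hypotheses (mX : forall i, measurable_fun setT (X i))
  (indX : mutually_independent P X)
  (mW : forall (A : {set I}) k, (forall i, row i = k -> i \in A) ->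
     measurable_mx (W k : generated X A -> _))
  (momW : forall k (e : 'I_d.+1 -> nat), (forall j, e j <= 4)%N ->
  has_mean P (fun x => \prod_j W k x j 0 ^+ e j) (\prod_j pmom k3 k4 (e j))).
Variables (N : nat) (th b : R).
Hypotheses (N0 : (0 < N)%N) (th0 : 0 <= th) (b0 : 0 <= b)
  (bn : b * (n * d.+1)%:R < N.*2%:R).
Local Notation F A := (\tr (A^-1 ^+ N.*2)).

Definition gram k x : 'M[R]_d.+1 := \sum_(i < n | (i < k)%N) outer (W i x).

Definition shifted_gram k V x : 'M[R]_d.+1 :=
  1 + (th / N.*2%:R) *: gram k x - (b / N.*2%:R) *: V.

Let nn0 : 0 < N.*2%:R :> R.
Proof. by rewrite ltr0n double_gt0. Qed.

(* A coercivity constant valid for every [shifted_gram k V x] with [reach m V], [m <= n]. *)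
Definition margin : R := 1 - b * (n * d.+1)%:R / N.*2%:R.

Lemma margin_gt0 : 0 < margin.
Proof. by rewrite subr_gt0 ltr_pdivrMr ?mul1r. Qed.

Lemma gramS (k : 'I_n) x : gram k.+1 x = gram k x + outer (W k x).
Proof.
rewrite /gram (bigD1 k) //= addrC; congr (_ + _); apply: eq_bigl => i.
by rewrite ltnS ltn_neqAle andbC.
Qed.

Lemma coercive_shifted_gram k m V x : (m <= n)%N -> reach m V ->
  coercive margin (shifted_gram k V x).
Proof.
move=> mn rV.
have base : coercive margin (1 - (b / N.*2%:R) *: V).
  rewrite /margin [b * _ / _]mulrAC; apply: coercive_shift.
  - exact: reach_sym rV.
  - by rewrite divr_ge0 // ltW.
  - move=> y; have /andP [_ Vy] := reach_qform y rV; apply: le_trans Vy _.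
    by rewrite ler_wpM2r ?nrm2_ge0 // ler_nat leq_mul2r mn orbT.
rewrite /shifted_gram addrAC scaler_sumr.
elim/big_rec: _ => [|i A _ IH]; first by rewrite addr0.
rewrite [_ *: outer _ + A]addrC addrA; apply: coercive_add_outer => //.
by rewrite divr_ge0 // ltW.
Qed.

Lemma measurable_shifted_gram (A : {set I}) k V :
  (forall i, (row i < k)%N -> i \in A) ->
  measurable_mx (shifted_gram k V : generated X A -> _).
Proof.
move=> kA; apply: measurable_mxD; last exact: measurable_mx_cst.
apply: measurable_mxD; first exact: measurable_mx_cst.
apply: measurable_mxZ; first exact: measurable_cst.
rewrite /gram; under eq_fun do rewrite big_mkcond.
apply: measurable_mx_sum => i; have [ik|_] := boolP (i < k)%N; last exact: measurable_mx_cst.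
have mWi : measurable_mx (W i : generated X A -> _).
  by apply: mW => j ji; apply: kA; rewrite ji.
by apply: measurable_mxM => //; exact: measurable_mx_tr.
Qed.

(* Hybrid between the sample ([m = 0]) and pure noise ([k = 0]). *)
Definition smoothed k m : \bar R :=
  (\int[P]_x (noise m (fun V => F (shifted_gram k V x)))%:E)%E.

(** The rows before [k] are frozen through the sigma-algebra of [A], row [k] is integrated through
    that of [A'], and [decouple_le] joins the two. The function [h] stays free because one regime
    closes the recursion with the same number of noise vectors and the other with one more. *)
Lemma smoothed_step (k : 'I_n) m (rho e : R) (h : 'M[R]_d.+1 -> T -> R) :
  (m <= n)%N -> 0 <= rho -> 0 <= e ->
  (forall V, reach m V ->
     measurable_fun setT (h V : generated X [set i | (row i < k)%N]%SET -> R)) ->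
  (forall V x, reach m V -> 0 <= h V x) ->
  (forall V x, reach m V ->
     step_bound (shifted_gram k V x) N k3 k4 th <= rho * h V x + e) ->
  (smoothed k.+1 m <= rho%:E * \int[P]_x (noise m (h ^~ x))%:E + e%:E)%E.
Proof.
move=> mn rho0 e0 mh h0 hb.
set A := [set i | (row i < k)%N]%SET in mh; set A' := [set i | row i == k]%SET.
have dA : [disjoint A & A']%B.
  rewrite disjoint_subset; apply/fintype.subsetP => i; rewrite !inE => ik.
  by apply: contraTneq ik => ->; rewrite ltnn.
pose Z V (z : (generated X A * generated X A')%type) : 'M[R]_d.+1 :=
  shifted_gram k V z.1 + (th / N.*2%:R) *: outer (W k z.2).
have th_nn : 0 <= th / N.*2%:R by rewrite divr_ge0 // ltW.
have cZ V z : reach m V -> coercive margin (Z V z).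
  by move=> rV; apply: coercive_add_outer => //; exact: coercive_shifted_gram mn rV.
pose f (z : (generated X A * generated X A')%type) : \bar R :=
  (noise m (fun V => F (Z V z)))%:E.
pose g (x : generated X A) : \bar R := (noise m (fun V => rho * h V x + e))%:E.
have mhA V : reach m V -> measurable_fun setT (h V : generated X A -> R) by exact: mh.
have mg : measurable_fun setT g.
  apply/measurable_EFinP; apply: measurable_noise => V rV.
  apply: measurable_funD; last exact: measurable_cst.
  by apply: measurable_funM; [exact: measurable_cst|exact: mhA].
have f0 z : (0 <= f z)%E.
  rewrite lee_fin; apply: noise_ge0 => V rV.
  exact: trace_inv_psd margin_gt0 (cZ V z rV) N.*2.
have mf : measurable_fun setT f.
  apply/measurable_EFinP; apply: measurable_noise => V rV.
  apply: measurable_trace_inv_expr => [z|].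
    exact: coercive_unit margin_gt0 (cZ V z rV).
  apply: measurable_mxD.
    move=> i j; apply: (measurableT_comp (f := fun x : generated X A => shifted_gram k V x i j)) => //.
    by apply: measurable_shifted_gram => l lk; rewrite inE.
  apply: measurable_mxZ; first exact: measurable_cst.
  have mWk : measurable_mx (fun z : (generated X A * generated X A')%type => W k z.2).
    move=> i j; apply: (measurableT_comp (f := fun x : generated X A' => W k x i j)) => //.
    by apply: mW => l lk; rewrite inE lk.
  by apply: measurable_mxM => //; exact: measurable_mx_tr.
have fg x : (\int[P]_y f (x, generated_id X A' y) <= g x)%E.
  apply: (@le_trans _ _ (noise m (fun V => step_bound (shifted_gram k V x) N k3 k4 th))%:E).
    apply: (@integral_noise _ T R d P m (fun V (y : T) => F (Z V (x, y)))
      (fun V => step_bound (shifted_gram k V x) N k3 k4 th)) => [V rV|V y rV|V rV].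
    - apply: measurable_trace_inv_expr => [y|].
        exact: coercive_unit margin_gt0 (cZ V _ rV).
      apply: measurable_mxD; first exact: (measurable_mx_cst (shifted_gram k V x)).
      apply: measurable_mxZ; first exact: measurable_cst.
      have mWk := measurable_row (momW k).
      by apply: measurable_mxM => //; exact: measurable_mx_tr.
    - exact: trace_inv_psd margin_gt0 (cZ V _ rV) _.
    - exact: (integral_step_le (momW k) margin_gt0 (coercive_shifted_gram k x mn rV)).
  by rewrite lee_fin; apply: noise_le => V rV; exact: hb.
have -> : smoothed k.+1 m = (\int[P]_x f (generated_id X A x, generated_id X A' x))%E.
  apply: eq_integral => x _; congr (_%:E); apply: noise_eq => V rV.
  congr (\tr (_^-1 ^+ _)).
  by rewrite /Z /shifted_gram gramS scalerDr addrA [RHS]addrAC.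
apply: le_trans (decouple_le
  (fun S S' => generated_indep mX indX (S := S) (S' := S') dA) mf f0 mg fg) _ => //.
rewrite [leLHS](_ : _ =
    \int[P]_x (rho%:E * (noise m (h ^~ x))%:E + e%:E))%E; last first.
  by apply: eq_integral => x _; rewrite /g noiseD noiseZ noise_cst.
have mhT V : reach m V -> measurable_fun setT (h V).
  by move=> rV; exact: measurableT_comp (mhA V rV) (measurable_funP (generated_id X A)).
have mn_h : measurable_fun setT (fun x => (noise m (h ^~ x))%:E).
  by apply/measurable_EFinP; exact: measurable_noise.
have n0 x : (0 <= (noise m (h ^~ x))%:E)%E.
  by rewrite lee_fin; apply: noise_ge0 => V rV; exact: h0.
have mr : measurable_fun setT (fun x => rho%:E * (noise m (h ^~ x))%:E)%E.
  by apply: emeasurable_funM => //; exact: measurable_cst.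
have r0 x : (0 <= rho%:E * (noise m (h ^~ x))%:E)%E by rewrite mule_ge0 // lee_fin.
rewrite (@ge0_integralD _ _ _ P _ measurableT _ (cst e%:E)) //.
rewrite ge0_integralZl // ?lee_fin //.
by rewrite (has_mean_cst P e).2.
Qed.

Lemma smoothed0 m : smoothed 0 m =
  (noise m (fun V : 'M[R]_d.+1 => F (1 - (b / N.*2%:R) *: V)))%:E.
Proof.
have [_ <-] := has_mean_cst P (noise m (fun V : 'M[R]_d.+1 => F (1 - (b / N.*2%:R) *: V))).
apply: eq_integral => x _; congr (_%:E).
apply: noise_eq => V rV; congr (\tr (_^-1 ^+ _)).
by rewrite /shifted_gram /gram big_pred0 // scaler0 addr0.
Qed.

Lemma measurable_smoothed_trace (A : {set I}) k m V :
  (forall i, (row i < k)%N -> i \in A) -> (m <= n)%N -> reach m V ->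
  measurable_fun setT ((fun x => F (shifted_gram k V x)) : generated X A -> R).
Proof.
move=> kA mn rV; apply: measurable_trace_inv_expr => [x|].
  exact: coercive_unit margin_gt0 (coercive_shifted_gram k x mn rV).
exact: measurable_shifted_gram.
Qed.

Lemma smoothed_trace_ge0 k m V x : (m <= n)%N -> reach m V ->
  0 <= F (shifted_gram k V x).
Proof.
move=> mn rV.
exact: trace_inv_psd margin_gt0 (coercive_shifted_gram k x mn rV) N.*2.
Qed.

Lemma smoothed_simple : 1 <= k4 ->
  let rho := 1 - th +
    th ^+ 2 / 2 * (k4 - 1 + d.+1%:R) * ((1 + N.*2%:R^-1) / margin ^+ 2) in
  0 <= rho <= 1 -> forall k, (k <= n)%N ->
  (smoothed k 0 <= (rho ^+ k * F (1 : 'M[R]_d.+1) + k%:R * (th * (d.+1%:R / N.*2%:R)))%:E)%E.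
Proof.
move=> k41 rho /andP [rho0 rho1]; set e := th * _.
have e0 : 0 <= e by rewrite mulr_ge0 // divr_ge0 // ltW.
elim=> [_|k IH kn].
  by rewrite smoothed0 /= scaler0 subr0 expr0 mul1r mul0r addr0.
have r0 V : reach 0 V -> @reach R d 0 V by [].
apply: le_trans.
apply: (@smoothed_step (Ordinal kn) 0%N rho e
  (fun V x => F (shifted_gram k V x)) (leq0n n) rho0 e0).
- move=> V rV; apply: (measurable_smoothed_trace _ (leq0n n) rV) => i ik.
  by rewrite inE.
- by move=> V x rV; exact: smoothed_trace_ge0 (leq0n n) rV.
- move=> V x rV.
  have h := step_bound_simple margin_gt0 (coercive_shifted_gram k x (leq0n n) rV) N0 k3 th0 k41. exact: h.
have h := IH (ltnW kn).
apply: (@le_trans _ _ (rho%:E * (rho ^+ k * F (1 : 'M[R]_d.+1) + k%:R * e)%:E + e%:E)%E).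
  by rewrite leeD2r // lee_wpmul2l.
rewrite -EFinM -EFinD lee_fin mulrDr mulrA -exprS -addrA lerD2l.
rewrite -[k.+1%:R]natr1 [leRHS]mulrDl mul1r lerD2r ler_piMl //.
by rewrite mulr_ge0.
Qed.

(** Induction on [k], uniformly in [m]: exchanging a row leaves one row less and one noise vector
    more, so [k + m] is invariant and stays at most [n], as [margin] requires. Since [rho <= 1], the
    drift errors simply add up. *)
Lemma smoothed_noise : th < 1 -> b = th / (1 - th) -> 1 <= k4 ->
  let rho := (1 - th) ^+ 2 +
    th ^+ 2 / 2 * (k4 - 1) * ((1 + N.*2%:R^-1) / margin ^+ 2) in
  rho <= 1 -> forall k m, (k + m <= n)%N ->
  (smoothed k m <= (rho ^+ k * noise (k + m) (fun V : 'M[R]_d.+1 => F (1 - (b / N.*2%:R) *: V)) +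
     k%:R * (2 * th * (d.+1%:R / N.*2%:R)))%:E)%E.
Proof.
move=> th1 bE k41 rho rho1; set e := 2 * th * _.
have e0 : 0 <= e by rewrite !mulr_ge0 // ?invr_ge0 // ltW.
have rho0 : 0 <= rho.
  rewrite addr_ge0 ?sqr_ge0 // mulr_ge0 //.
    by rewrite !mulr_ge0 ?sqr_ge0 ?subr_ge0 // invr_ge0.
  by rewrite divr_ge0 ?sqr_ge0 // addr_ge0 // invr_ge0 ltW.
elim=> [|k IH] m kmn.
  by rewrite smoothed0 add0n expr0 mul1r mul0r addr0.
have kn : (k < n)%N by apply: leq_trans kmn; rewrite addSn ltnS leq_addr.
have mn : (m < n)%N by apply: leq_trans kmn; rewrite addSn ltnS leq_addl.
have rS (V : 'M[R]_d.+1) s : reach m V -> reach m.+1 (V + outer (sgnv s)) by exists s, V.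
have shiftS V s x : shifted_gram k (V + outer (sgnv s)) x =
    shifted_gram k V x - (b / N.*2%:R) *: outer (sgnv s).
  by rewrite /shifted_gram scalerDr opprD addrA.
apply: le_trans.
apply: (@smoothed_step (Ordinal kn) m rho e
  (fun V x => avg (fun s => F (shifted_gram k (V + outer (sgnv s)) x)))
  (ltnW mn) rho0 e0).
- move=> V rV.
  apply: measurable_avg => s.
  by apply: (measurable_smoothed_trace _ mn (rS V s rV)) => i ik; rewrite inE.
- by move=> V x rV; apply: avg_ge0 => s; exact: smoothed_trace_ge0 mn (rS V s rV).
- move=> V x rV.
  have C' s : coercive margin (shifted_gram k V x -
      (th / (1 - th) / N.*2%:R) *: outer (sgnv s)).
    by rewrite -bE -shiftS; exact: coercive_shifted_gram mn (rS V s rV).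
  apply: le_trans (step_bound_avg margin_gt0
    (coercive_shifted_gram k x (ltnW mn) rV) N0 k3 _ k41 margin_gt0 C') _.
    by rewrite th0.
  rewrite lerD2r ler_wpM2l // avg_le // => s.
  by rewrite shiftS bE.
have h := IH m.+1; rewrite addnS -addSn in h; have {}h := h kmn.
apply: (@le_trans _ _ (rho%:E * (rho ^+ k *
   noise (k.+1 + m) (fun V : 'M[R]_d.+1 => F (1 - (b / N.*2%:R) *: V)) + k%:R * e)%:E + e%:E)%E).
  by rewrite leeD2r // lee_wpmul2l.
rewrite -EFinM -EFinD lee_fin mulrDr mulrA -exprS -addrA lerD2l.
rewrite -[k.+1%:R]natr1 [leRHS]mulrDl mul1r lerD2r ler_piMl //.
by rewrite mulr_ge0.
Qed.

End Lindeberg.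

(** * Eigenvalues and resolvent traces *)

Section RealEigenvalues.
Variables (R : realType) (d : nat).
Local Notation M := 'M[R]_d.+1.
Local Notation cV := 'cV[R]_d.+1.
Implicit Types (A B K : M) (x : cV).

Lemma mulmx_unitv B x i : bform B (unitv R i) x = (B *m x) i 0.
Proof. by rewrite /bform /unitv trmx_delta -mulmxA -rowE mxE. Qed.

(** The Hilbert-Schmidt norm of [A ^+ a] bounds its operator norm: Cauchy-Schwarz on each coordinate
    of [A ^+ a *m x], then summation. *)
Lemma qform_expr_double_le_trace A a x : A^T = A ->
  qform (A ^+ a.*2) x <= \tr (A ^+ a.*2) * nrm2 x.
Proof.
move=> sA; rewrite qform_expr_double // nrm2E trace_unitv mulr_suml.
apply: ler_sum => i _; rewrite qform_expr_double // -mulmx_unitv.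
have sAa := sym_expr a sA.
have -> : bform (A ^+ a) (unitv R i) x = bform 1 (A ^+ a *m unitv R i) x.
  by rewrite bform_mulmx // mulr1.
apply: cauchy_schwarz_psd; first exact: trmx1.
exact: nrm2_ge0.
Qed.

Lemma qform_le_trace_sqr B x : B^T = B ->
  qform B x <= (1 + \tr (B ^+ 2)) / 2 * nrm2 x.
Proof.
move=> sB; have := nrm2_ge0 (x - B *m x).
have -> : nrm2 (x - B *m x) = nrm2 x - 2 * qform B x + qform (B ^+ 2) x.
  rewrite !nrm2E -[x - B *m x]/(x + - (B *m x)).
  rewrite (qform_expr_double 1) // expr1 nrm2E.
  have -> : qform B x = \sum_i x i 0 * (B *m x) i 0.
    rewrite /qform /bform -mulmxA mxE; apply: eq_bigr => i _; by rewrite mxE.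
  rewrite mulr_sumr -sumrB -big_split /=; apply: eq_bigr => i _.
  by rewrite !mxE; ring.
have := qform_expr_double_le_trace 1 x sB.
move: (qform B x) (qform _ x) (nrm2 x) (\tr _) => p q r t; nra.
Qed.

Lemma symmetric_mulmx_eigen K a : K^T = K -> eigenvalue K a ->
  exists2 x : cV, x != 0 & K *m x = a *: x.
Proof.
move=> sK /eigenvalueP [v vK v0]; exists v^T; last first.
  by rewrite -[K in LHS]sK -trmx_mul vK linearZ.
by apply: contra_neq v0 => vT; rewrite -[v]trmxK vT trmx0.
Qed.

(* The supremum of the coercivity constants is an eigenvalue: otherwise
   [K - sup] is invertible and positive, hence coercive with a positive constant. *)
Lemma psd_eigenvalue K : K^T = K -> (forall x, 0 <= qform K x) ->
  exists a, eigenvalue K a.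
Proof.
move=> sK pK.
pose S := [set c : R | forall x, c * nrm2 x <= qform K x]%classic.
have S0 : S 0 by move=> x; rewrite mul0r.
have supS : has_sup S.
  split; first by exists 0.
  by exists (qform K (unitv R 0)) => c /(_ (unitv R 0)); rewrite nrm2_unitv mulr1.
exists (sup S); apply: contraT => noteig.
have sS x : sup S * nrm2 x <= qform K x.
  have [->|x0] := eqVneq x 0.
    by rewrite /nrm2 /qform /bform !mulmx0 !mxE mulr0.
  have n0 : 0 < nrm2 x by rewrite lt_neqAle eq_sym nrm2_eq0 x0 nrm2_ge0.
  rewrite -ler_pdivlMr //; apply: ge_sup; first by exists 0.
  by move=> c Sc; rewrite ler_pdivlMr.
pose A : M := K - (sup S)%:M.
have sA : A^T = A by rewrite linearB /= sK tr_scalar_mx.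
have qA x : qform A x = qform K x - sup S * nrm2 x.
  by rewrite /A qform_add qform_opp -scalemx1 qform_scale.
have pA x : 0 <= qform A x by rewrite qA subr_ge0.
have uA : A \is a GRing.unit.
  rewrite -[_ \is a _]/(A \in unitmx) -row_free_unit -kermx_eq0.
  by move: noteig; rewrite /eigenvalue /eigenspace negbK.
have sG := sym_inv sA.
set m := (1 + \tr (A^-1 ^+ 2)) / 2.
have m0 : 0 < m.
  rewrite divr_gt0 // ltr_pwDl // trace_unitv sumr_ge0 // => i _.
  by rewrite (qform_expr_double 1) // nrm2_ge0.
(* Cauchy-Schwarz for the form [A] at [A^-1 *m x] and [x] bounds [nrm2 x ^+ 2] by the product of the
   forms of [A^-1] and [A]; the former is at most [m * nrm2 x]. *)
have low x : m^-1 * nrm2 x <= qform A x.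
  have := cauchy_schwarz_psd (A^-1 *m x) x sA pA.
  rewrite bform_mulmx // mulVr // qform_mulmx // mulVr // mul1r -/(nrm2 x) => cs.
  have [->|x0] := eqVneq x 0.
    by rewrite /nrm2 /qform /bform !mulmx0 !mxE mulr0.
  have n0 : 0 < nrm2 x by rewrite lt_neqAle eq_sym nrm2_eq0 x0 nrm2_ge0.
  have := le_trans cs (ler_wpM2r (pA x) (qform_le_trace_sqr x sG)).
  rewrite -/m expr2 [m * _]mulrC -mulrA ler_pM2l // => h.
  by rewrite mulrC ler_pdivrMr // mulrC.
have : S (sup S + m^-1).
  by move=> x; have := low x; rewrite qA mulrDl; lra.
by move/(ub_le_sup supS.2); rewrite gerDl leNgt invr_gt0 m0.
Qed.

(** An eigenvector of [K] is one of every power of the resolvent, and an eigenvalue of an even power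
    of a symmetric matrix is at most the trace of that power. *)
Lemma trace_inv_eigenvalue K a s N : K^T = K -> coercive 1 (1 + s *: K) ->
  eigenvalue K a ->
  1 <= 1 + s * a /\ (1 + s * a) ^- N.*2 <= \tr ((1 + s *: K)^-1 ^+ N.*2).
Proof.
move=> sK cC /(symmetric_mulmx_eigen sK) [x x0 Kx].
set C := 1 + s *: K in cC *; set l := 1 + s * a.
have n0 : 0 < nrm2 x by rewrite lt_neqAle eq_sym nrm2_eq0 x0 nrm2_ge0.
have Cx : C *m x = l *: x.
  by rewrite mulmxDl mul1mx -scalemxAl Kx scalerA scalerDl scale1r.
have l1 : 1 <= l.
  have := cC.2 x; rewrite mul1r /qform /bform -mulmxA Cx -scalemxAr mxE.
  rewrite (_ : (x^T *m x) 0 0 = nrm2 x); first by rewrite ler_pMl.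
  by rewrite /nrm2 /qform /bform mulmx1.
have l0 : l != 0 by rewrite gt_eqF // (lt_le_trans ltr01).
have Gx k : C^-1 ^+ k *m x = l ^- k *: x.
  have uC := coercive_unit ltr01 cC.
  have G1 : C^-1 *m x = l^-1 *: x.
    rewrite -[x in LHS]scale1r -(mulVf l0) -scalerA -Cx -scalemxAr mulmxA.
    by rewrite [C^-1 *m C](mulVr uC) mul1mx.
  elim: k => [|k IH]; first by rewrite !expr0 mul1mx invr1 scale1r.
  rewrite exprSr -[_ ^+ k * _]/(_ ^+ k *m _) -mulmxA G1 -scalemxAr IH scalerA.
  by rewrite exprS invfM.
split=> //; have sG := sym_inv cC.1.
have := qform_expr_double_le_trace N x sG.
rewrite qform_expr_double // Gx {1}/nrm2 qform_scalev -/(nrm2 x) ler_pM2r //.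
by rewrite -!exprVn -exprM muln2.
Qed.

End RealEigenvalues.

(** * Choice of parameters *)

Section Rates.
Variable R : realType.
Implicit Types (eps kappa L D theta q b t : R) (n : nat).

Lemma expR_pow_le (x y : R) n : 0 <= x -> x <= expR y -> x ^+ n <= expR (n%:R * y).
Proof. by move=> x0 xy; rewrite mulrC expRM_natr lerXn2r // nnegrE ?expR_ge0. Qed.

(** The exact second-order coefficient is [1 / 2]. Raising [1 - y / 4 <= expR (- (y / 4))] to the
    fourth power keeps [3 / 8] of it, and [7 / 20] leaves room for the higher orders. *)
Lemma one_sub_le_expR theta : 0 <= theta <= 1 / 10 ->
  1 - theta <= expR (- (theta + 7 / 20 * theta ^+ 2)).
Proof.
move=> /andP [t0 t1]; set y := theta + _.
have y4 : 1 - y / 4 <= expR (- (y / 4)) by have := expR_ge1Dx (- (y / 4)).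
have -> : - y = - (y / 4) * 4%:R by field.
have ys : theta <= y <= 207 / 200 * theta.
  have : 0 <= theta * (1 / 10 - theta) by rewrite mulr_ge0 ?subr_ge0.
  have := sqr_ge0 theta; rewrite /y !expr2 mulrBr; lra.
have [y1 y2] := andP ys; rewrite expRM_natr.
have p4 : 0 <= 1 - y / 4 by lra.
apply: le_trans (lerXn2r 4 _ _ y4); rewrite ?nnegrE ?expR_ge0 //.
have -> : (1 - y / 4) ^+ 4 = 1 - theta - 7 / 20 * theta ^+ 2 +
    y ^+ 2 * (3 / 8 - y / 16) + (y ^+ 2 / 16) ^+ 2 by rewrite /y; field.
have a1 : theta ^+ 2 <= y ^+ 2 by rewrite lerXn2r // nnegrE (le_trans t0).
have a2 : y ^+ 2 * (7 / 20) <= y ^+ 2 * (3 / 8 - y / 16).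
  by rewrite ler_wpM2l ?sqr_ge0 //; lra.
have := sqr_ge0 (y ^+ 2 / 16); lra.
Qed.

(** The drift left over is [n * theta * eps * (99/100 - q / 2)]. As [kappa - 1 + D] is below
    [21 * kappa], it is at least [(50 / 21) * (97 / 200) * L], and this product of constants exceeds
    one. *)
Lemma simple_rate eps kappa L D q theta n :
  0 < eps < 1 -> 1 <= kappa -> 1 <= D -> D <= 20 * kappa -> 0 <= L ->
  50 * kappa * L <= n%:R * eps ^+ 2 -> 0 <= q <= 101 / 100 ->
  theta = eps / (kappa - 1 + D) ->
  (1 - theta + theta ^+ 2 / 2 * (kappa - 1 + D) * q) ^+ n <=
  expR (- L) * expR (- (theta * n%:R * (1 - 99 / 100 * eps))).
Proof.
move=> /andP [e0 e1] k1 D1 Dk L0 nL /andP [q0 q1]; set M := kappa - 1 + D => thE.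
have M1 : 1 <= M by rewrite /M; lra.
have M0 : 0 < M by lra.
have th0 : 0 <= theta by rewrite thE divr_ge0 // ltW.
have thM : theta * M = eps by rewrite thE divfK // gt_eqF.
have th1 : theta <= 1.
  by rewrite -(@ler_pM2r _ M) // thM mul1r; lra.
have -> : theta ^+ 2 / 2 * M * q = theta * eps * (q / 2) by rewrite -thM; field.
apply: le_trans (expR_pow_le n (y := - theta + theta * eps * (q / 2)) _ _) _.
- by rewrite addr_ge0 ?subr_ge0 // !mulr_ge0 // ?invr_ge0 // ltW.
- by apply: le_trans (expR_ge1Dx _); rewrite addrA.
rewrite -expRD ler_expR -subr_ge0.
have -> : - L - theta * n%:R * (1 - 99 / 100 * eps) -
    n%:R * (- theta + theta * eps * (q / 2)) =
    n%:R * (theta * eps) * (99 / 100 - q / 2) - L by field.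
have te : n%:R * (theta * eps) = n%:R * eps ^+ 2 / M by rewrite thE; field; rewrite gt_eqF.
have low : 50 / 21 * L <= n%:R * (theta * eps).
  rewrite te ler_pdivlMr //; apply: le_trans nL.
  have : 0 <= L * (21 * kappa - M) by rewrite mulr_ge0 // /M; lra.
  rewrite mulrBr; lra.
rewrite subr_ge0.
have q2 : 97 / 200 <= 99 / 100 - q / 2 by lra.
apply: (@le_trans _ _ (50 / 21 * L * (97 / 200))); first by lra.
have p1 : 0 <= 50 / 21 * L by lra.
have p2 : 0 <= 97 / 200 :> R by lra.
exact: ler_pM p1 p2 low q2.
Qed.

(** The first-order terms in [theta] cancel: [-2] from [(1 - theta) ^+ 2], [+1] from the mean
    [b * n] of the noise, [+1] from the target. At order [theta * eps] the noise costs at most about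
    [66/100], thanks to [n * eps ^+ 2 >= 25 * D] and a [t] of the order that balances [n * t]
    against [D / t]; the target allows [99/100]. The surplus [1/5 * theta * eps * n = n * eps ^+ 2 /
    (50 * kappa)] pays for [L]. *)
Lemma noise_rate eps kappa L D q theta b t n :
  0 < eps < 1 -> 1 <= kappa -> 21 <= D -> 0 <= L ->
  25 * D <= n%:R * eps ^+ 2 -> 50 * kappa * L <= n%:R * eps ^+ 2 ->
  0 <= q <= 101 / 100 ->
  theta = eps / (10 * kappa) -> b = theta / (1 - theta) -> t = 17 / 100 * eps ->
  ((1 - theta) ^+ 2 + theta ^+ 2 / 2 * (kappa - 1) * q) ^+ n *
    expR (b * n%:R + 5 / 4 * b / t * (27 / 20 * (n%:R * t ^+ 2) + (31 / 25 * D + 1 / 10))) <=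
  expR (- L) * expR (- (theta * n%:R * (1 - 99 / 100 * eps))).
Proof.
move=> /andP [e0 e1] k1 D21 L0 nD nL /andP [q0 q1] thE bE tE.
have thk : theta * kappa = eps / 10 by rewrite thE; field; rewrite gt_eqF; lra.
have th0 : 0 < theta by rewrite thE divr_gt0 //; lra.
have the : theta <= eps / 10 by rewrite -thk ler_peMr // ltW.
have th1 : theta <= 1 / 10 by lra.
have s0 : 9 / 10 <= 1 - theta by lra.
have t0 : 0 < t by rewrite tE; lra.
have b0 : 0 <= b by rewrite bE divr_ge0 ?(ltW th0) //; lra.
have bth : b <= theta + 10 / 9 * theta ^+ 2.
  rewrite bE ler_pdivrMr; last lra.
  have : 0 <= theta ^+ 2 * (1 / 10 - theta) by rewrite mulr_ge0 ?sqr_ge0 ?subr_ge0.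
  rewrite -subr_ge0 => h; rewrite -subr_ge0.
  have -> : (theta + 10 / 9 * theta ^+ 2) * (1 - theta) - theta =
    10 / 9 * (theta ^+ 2 * (1 / 10 - theta)) by field.
  by rewrite mulr_ge0 //; rewrite subr0 in h.
(* [101 / 162] is [101 / 200], the bound on [q / 2], over [81 / 100], the lower bound on the
   factored [(1 - theta) ^+ 2]. *)
pose z := 101 / 162 * (theta ^+ 2 * (kappa - 1)).
have base : (1 - theta) ^+ 2 + theta ^+ 2 / 2 * (kappa - 1) * q <=
    expR (- (2 * theta + 7 / 10 * theta ^+ 2) + z).
  have tk0 : 0 <= theta ^+ 2 * (kappa - 1) by rewrite mulr_ge0 ?sqr_ge0 ?subr_ge0.
  apply: (@le_trans _ _ ((1 - theta) ^+ 2 * (1 + z))).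
    rewrite [leRHS]mulrDr mulr1 lerD2l.
    have s2 : 81 / 100 <= (1 - theta) ^+ 2.
      have -> : 81 / 100 = (9 / 10) ^+ 2 :> R by field.
      by rewrite lerXn2r // nnegrE; lra.
    apply: (@le_trans _ _ (81 / 100 * z)); last first.
      by rewrite ler_wpM2r // /z mulr_ge0.
    rewrite /z [leLHS](_ : _ = theta ^+ 2 * (kappa - 1) * (q / 2)); last by field.
    rewrite [leRHS](_ : _ = theta ^+ 2 * (kappa - 1) * (101 / 200)); last by field.
    by rewrite ler_wpM2l //; lra.
  rewrite expRD; apply: ler_pM => //; first exact: sqr_ge0.
  - by rewrite addr_ge0 // /z mulr_ge0.
  - have -> : - (2 * theta + 7 / 10 * theta ^+ 2) =
      - (theta + 7 / 20 * theta ^+ 2) * 2%:R by field.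
    rewrite expRM_natr lerXn2r ?nnegrE ?expR_ge0 //; first by lra.
    by apply: one_sub_le_expR; rewrite (ltW th0).
  - exact: expR_ge1Dx.
have noise_part : 5 / 4 * b / t * (27 / 20 * (n%:R * t ^+ 2) + (31 / 25 * D + 1 / 10)) <=
    66 / 100 * (n%:R * eps * b).
  have -> : 5 / 4 * b / t * (27 / 20 * (n%:R * t ^+ 2) + (31 / 25 * D + 1 / 10)) =
    b * ((27 / 16 * (n%:R * t ^+ 2) + (31 / 20 * D + 1 / 8)) / t).
    by field; rewrite gt_eqF.
  have -> : 66 / 100 * (n%:R * eps * b) = b * (66 / 100 * (n%:R * eps)) by ring.
  rewrite ler_wpM2l // ler_pdivrMr // tE.
  have -> : n%:R * (17 / 100 * eps) ^+ 2 = (17 / 100) ^+ 2 * (n%:R * eps ^+ 2) by ring.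
  have -> : 66 / 100 * (n%:R * eps) * (17 / 100 * eps) =
    66 / 100 * (17 / 100) * (n%:R * eps ^+ 2) by ring.
  move: (n%:R * eps ^+ 2) nD => w nD; lra.
apply: (@le_trans _ _ (expR (n%:R * (- (2 * theta + 7 / 10 * theta ^+ 2) + z)) *
    expR (b * n%:R + 66 / 100 * (n%:R * eps * b)))).
  apply: ler_pM; rewrite ?expR_ge0 //.
  - rewrite exprn_ge0 // addr_ge0 ?sqr_ge0 // !mulr_ge0 ?subr_ge0 ?invr_ge0 ?(ltW th0) //.
  - apply: expR_pow_le => //.
    by rewrite addr_ge0 ?sqr_ge0 // !mulr_ge0 ?subr_ge0 ?invr_ge0 ?(ltW th0) //.
  - by rewrite ler_expR lerD2l.
rewrite -!expRD ler_expR.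
have n0 : 0 <= n%:R :> R by [].
have small : - (2 * theta + 7 / 10 * theta ^+ 2) + z + b + 66 / 100 * (eps * b) +
    theta * (1 - 99 / 100 * eps) <= - (1 / 5 * (theta * eps)).
  have zE : z = 101 / 162 * (theta * eps / 10 - theta ^+ 2).
    rewrite -[theta * eps / 10]mulrA -thk /z; ring.
  have eb : eps * b <= theta * eps + 10 / 9 * theta ^+ 2.
    apply: le_trans (ler_wpM2l (ltW e0) bth) _.
    rewrite mulrDr [eps * theta]mulrC lerD2l.
    by rewrite ler_piMl ?(ltW e1) // mulr_ge0 ?sqr_ge0.
  have tt : theta ^+ 2 <= theta * eps / 10.
    by rewrite expr2 -mulrA ler_wpM2l // ltW.
  have te : 0 <= theta * eps by rewrite mulr_ge0 // ltW.
  have -> : theta * (1 - 99 / 100 * eps) = theta - 99 / 100 * (theta * eps) by field.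
  rewrite zE; move: (theta ^+ 2) (theta * eps) (eps * b) te tt eb bth => u v w te tt eb bth.
  lra.
have rate : L <= n%:R * (1 / 5 * (theta * eps)).
  have -> : n%:R * (1 / 5 * (theta * eps)) = (n%:R * eps ^+ 2) / (50 * kappa).
    by rewrite thE; field; rewrite gt_eqF; lra.
  by rewrite ler_pdivlMr ?mulr_gt0 //; [rewrite mulrC|lra].
have := ler_wpM2l n0 small; rewrite -subr_ge0 => h; rewrite -subr_ge0.
apply: le_trans (addr_ge0 h (_ : 0 <= n%:R * (1 / 5 * (theta * eps)) - L)) _.
  by rewrite subr_ge0.
by rewrite le_eqVlt; apply/orP; left; apply/eqP; ring.
Qed.

End Rates.

Lemma exists_double_ge (R : realType) (a : R) :
  exists2 N, (0 < N)%N & a <= N.*2%:R :> R.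
Proof.
exists (Num.truncn a).+1 => //.
apply: le_trans (ltW (truncnS_gt a)) _.
by rewrite ler_nat -addnn leq_addr.
Qed.

Section LargeExponent.
Variable R : realType.
Implicit Types B r u v x theta kappa eps q : R.

Lemma large_exponent_bounds B r x : 0 <= B -> 0 <= r ->
  1000 + 1000 * B + 4 * B ^+ 2 + r <= x ->
  [/\ B / x <= 1 / 1000, x^-1 <= 1 / 1000, B < x,
     B <= x / 2 /\ B ^+ 2 <= x / 4 & r <= x].
Proof.
move=> B0 r0 Bx; have B2 := sqr_ge0 B.
have x0 : 0 < x by lra.
split; [rewrite ler_pdivrMr //; lra| |lra|split; lra|lra].
by rewrite -[x^-1]div1r ler_pdivrMr //; lra.
Qed.

Lemma margin_ratio_le u v : 0 <= u <= 1 / 1000 -> 0 <= v <= 1 / 1000 ->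
  0 <= (1 + u) / (1 - v) ^+ 2 <= 101 / 100.
Proof.
move=> /andP [u0 u1] /andP [v0 v1].
have v2 : 1 - 2 * v <= (1 - v) ^+ 2.
  have -> : (1 - v) ^+ 2 = 1 - 2 * v + v ^+ 2 by ring.
  by rewrite lerDl sqr_ge0.
have w0 : 0 < (1 - v) ^+ 2 by apply: lt_le_trans v2; lra.
apply/andP; split; first by apply: divr_ge0; [lra|exact: ltW].
by rewrite ler_pdivrMr //; lra.
Qed.

Lemma noise_factor_le1 theta kappa eps q : 0 <= theta <= 1 / 10 -> 1 <= kappa ->
  theta * kappa = eps / 10 -> eps < 1 -> q <= 101 / 100 ->
  (1 - theta) ^+ 2 + theta ^+ 2 / 2 * (kappa - 1) * q <= 1.
Proof.
move=> /andP [t0 t1] k1 tk e1 q1.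
have tk0 : 0 <= theta ^+ 2 / 2 * (kappa - 1).
  by rewrite mulr_ge0 ?subr_ge0 // divr_ge0 ?sqr_ge0.
apply: le_trans (lerD (lexx _) (ler_wpM2l tk0 q1)) _.
have -> : (1 - theta) ^+ 2 + theta ^+ 2 / 2 * (kappa - 1) * (101 / 100) =
  1 - theta * (2 - 101 / 200 * (theta * kappa) - 99 / 200 * theta) by field.
by rewrite gerBl tk; apply: mulr_ge0; [exact: t0|lra].
Qed.

End LargeExponent.

Section TraceMean.
Local Open Scope classical_set_scope.
Context {dT : measure_display} {T : measurableType dT} {R : realType}
  (P : probability T R) {I : finType} (X : I -> T -> R)
  {n d : nat} (row : I -> 'I_n) (W : 'I_n -> T -> 'cV[R]_d.+1) (k3 k4 : R).
Hypotheses (mX : forall i, measurable_fun setT (X i))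
  (indX : mutually_independent P X)
  (mW : forall (A : {set I}) k, (forall i, row i = k -> i \in A) ->
     measurable_mx (W k : generated X A -> _))
  (momW : forall k (e : 'I_d.+1 -> nat), (forall j, e j <= 4)%N ->
  has_mean P (fun x => \prod_j W k x j 0 ^+ e j) (\prod_j pmom k3 k4 (e j))).
Local Notation D := (d.+1%:R : R).
Variables eps delta : R.
Hypotheses (heps : 0 < eps < 1) (hdelta : 0 < delta < 1) (k41 : 1 <= k4)
  (nD : 25 * D <= n%:R * eps ^+ 2)
  (nL : 50 * k4 * ln (2 * D / delta) <= n%:R * eps ^+ 2).

Definition trace_mean N th : \bar R :=
  (\int[P]_x (\tr ((1 + (th / N.*2%:R) *: gram W n x)^-1 ^+ N.*2))%:E)%E.

Lemma smoothed_trace_mean N th b : smoothed P W N th b n 0 = trace_mean N th.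
Proof.
apply: eq_integral => x _; congr (\tr (_^-1 ^+ _))%:E.
by rewrite /shifted_gram scaler0 subr0.
Qed.

Let D1 : 1 <= D. Proof. by rewrite ler1n. Qed.

Let L0 : 0 <= ln (2 * D / delta).
Proof.
have /andP [d0 d1] := hdelta.
by rewrite ln_ge0 // ler_pdivlMr // mul1r (le_trans (ltW d1)) //; move: D1; lra.
Qed.

Let expL : expR (- ln (2 * D / delta)) = delta / (2 * D).
Proof.
have /andP [d0 d1] := hdelta.
by rewrite expRN lnK ?posrE ?divr_gt0 ?mulr_gt0 // invf_div.
Qed.

Lemma trace_mean_simple : D <= 20 * k4 ->
  exists N th, [/\ (0 < N)%N, 0 < th & (trace_mean N th <=
    (delta * expR (- (th * n%:R * (1 - 99 / 100 * eps))))%:E)%E].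
Proof.
move=> Dk; have /andP [e0 e1] := heps; have /andP [d0 d1] := hdelta.
have M1 : 1 <= k4 - 1 + D by move: D1 k41; lra.
pose th := eps / (k4 - 1 + D).
have th0 : 0 < th by rewrite divr_gt0 // (lt_le_trans ltr01).
have thM : th * (k4 - 1 + D) = eps by rewrite divfK // gt_eqF // (lt_le_trans ltr01).
have th1 : th <= 1.
  by rewrite -thM in e1; apply: le_trans (ltW e1); rewrite ler_peMr // ltW.
set Q := expR (- (th * n%:R * (1 - 99 / 100 * eps))).
have Q0 : 0 < Q by exact: expR_gt0.
(* [th] and [Q] do not involve [N], so [N] is chosen last; [N.*2 >= r] brings the accumulated drift
   below a third of the target, and the summand 100 in its bound gives [q <= 101 / 100]. *)
pose r := n%:R * (th * D) / (delta / 3 * Q).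
have dQ0 : 0 < delta / 3 * Q by rewrite mulr_gt0 // divr_gt0.
have r0 : 0 <= r.
  apply: divr_ge0; last exact: ltW.
  by apply: mulr_ge0 => //; apply: mulr_ge0 => //; exact: ltW.
have [N N0 hN] := exists_double_ge (100 + r).
have nn0 : 0 < N.*2%:R :> R by rewrite ltr0n double_gt0.
exists N, th; split => //; rewrite -(smoothed_trace_mean N th 0).
have bn : 0 * (n * d.+1)%:R < N.*2%:R :> R by rewrite mul0r.
set q := (1 + (N.*2%:R)^-1) / (@margin R n d N 0) ^+ 2.
have qE : q = 1 + (N.*2%:R)^-1 by rewrite /q /margin !mul0r subr0 expr1n divr1.
have q1 : 0 <= q <= 101 / 100.
  rewrite qE addr_ge0 ?invr_ge0 ?(ltW nn0) //=.
  have : (N.*2%:R)^-1 <= 100^-1 :> R by rewrite lef_pV2 ?posrE //; lra.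
  by move: (_^-1) => u; lra.
have rho01 : 0 <= 1 - th + th ^+ 2 / 2 * (k4 - 1 + D) * q <= 1.
  have /andP [q0 q2] := q1.
  have -> : th ^+ 2 / 2 * (k4 - 1 + D) * q = th * (eps * q / 2) by rewrite -thM; field.
  have eq1 : 0 <= eps * q by rewrite mulr_ge0 // ltW.
  have eq2 : eps * q <= 101 / 100.
    by apply: le_trans q2; rewrite ler_piMl // ltW.
  have p0 : 0 <= eps * q / 2 <= 1 by move: eq1 eq2; lra.
  have [p1 p2] := andP p0.
  have p3 : th * (eps * q / 2) <= th by rewrite ler_piMr // ltW.
  have p4 := mulr_ge0 (ltW th0) p1.
  by apply/andP; split; move: p3 p4 th1; lra.
apply: le_trans (smoothed_simple mX indX mW momW N0 (ltW th0) (lexx 0) bn k41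
  rho01 (leqnn n)) _.
rewrite lee_fin -/q.
have -> : \tr ((1 : 'M[R]_d.+1)^-1 ^+ N.*2) = D by rewrite invr1 expr1n mxtrace1.
have rate := simple_rate heps k41 D1 Dk L0 nL q1 (erefl th).
(* The trace starts at [D], and [expL] turns it into [delta / 2]; together with the third spent on
   the drift this is [5 / 6] of the target. *)
apply: (@le_trans _ _ (delta / (2 * D) * Q * D + delta / 3 * Q)).
  apply: lerD; first by rewrite ler_wpM2r // -expL.
  have -> : n%:R * (th * (D / N.*2%:R)) = r * (delta / 3 * Q) / N.*2%:R.
    by rewrite /r; field; rewrite !gt_eqF.
  rewrite ler_pdivrMr // mulrC ler_wpM2l ?(ltW dQ0) //.
  by move: hN r0; lra.
have -> : delta / (2 * D) * Q * D + delta / 3 * Q = 5 / 6 * (delta * Q) by field.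
by rewrite ler_piMl // ?mulr_ge0 ?(ltW Q0) ?(ltW d0) //; lra.
Qed.

Lemma trace_mean_noise : 20 * k4 < D ->
  exists N th, [/\ (0 < N)%N, 0 < th & (trace_mean N th <=
    (delta * expR (- (th * n%:R * (1 - 99 / 100 * eps))))%:E)%E].
Proof.
move=> Dk; have /andP [e0 e1] := heps; have /andP [d0 d1] := hdelta.
have d20 : (20 < d.+1)%N by rewrite -(ltr_nat R); move: k41 Dk; lra.
have D21 : 21 <= D by rewrite ler_nat.
pose th := eps / (10 * k4).
have k0 : 0 < k4 by apply: lt_le_trans ltr01 _.
have thk : th * k4 = eps / 10 by rewrite /th; field; rewrite gt_eqF.
have th0 : 0 < th by rewrite divr_gt0 // mulr_gt0.
have the : th <= eps / 10 by rewrite -thk ler_peMr // ltW.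
have th1 : th <= 1 / 10 by lra.
have th_lt1 : th < 1 by lra.
pose b := th / (1 - th).
have s0 : 0 < 1 - th by lra.
have b0 : 0 <= b by rewrite divr_ge0 ?ltW.
pose t := 17 / 100 * eps.
have t0 : 0 < t <= 17 / 100 by rewrite /t; lra.
have bt : 5 / 4 * b <= t.
  rewrite /b mulrA ler_pdivrMr // /t.
  have : eps * th <= eps * (1 / 10) by rewrite ler_wpM2l // ltW.
  rewrite mulrBr mulr1 -[17 / 100 * eps * th]mulrA; lra.
set Q := expR (- (th * n%:R * (1 - 99 / 100 * eps))).
have Q0 : 0 < Q by exact: expR_gt0.
pose B := b * (n * d.+1)%:R; have B0 : 0 <= B by rewrite mulr_ge0.
pose r := n%:R * (2 * th * D) / (delta / 3 * Q).
have dQ0 : 0 < delta / 3 * Q by rewrite mulr_gt0 // divr_gt0.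
have r0 : 0 <= r.
  apply: divr_ge0; last exact: ltW.
  by rewrite mulr_ge0 // mulr_ge0 // mulr_ge0 // ltW.
have [N N0 hN] := exists_double_ge (1000 + 1000 * B + 4 * B ^+ 2 + r).
have nn0 : 0 < N.*2%:R :> R by rewrite ltr0n double_gt0.
have [BN nnV bn [B_half B_quarter] rN] := large_exponent_bounds B0 r0 hN.
exists N, th; split => //; rewrite -(smoothed_trace_mean N th b).
set q := (1 + (N.*2%:R)^-1) / (@margin R n d N b) ^+ 2.
have q1 : 0 <= q <= 101 / 100.
  by apply: margin_ratio_le; rewrite (BN, nnV) andbT ?invr_ge0 ?divr_ge0 // ltW.
have rho1 : (1 - th) ^+ 2 + th ^+ 2 / 2 * (k4 - 1) * q <= 1.
  by apply: (noise_factor_le1 _ k41 thk e1); [rewrite (ltW th0)|case/andP: q1].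
apply: le_trans (smoothed_noise mX indX mW momW N0 (ltW th0) b0 bn th_lt1
  (erefl b) k41 rho1 (_ : n + 0 <= n)%N) _; first by rewrite addn0.
rewrite lee_fin -/q addn0.
have nb := noise_trace_bound (m := n) d20 N0 t0 b0 bt.
have {}nb := nb B_half B_quarter.
have rate := noise_rate heps k41 D21 L0 nD nL q1 (erefl th) (erefl b) (erefl t).
set U := expR _ in nb; rewrite -/U -/Q expL in rate.
have rho0 : 0 <= (1 - th) ^+ 2 + th ^+ 2 / 2 * (k4 - 1) * q.
  have /andP [q0 _] := q1.
  by rewrite addr_ge0 ?sqr_ge0 // mulr_ge0 // mulr_ge0 ?subr_ge0 // divr_ge0 ?sqr_ge0.
(* The prefactor [4 / 3 * D] times [delta / (2 * D)] is two thirds of [delta]; the drift takes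
   exactly the last third. *)
apply: (@le_trans _ _ (4 / 3 * D * (delta / (2 * D) * Q) + delta / 3 * Q)).
  apply: lerD.
    apply: le_trans (ler_wpM2l (exprn_ge0 n rho0) nb) _.
    by rewrite mulrCA ler_wpM2l // mulr_ge0.
  have -> : n%:R * (2 * th * (D / N.*2%:R)) = r * (delta / 3 * Q) / N.*2%:R.
    by rewrite /r; field; rewrite !gt_eqF.
  rewrite ler_pdivrMr // mulrC ler_wpM2l ?(ltW dQ0) //.
by rewrite -/Q le_eqVlt; apply/orP; left; apply/eqP; field.
Qed.

Lemma trace_mean_le : exists N th, [/\ (0 < N)%N, 0 < th & (trace_mean N th <=
    (delta * expR (- (th * n%:R * (1 - 99 / 100 * eps))))%:E)%E].
Proof.
have [Dk|Dk] := leP D (20 * k4); first exact: trace_mean_simple.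
exact: trace_mean_noise.
Qed.

End TraceMean.

Section MinimumEigenvalue.
Variables (R : realType) (n d : nat) (w : 'I_n -> 'cV[R]_d.+1).
Local Notation K := (n%:R^-1 *: \sum_i outer (w i)).

Lemma sym_sum_outer : (\sum_i outer (w i))^T = \sum_i outer (w i).
Proof. by rewrite linear_sum; apply: eq_bigr => i _; exact: sym_outer. Qed.

Lemma qform_sum_outer_ge0 x : 0 <= qform (\sum_i outer (w i)) x.
Proof.
by rewrite qform_sum sumr_ge0 // => i _; rewrite qform_outer sqr_ge0.
Qed.

Lemma lambda_min_ge N th r : (0 < n)%N -> (0 < N)%N -> 0 < th ->
  \tr ((1 + (th / N.*2%:R) *: \sum_i outer (w i))^-1 ^+ N.*2) <
    expR (- (th * n%:R * r)) ->
  r <= lambda_min K.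
Proof.
move=> n0 N0 th0 small.
have nn0 : 0 < N.*2%:R :> R by rewrite ltr0n double_gt0.
have nR : 0 < n%:R :> R by rewrite ltr0n.
have sK : K^T = K by rewrite linearZ /= sym_sum_outer.
have pK x : 0 <= qform K x.
  by rewrite qform_scale mulr_ge0 ?invr_ge0 ?qform_sum_outer_ge0.
pose s := th * n%:R / N.*2%:R.
have sE : (th / N.*2%:R) *: \sum_i outer (w i) = s *: K.
  by rewrite scalerA; congr (_ *: _); rewrite /s; field; rewrite !gt_eqF.
have s0 : 0 <= s by rewrite divr_ge0 ?mulr_ge0 // ltW.
have cK : coercive 1 (1 + s *: K).
  split=> [|x]; first by rewrite linearD linearZ /= trmx1 sK.
  by rewrite qform_add qform_scale -/(nrm2 x) mul1r lerDl mulr_ge0.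
(* The spectrum must be shown nonempty: the infimum of the empty set is a mere default value. *)
apply: lb_le_inf => [|a ea]; first exact: psd_eigenvalue.
have [l1 la] := trace_inv_eigenvalue N sK cK ea.
rewrite sE in small; have := le_lt_trans la small.
have l0 : 0 < 1 + s * a by apply: lt_le_trans l1.
rewrite expRN ltf_pV2 ?posrE ?exprn_gt0 ?expR_gt0 // => h.
have up : (1 + s * a) ^+ N.*2 <= expR (th * n%:R * a).
  apply: le_trans (expR_pow_le (y := s * a) _ (ltW l0) _) _.
    exact: expR_ge1Dx.
  rewrite ler_expR le_eqVlt; apply/orP; left; apply/eqP.
  by rewrite /s; field; rewrite gt_eqF.
have := lt_le_trans h up; rewrite ltr_expR ltr_pM2l ?mulr_gt0 //.
exact: ltW.
Qed.

End MinimumEigenvalue.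

Section Markov.
Local Open Scope classical_set_scope.
Context {dT : measure_display} {T : measurableType dT} {R : realType}
  (P : probability T R).

Lemma probability_lt_ge (f : T -> R) (a delta : R) :
  measurable_fun setT f -> (forall x, 0 <= f x) -> 0 < a ->
  (\int[P]_x (f x)%:E <= (delta * a)%:E)%E ->
  let A := [set x | f x < a] in measurable A /\ ((1 - delta)%:E <= P A)%E.
Proof.
move=> mf f0 a0 fa A.
have mA : measurable A.
  have -> : A = setT `&` f @^-1` `]-oo, a[%classic.
    by rewrite setTI; apply/seteqP; split => x; rewrite /A /= in_itv.
  by apply: mf => //; exact: measurable_itv.
split=> //; pose B := ~` A.
have mB : measurable B by exact: measurableC.
have PB : P B = (fine (P B))%:E by rewrite fineK // fin_num_measure.
have hB : has_mean P (\1_B) (fine (P B)).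
  split; first exact: integrable_indic.
  by rewrite integral_indic // setIT -PB.
have le1 : ((a * fine (P B))%:E <= (delta * a)%:E)%E.
  apply: le_trans fa; rewrite -(has_meanZ a hB).2; apply: ge0_le_integral => //.
  - by move=> x _; rewrite lee_fin mulr_ge0 // ltW.
  - exact/measurable_EFinP/(has_mean_measurable (has_meanZ a hB)).
  - exact/measurable_EFinP.
  - move=> x _; rewrite lee_fin indicE; have [xB|xB] := boolP (x \in B).
      by rewrite mulr1 leNgt; apply/negP => fx; move: xB; rewrite inE; exact.
    by rewrite mulr0.
have -> : P A = (1 - P B)%E.
  by rewrite -[A]setCK; exact: probability_setC.
rewrite PB -EFinB lee_fin lerD2l lerN2.
by move: le1; rewrite lee_fin mulrC ler_pM2r.
Qed.

End Markov.

Local Open Scope classical_set_scope.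
Local Open Scope ring_scope.

Lemma sample_size_bounds (R : realType) (D zeta C eps delta : R) (n : nat) :
  0 < D -> 0 < zeta -> 0 < eps ->
  25 * D * Num.max 1 (2 * C / zeta * ln (2 * D / delta)) / eps ^+ 2 <= n%:R ->
  25 * D <= n%:R * eps ^+ 2 /\
  50 * (C * (D / zeta)) * ln (2 * D / delta) <= n%:R * eps ^+ 2.
Proof.
move=> D0 z0 e0; rewrite ler_pdivrMr ?exprn_gt0 // => hn.
have D25 : 0 <= 25 * D by rewrite mulr_ge0 // ltW.
split; apply: le_trans hn.
  by rewrite ler_peMr // le_max lexx.
have -> : 50 * (C * (D / zeta)) * ln (2 * D / delta) =
  25 * D * (2 * C / zeta * ln (2 * D / delta)) by field; rewrite gt_eqF.
by rewrite ler_wpM2l // le_max lexx orbT.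
Qed.

Theorem theorem5p4 (dm : measure_display) (T : measurableType dm)
  (R : realType) (P : probability T R)
  (d : nat) (zeta : R) (hzeta : 0 < zeta <= d%:R)
  (psi0 : {RV P >-> R}) (C : R)
  (hmean : ('E_P[psi0] = 0)%E) (hvar : 'V_P[psi0] = 1%E)
  (hfourth : (\int[P]_x (`|psi0 x| ^+ 4)%:E)%E = C%:E)
  (n : nat)
  (xi psi : 'I_n -> 'I_d -> {RV P >-> R})
  (hxi1 : forall i j, P (xi i j @^-1` [set 1]) = (zeta / d%:R)%:E)
  (hxi0 : forall i j, P (xi i j @^-1` [set 0]) = (1 - zeta / d%:R)%:E)
  (hpsi : forall i j (B : set R), measurable B ->
     P (psi i j @^-1` B) = P (psi0 @^-1` B))
  (hindep : mutually_independent P (xipsi_family xi psi))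
  (eps delta : R) (heps : 0 < eps < 1) (hdelta : 0 < delta < 1)
  (hn : 25 * d%:R * Num.max 1 (2 * C / zeta * ln (2 * d%:R / delta)) / eps ^+ 2
          <= n%:R) :
  let w : 'I_n -> T -> 'cV[R]_d :=
    fun i x => \col_j (Num.sqrt (d%:R / zeta) * (xi i j x * psi i j x)) in
  let K : T -> 'M[R]_d :=
    fun x => n%:R^-1 *: \sum_(i < n) (w i x *m (w i x)^T) in
  exists A : set T, [/\ measurable A,
    A `<=` [set x | 1 - eps < lambda_min (K x)] &
    ((1 - delta)%:E <= P A)%E].
Proof.
case: d zeta hzeta xi psi hxi1 hxi0 hpsi hindep hn =>
  [|d'] zeta' hzeta' xi' psi' hxi1' hxi0' hpsi' hindep' hn' w K.
  by case/andP: hzeta' => z0 /(lt_le_trans z0); rewrite ltxx.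
have [z0 zd] := andP hzeta'; have [e0 e1] := andP heps.
have D0 : 0 < d'.+1%:R :> R by rewrite ltr0n.
have [nD nL] := sample_size_bounds D0 z0 e0 hn'.
have C1 : 1 <= C := kurtosis_ge1 hmean hvar hfourth.
have kappa1 : 1 <= C * (d'.+1%:R / zeta').
  apply: (le_trans C1); apply: ler_peMr; first exact: (le_trans ler01 C1).
  by rewrite ler_pdivlMr // mul1r.
have n0 : (0 < n)%N.
  rewrite lt0n; apply/eqP => n0; move: nD; rewrite n0 mul0r leNgt.
  by rewrite mulr_gt0.
have [k3 mom] := row_moments hzeta' hmean hvar hfourth hxi1' hxi0' hpsi' hindep'.
have momw k (e : 'I_d'.+1 -> nat) : (forall j, e j <= 4)%N ->
    has_mean P (fun x => \prod_j w k x j 0 ^+ e j)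
      (\prod_j pmom k3 (C * (d'.+1%:R / zeta')) (e j)).
  move=> e4; apply: has_mean_eq (mom k e e4) => x.
  by apply: eq_bigr => j _; rewrite mxE.
pose X := xipsi_family xi' psi'.
have mX q : measurable_fun setT (X q) by exact: measurable_xipsi.
have mw (A : {set 'I_n * 'I_d'.+1 * bool}) k :
    (forall q, q.1.1 = k -> q \in A) -> measurable_mx (w k : generated X A -> _).
  move=> kA i j; under eq_fun do rewrite mxE.
  apply: measurable_funM; first exact: measurable_cst.
  apply: measurable_funM.
    exact: (measurable_generated (X := X) (kA (k, i, false) erefl)).
  exact: (measurable_generated (X := X) (kA (k, i, true) erefl)).
have [N [th [N0 th0 bound]]] := trace_mean_le (row := fun q => q.1.1)
  mX hindep' mw momw heps hdelta kappa1 nD nL.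
have [th_ge0 nn0] : 0 <= th /\ 0 < N.*2%:R :> R by rewrite ltW // ltr0n double_gt0.
pose G x : 'M[R]_d'.+1 := 1 + (th / N.*2%:R) *: gram w n x.
have gramE x : gram w n x = \sum_i outer (w i x).
  by apply: eq_bigl => i; rewrite ltn_ord.
have cC x : coercive 1 (G x).
  split=> [|y]; first by rewrite /G linearD linearZ /= trmx1 gramE sym_sum_outer.
  rewrite /G qform_add qform_scale -/(nrm2 y) mul1r lerDl gramE.
  by rewrite mulr_ge0 ?qform_sum_outer_ge0 // divr_ge0 // ltW.
have mC : measurable_fun setT (fun x => \tr ((G x)^-1 ^+ N.*2)).
  apply: measurable_trace_inv_expr => [x|]; first exact: coercive_unit ltr01 (cC x).
  apply: measurable_mxD; first exact: measurable_mx_cst.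
  apply: measurable_mxZ; first exact: measurable_cst.
  rewrite (_ : gram w n = fun x => \sum_i outer (w i x)); last exact/funext.
  apply: measurable_mx_sum => i.
  have mwi := measurable_row (momw i).
  by apply: measurable_mxM => //; exact: measurable_mx_tr.
have C0 x : 0 <= \tr ((G x)^-1 ^+ N.*2) by exact: trace_inv_psd ltr01 (cC x) _.
(* The event is defined by the trace, whose measurability follows from that of the matrix entries;
   only its inclusion in the event about [lambda_min] has to be proved. *)
have [mA PA] := probability_lt_ge mC C0 (expR_gt0 _) bound.
eexists; split; [exact: mA| |exact: PA] => x /=; rewrite /G gramE => small.
(* [lambda_min_ge] gives a weak inequality with [99 / 100 * eps]; the missing hundredth makes it
   strict. *)
apply: lt_le_trans (lambda_min_ge n0 N0 th0 small).
by rewrite ltrD2l ltrN2; lra.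
Qed.
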